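(* Let $(R,\mathfrak{m})$ be a Noetherian local ring with $\operatorname{depth} R>0$, let $\widehat{R}$ be its $\mathfrak{m}$-adic completion, and let $R^*$ be the strict closure of $R$ in its integral closure $\overline{R}$. Then the following hold. (1) If $\widehat{R}$ satisfies Serre's condition $(S_1)$ and $(\sqrt{(0)})^2=(0)$ in $\widehat{R}$, then $R^*$ is a finitely generated $R$-module. (2) Suppose that $R$ is excellent and satisfies Serre's condition $(S_1)$. Then $R^*$ is a finitely generated $R$-module if and only if $(\sqrt{(0)})^2=(0)$ in $R$.
   Context: All rings are commutative. For a ring $R$, $\mathrm{Q}(R)$ denotes the total ring of fractions of $R$ and $\overline{R}$ denotes the integral closure of $R$ in $\mathrm{Q}(R)$. For an extension of commutative rings $S/R$ (i.e. $R\subseteq S$), the strict closure of $R$ in $S$ is the intermediate ring $R_S^*=\{\alpha\in S \mid \alpha\otimes 1=1\otimes\alpha \text{ in } S\otimes_R S\}$. When $S=\overline{R}$, one writes simply $R^*=R^*_{\overline{R}}$. The ideal $\sqrt{(0)}$ in a ring is the nilradical of that ring. A ring $R$ satisfies Serre's condition $(S_1)$ if every associated prime ideal of $R$ is minimal in $\operatorname{Spec} R$, i.e. $\operatorname{Ass} R=\operatorname{Min} R$. *)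

(* Defs.v *)
(* MathComp, with the classical axioms of mathcomp.classical.boolp.
   Rings are [comPzRingType]s: commutative, possibly zero (fibres and
   quotients may vanish). *)
From HB Require Import structures.
From mathcomp Require Import all_boot all_order all_algebra.
From mathcomp Require Import ring.
From mathcomp Require Import boolp classical_sets.

Set Implicit Arguments.
Unset Strict Implicit.
Unset Printing Implicit Defensive.

Import GRing.Theory.
Local Open Scope ring_scope.
Local Open Scope quotient_scope.
Local Open Scope classical_set_scope.

Record ring_pres := RingPres {
  rp_sort : choiceType;
  rp_eq : rp_sort -> rp_sort -> Prop;
  rp_zero : rp_sort;
  rp_one : rp_sort;
  rp_opp : rp_sort -> rp_sort;
  rp_add : rp_sort -> rp_sort -> rp_sort;
  rp_mul : rp_sort -> rp_sort -> rp_sort;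
  rp_refl : forall x, rp_eq x x;
  rp_sym : forall x y, rp_eq x y -> rp_eq y x;
  rp_trans : forall x y z, rp_eq x y -> rp_eq y z -> rp_eq x z;
  rp_oppP : forall x y, rp_eq x y -> rp_eq (rp_opp x) (rp_opp y);
  rp_addP : forall x y z, rp_eq x y -> rp_eq (rp_add x z) (rp_add y z);
  rp_mulP : forall x y z, rp_eq x y -> rp_eq (rp_mul x z) (rp_mul y z);
  rp_addA : forall x y z,
    rp_eq (rp_add x (rp_add y z)) (rp_add (rp_add x y) z);
  rp_addC : forall x y, rp_eq (rp_add x y) (rp_add y x);
  rp_add0 : forall x, rp_eq (rp_add rp_zero x) x;
  rp_addN : forall x, rp_eq (rp_add (rp_opp x) x) rp_zero;
  rp_mulA : forall x y z,
    rp_eq (rp_mul x (rp_mul y z)) (rp_mul (rp_mul x y) z);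
  rp_mulC : forall x y, rp_eq (rp_mul x y) (rp_mul y x);
  rp_mul1 : forall x, rp_eq (rp_mul rp_one x) x;
  rp_mulD : forall x y z,
    rp_eq (rp_mul (rp_add x y) z) (rp_add (rp_mul x z) (rp_mul y z)) }.

Section PresentedRing.
Variable P : ring_pres.

Definition rp_rel : rel (rp_sort P) := fun x y => `[< rp_eq x y >].

Lemma rp_rel_equiv : equiv_class_of rp_rel.
Proof.
split=> [x|x y|y x z].
- by apply/asboolP; apply: rp_refl.
- by apply/asboolP/asboolP; apply: rp_sym.
- by move=> /asboolP xy /asboolP yz; apply/asboolP; apply: rp_trans yz.
Qed.

Canonical rp_rel_canonical := EquivRelPack rp_rel_equiv.

Definition pres_ring := {eq_quot rp_rel}.
HB.instance Definition _ := Choice.on pres_ring.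

Definition rp_class (x : rp_sort P) : pres_ring := \pi x.

Lemma rp_classP x y : rp_class x = rp_class y <-> rp_eq x y.
Proof.
split=> [/eqquotP|] xy; first exact/asboolP.
by apply/eqquotP; apply/asboolP.
Qed.

Lemma rp_class_surj (z : pres_ring) : exists x, z = rp_class x.
Proof. by exists (repr z); rewrite /rp_class reprK. Qed.

Let rp_repr x : rp_eq (repr (rp_class x)) x.
Proof. by apply/rp_classP; rewrite /rp_class reprK. Qed.

Definition pr_zero : pres_ring := rp_class (rp_zero P).
Definition pr_one : pres_ring := rp_class (rp_one P).
Definition pr_opp (x : pres_ring) : pres_ring := rp_class (rp_opp (repr x)).
Definition pr_add (x y : pres_ring) : pres_ring :=
  rp_class (rp_add (repr x) (repr y)).
Definition pr_mul (x y : pres_ring) : pres_ring :=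
  rp_class (rp_mul (repr x) (repr y)).

Lemma pr_oppE x : pr_opp (rp_class x) = rp_class (rp_opp x).
Proof. by apply/rp_classP/rp_oppP/rp_repr. Qed.

Lemma pr_addE x y : pr_add (rp_class x) (rp_class y) = rp_class (rp_add x y).
Proof.
apply/rp_classP; apply: rp_trans (rp_addP _ (rp_repr x)) _.
apply: rp_trans (rp_addC _ _) _; apply: rp_trans (rp_addP _ (rp_repr y)) _.
exact: rp_addC.
Qed.

Lemma pr_mulE x y : pr_mul (rp_class x) (rp_class y) = rp_class (rp_mul x y).
Proof.
apply/rp_classP; apply: rp_trans (rp_mulP _ (rp_repr x)) _.
apply: rp_trans (rp_mulC _ _) _; apply: rp_trans (rp_mulP _ (rp_repr y)) _.
exact: rp_mulC.
Qed.

Let prE := (pr_oppE, pr_addE, pr_mulE).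

Lemma pr_addA : associative pr_add.
Proof.
move=> x y z; have [[a ->] [b ->] [c ->]] :=
  And3 (rp_class_surj x) (rp_class_surj y) (rp_class_surj z).
by rewrite !prE; apply/rp_classP/rp_addA.
Qed.

Lemma pr_addC : commutative pr_add.
Proof.
move=> x y; have [[a ->] [b ->]] := conj (rp_class_surj x) (rp_class_surj y).
by rewrite !prE; apply/rp_classP/rp_addC.
Qed.

Lemma pr_add0 : left_id pr_zero pr_add.
Proof.
by move=> x; have [a ->] := rp_class_surj x; rewrite !prE; apply/rp_classP/rp_add0.
Qed.

Lemma pr_addN : left_inverse pr_zero pr_opp pr_add.
Proof.
by move=> x; have [a ->] := rp_class_surj x; rewrite !prE; apply/rp_classP/rp_addN.
Qed.

Lemma pr_mulA : associative pr_mul.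
Proof.
move=> x y z; have [[a ->] [b ->] [c ->]] :=
  And3 (rp_class_surj x) (rp_class_surj y) (rp_class_surj z).
by rewrite !prE; apply/rp_classP/rp_mulA.
Qed.

Lemma pr_mulC : commutative pr_mul.
Proof.
move=> x y; have [[a ->] [b ->]] := conj (rp_class_surj x) (rp_class_surj y).
by rewrite !prE; apply/rp_classP/rp_mulC.
Qed.

Lemma pr_mul1 : left_id pr_one pr_mul.
Proof.
by move=> x; have [a ->] := rp_class_surj x; rewrite !prE; apply/rp_classP/rp_mul1.
Qed.

Lemma pr_mulD : left_distributive pr_mul pr_add.
Proof.
move=> x y z; have [[a ->] [b ->] [c ->]] :=
  And3 (rp_class_surj x) (rp_class_surj y) (rp_class_surj z).
by rewrite !prE; apply/rp_classP/rp_mulD.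
Qed.

HB.instance Definition _ := GRing.isZmodule.Build pres_ring
  pr_addA pr_addC pr_add0 pr_addN.
HB.instance Definition _ := GRing.Zmodule_isComPzRing.Build pres_ring
  pr_mulA pr_mulC pr_mul1 pr_mulD.

Lemma rp_class0 : rp_class (rp_zero P) = 0. Proof. by []. Qed.
Lemma rp_class1 : rp_class (rp_one P) = 1. Proof. by []. Qed.
Lemma rp_classN x : rp_class (rp_opp x) = - rp_class x.
Proof. by rewrite -pr_oppE. Qed.
Lemma rp_classD x y : rp_class (rp_add x y) = rp_class x + rp_class y.
Proof. by rewrite -pr_addE. Qed.
Lemma rp_classM x y : rp_class (rp_mul x y) = rp_class x * rp_class y.
Proof. by rewrite -pr_mulE. Qed.

End PresentedRing.

Identity Coercion set_to_fun : set >-> Funclass.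

Record ideal (A : comPzRingType) := Ideal {
  ideal_set :> set A;
  ideal0 : ideal_set 0;
  idealD : forall x y, ideal_set x -> ideal_set y -> ideal_set (x + y);
  idealM : forall a x, ideal_set x -> ideal_set (a * x) }.

Section Ideals.
Variable A : comPzRingType.
Implicit Types (I J : ideal A) (X : set A).

Lemma idealN I x : I x -> I (- x).
Proof. by move=> Ix; rewrite -mulN1r; apply: idealM. Qed.

Definition ideal_gen X : ideal A.
Proof.
exists [set x | forall I : ideal A, X `<=` I -> I x].
- by move=> I _; apply: ideal0.
- by move=> x y Ix Iy I XI; apply: idealD; [apply: Ix|apply: Iy].
- by move=> a x Ix I XI; apply: idealM; apply: Ix.
Defined.

Definition ideal_span (s : seq A) : ideal A := ideal_gen [set x | x \in s].

Definition ideal_mul X1 X2 : ideal A :=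
  ideal_gen [set z | exists x y, [/\ X1 x, X2 y & z = x * y]].

Fixpoint ideal_exp I (n : nat) : ideal A :=
  if n is k.+1 then ideal_mul I (ideal_exp I k) else ideal_gen setT.

Definition prime_ideal I : Prop :=
  ~ I 1 /\ forall x y, I (x * y) -> I x \/ I y.

Definition maximal_ideal I : Prop :=
  ~ I 1 /\ forall J, I `<=` J -> ~ J 1 -> J `<=` I.

Definition local_ring I : Prop :=
  maximal_ideal I /\ forall J, maximal_ideal J -> (J : set A) = I.

Definition nilradical : set A := [set x | exists n, x ^+ n = 0].

Definition ann (x : A) : set A := [set a | a * x = 0].

End Ideals.

Definition noetherian (A : comPzRingType) : Prop :=
  forall I : ideal A, exists s : seq A, (I : set A) = ideal_span s.

Definition nilradical_sq0 (A : comPzRingType) : Prop :=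
  (ideal_mul (@nilradical A) (@nilradical A) : set A) = [set 0].

Record spec (A : comPzRingType) := Spec {
  spec_ideal :> ideal A;
  specP : prime_ideal spec_ideal }.

Section Spectrum.
Variable A : comPzRingType.
Implicit Types (p q : spec A).

Definition associated_prime p : Prop := exists x : A, (p : set A) = ann x.

Definition minimal_prime p : Prop := forall q, q `<=` p -> p `<=` q.

Definition serre_S1 : Prop := forall p, associated_prime p -> minimal_prime p.

Definition regular_sequence (s : seq A) : Prop :=
  ~ ideal_span s 1 /\
  forall i, (i < size s)%N -> forall x : A,
    ideal_span (take i s) (s`_i * x) -> ideal_span (take i s) x.

(* The depth of a local ring being the supremum of the lengths of the regular
   sequences in its maximal ideal m, it is greater than n iff one of these
   lengths is. *)
Definition depth_gt (m : ideal A) (n : nat) : Prop :=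
  exists s : seq A, [/\ (n < size s)%N, [set x | x \in s] `<=` m
                      & regular_sequence s].

Definition prime_chain (c : nat -> spec A) (n : nat) : Prop :=
  forall i, (i < n)%N -> (c i : set A) `<` c i.+1.

Definition krull_dim (n : nat) : Prop :=
  (exists c, prime_chain c n) /\
  (forall c k, prime_chain c k -> (k <= n)%N).

Definition saturated_chain p q (n : nat) : Prop :=
  exists c : nat -> spec A,
    [/\ c 0%N = p, c n = q, prime_chain c n
      & forall i, (i < n)%N ->
          ~ exists r : spec A, (c i : set A) `<` r /\ (r : set A) `<` c i.+1].

Definition catenary : Prop :=
  forall p q, p `<=` q -> exists! n, saturated_chain p q n.

Definition open_spec (U : set (spec A)) : Prop :=
  exists I : ideal A, U = [set p : spec A | ~ (I `<=` p)].

End Spectrum.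

Section Quotient.
Variables (A : comPzRingType) (I : ideal A).

Definition quot_pres : ring_pres.
Proof.
refine (@RingPres A (fun x y => I (x - y)) 0 1 -%R +%R *%R
          _ _ _ _ _ _ _ _ _ _ _ _ _ _).
- by move=> x; rewrite subrr; apply: ideal0.
- by move=> x y /idealN; rewrite opprB.
- by move=> x y z xy /(idealD xy); rewrite addrA subrK.
- by move=> x y /idealN; rewrite opprD.
- by move=> x y z; rewrite opprD addrACA subrr addr0.
- by move=> x y z /(idealM z); rewrite mulrBr ![z * _]mulrC.
- by move=> x y z; rewrite addrA subrr; apply: ideal0.
- by move=> x y; rewrite [x + y]addrC subrr; apply: ideal0.
- by move=> x; rewrite add0r subrr; apply: ideal0.
- by move=> x; rewrite addNr subrr; apply: ideal0.
- by move=> x y z; rewrite mulrA subrr; apply: ideal0.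
- by move=> x y; rewrite mulrC subrr; apply: ideal0.
- by move=> x; rewrite mul1r subrr; apply: ideal0.
- by move=> x y z; rewrite mulrDl subrr; apply: ideal0.
Defined.

Definition quot := pres_ring quot_pres.
HB.instance Definition _ := GRing.ComPzRing.on quot.

Definition to_quot (x : A) : quot := rp_class (x : rp_sort quot_pres).

Lemma to_quot_is_zmod_morphism : zmod_morphism to_quot.
Proof.
move=> x y; rewrite /to_quot -[RHS]/(rp_class (x : rp_sort quot_pres) -
  rp_class (y : rp_sort quot_pres) :> pres_ring _).
by rewrite -rp_classN -rp_classD.
Qed.

Lemma to_quot_is_monoid_morphism : monoid_morphism to_quot.
Proof.
by split=> // x y; exact: (@rp_classM quot_pres).
Qed.

HB.instance Definition _ :=
  GRing.isZmodMorphism.Build A quot to_quot to_quot_is_zmod_morphism.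
HB.instance Definition _ :=
  GRing.isMonoidMorphism.Build A quot to_quot to_quot_is_monoid_morphism.

End Quotient.

Record mult_set (A : comPzRingType) := MultSet {
  mult_set_set :> set A;
  mult_set1 : mult_set_set 1;
  mult_setM : forall x y,
    mult_set_set x -> mult_set_set y -> mult_set_set (x * y) }.

Section Localization.
Variables (A : comPzRingType) (S : mult_set A).

Definition denom := {s : A | `[< S s >]}.

Lemma denomP (s : denom) : S (sval s).
Proof. exact/asboolP/(valP s). Qed.

Definition mk_denom s (Ss : S s) : denom := exist _ s (asboolT Ss).

Definition denomM (s t : denom) : denom :=
  mk_denom (mult_setM (denomP s) (denomP t)).

Definition loc_eq (x y : A * denom) : Prop :=
  exists2 u, S u & u * (x.1 * sval y.2 - y.1 * sval x.2) = 0.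

Let loc_eq_cross x y : x.1 * sval y.2 = y.1 * sval x.2 -> loc_eq x y.
Proof. by move=> xy; exists 1; [exact: mult_set1|rewrite xy subrr mulr0]. Qed.

Definition loc_pres : ring_pres.
Proof.
refine (@RingPres (A * denom)%type loc_eq
  (0, mk_denom (mult_set1 S)) (1, mk_denom (mult_set1 S))
  (fun x => (- x.1, x.2))
  (fun x y => (x.1 * sval y.2 + y.1 * sval x.2, denomM x.2 y.2))
  (fun x y => (x.1 * y.1, denomM x.2 y.2)) _ _ _ _ _ _ _ _ _ _ _ _ _ _).
- by move=> x; apply: loc_eq_cross.
- by move=> x y [u Su uxy]; exists u => //; rewrite -opprB mulrN uxy oppr0.
- move=> x y z [u Su uxy] [v Sv vyz]; exists (u * v * sval y.2).
    by do ?apply: mult_setM => //; apply: denomP.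
  transitivity (v * sval z.2 * (u * (x.1 * sval y.2 - y.1 * sval x.2)) +
                u * sval x.2 * (v * (y.1 * sval z.2 - z.1 * sval y.2))).
    by ring.
  by rewrite uxy vyz !mulr0 addr0.
- move=> x y [u Su uxy]; exists u => //=.
  by rewrite !mulNr -opprD mulrN uxy oppr0.
- move=> x y z [u Su uxy]; exists u => //=.
  transitivity (sval z.2 * sval z.2 * (u * (x.1 * sval y.2 - y.1 * sval x.2))).
    by ring.
  by rewrite uxy mulr0.
- move=> x y z [u Su uxy]; exists u => //=.
  transitivity (z.1 * sval z.2 * (u * (x.1 * sval y.2 - y.1 * sval x.2))).
    by ring.
  by rewrite uxy mulr0.
- by move=> x y z; apply: loc_eq_cross => /=; ring.
- by move=> x y; apply: loc_eq_cross => /=; ring.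
- by move=> x; apply: loc_eq_cross => /=; ring.
- by move=> x; apply: loc_eq_cross => /=; ring.
- by move=> x y z; apply: loc_eq_cross => /=; ring.
- by move=> x y; apply: loc_eq_cross => /=; ring.
- by move=> x; apply: loc_eq_cross => /=; ring.
- by move=> x y z; apply: loc_eq_cross => /=; ring.
Defined.

Definition loc := pres_ring loc_pres.
HB.instance Definition _ := GRing.ComPzRing.on loc.

Definition to_loc (x : A) : loc :=
  rp_class ((x, mk_denom (mult_set1 S)) : rp_sort loc_pres).

Lemma to_loc_is_zmod_morphism : zmod_morphism to_loc.
Proof.
move=> x y; rewrite /to_loc -[RHS]/(rp_class (_ : rp_sort loc_pres) -
  rp_class (_ : rp_sort loc_pres) :> pres_ring _).
rewrite -rp_classN -rp_classD; apply/rp_classP.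
by apply: loc_eq_cross => /=; ring.
Qed.

Lemma to_loc_is_monoid_morphism : monoid_morphism to_loc.
Proof.
split=> // x y; rewrite /to_loc -[RHS]/(rp_class (_ : rp_sort loc_pres) *
  rp_class (_ : rp_sort loc_pres) :> pres_ring _).
rewrite -rp_classM; apply/rp_classP.
by apply: loc_eq_cross => /=; ring.
Qed.

HB.instance Definition _ :=
  GRing.isZmodMorphism.Build A loc to_loc to_loc_is_zmod_morphism.
HB.instance Definition _ :=
  GRing.isMonoidMorphism.Build A loc to_loc to_loc_is_monoid_morphism.

End Localization.

Definition prime_compl (A : comPzRingType) (p : spec A) : mult_set A.
Proof.
exists [set s | ~ p s]; first by case: (specP p).
by move=> x y px py; have [_ pM] := specP p => /pM[].
Defined.

Definition loc_prime (A : comPzRingType) (p : spec A) :=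
  loc (prime_compl p).
HB.instance Definition _ (A : comPzRingType) (p : spec A) :=
  GRing.ComPzRing.on (loc_prime p).

Definition to_loc_prime (A : comPzRingType) (p : spec A) :
  {rmorphism A -> loc_prime p} := to_loc (prime_compl p).

Definition loc_prime_ideal (A : comPzRingType) (p : spec A) :
  ideal (loc_prime p) := ideal_gen (to_loc_prime p @` p).

Definition residue_field (A : comPzRingType) (p : spec A) :=
  quot (loc_prime_ideal p).
HB.instance Definition _ (A : comPzRingType) (p : spec A) :=
  GRing.ComPzRing.on (residue_field p).

Definition to_residue_field (A : comPzRingType) (p : spec A) :
    {rmorphism A -> residue_field p} :=
  to_quot (loc_prime_ideal p) \o to_loc_prime p.

Definition nonzerodivisors (A : comPzRingType) : mult_set A.
Proof.
exists [set s | forall x, s * x = 0 -> x = 0].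
  by move=> x; rewrite mul1r.
by move=> s t sP tP x; rewrite -mulrA => /sP/tP.
Defined.

Section IntegralClosure.
Variable R : comNzRingType.

Definition total_frac := loc (nonzerodivisors R).
HB.instance Definition _ := GRing.ComPzRing.on total_frac.

Lemma total_frac1_neq0 : (1 : total_frac) != 0.
Proof.
apply/eqP => /(rp_classP (P := loc_pres (nonzerodivisors R))) [u uP].
rewrite /= mul1r mul0r subr0 => /uP/eqP; exact/negP/oner_neq0.
Qed.
HB.instance Definition _ :=
  GRing.PzSemiRing_isNonZero.Build total_frac total_frac1_neq0.

Definition to_total_frac : {rmorphism R -> total_frac} :=
  to_loc (nonzerodivisors R).

Definition integral_pred : {pred total_frac} :=
  fun x => `[< integralOver to_total_frac x >].

Lemma integral_subring : subring_closed integral_pred.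
Proof.
split=> [|x y /asboolP xP /asboolP yP|x y /asboolP xP /asboolP yP].
- by apply/asboolP/integral1.
- by apply/asboolP; apply: (integral_sub xP yP).
- by apply/asboolP; apply: (integral_mul xP yP).
Qed.
HB.instance Definition _ :=
  GRing.isSubringClosed.Build total_frac integral_pred integral_subring.

Definition int_closure := {x : total_frac | x \in integral_pred}.
HB.instance Definition _ := [isSub of int_closure for sval].
HB.instance Definition _ := [Choice of int_closure by <:].
HB.instance Definition _ := [SubChoice_isSubComNzRing of int_closure by <:].

Definition to_int_closure (x : R) : int_closure :=
  exist _ (to_total_frac x) (asboolT (integral_id to_total_frac x)).

Lemma to_int_closure_is_zmod_morphism : zmod_morphism to_int_closure.
Proof. by move=> x y; apply/val_inj; rewrite /= rmorphB. Qed.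

Lemma to_int_closure_is_monoid_morphism : monoid_morphism to_int_closure.
Proof.
by split=> [|x y]; apply/val_inj; rewrite /= ?rmorph1 ?rmorphM.
Qed.

HB.instance Definition _ :=
  GRing.isZmodMorphism.Build R int_closure to_int_closure
    to_int_closure_is_zmod_morphism.
HB.instance Definition _ :=
  GRing.isMonoidMorphism.Build R int_closure to_int_closure
    to_int_closure_is_monoid_morphism.

End IntegralClosure.

Section Tensor.
Variables (R A B : comPzRingType).
Variables (f : {rmorphism R -> A}) (g : {rmorphism R -> B}).

(* A (x)_R B is presented on formal sums of pairs (a, b), written as
   sequences, by the congruence that the bilinearity relations generate. *)
Inductive tens_eq : seq (A * B) -> seq (A * B) -> Prop :=
| tens_refl s : tens_eq s s
| tens_sym s t : tens_eq s t -> tens_eq t s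
| tens_trans s t u : tens_eq s t -> tens_eq t u -> tens_eq s u
| tens_cat s s' t t' :
    tens_eq s s' -> tens_eq t t' -> tens_eq (s ++ t) (s' ++ t')
| tens_catC s t : tens_eq (s ++ t) (t ++ s)
| tens_0l b : tens_eq [:: (0, b)] [::]
| tens_Dl a a' b : tens_eq [:: (a + a', b)] [:: (a, b); (a', b)]
| tens_Dr a b b' : tens_eq [:: (a, b + b')] [:: (a, b); (a, b')]
| tens_scale r a b : tens_eq [:: (f r * a, b)] [:: (a, g r * b)].

Definition pairM (x y : A * B) : A * B := (x.1 * y.1, x.2 * y.2).

Definition tens_opp (s : seq (A * B)) := [seq (- x.1, x.2) | x <- s].

Definition tens_mul (s t : seq (A * B)) := [seq pairM x y | x <- s, y <- t].

Let tens_perm s t : perm_eq s t -> tens_eq s t.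
Proof.
elim: s t => [t|x s IH t st].
  by rewrite perm_sym => /perm_nilP ->; apply: tens_refl.
have /path.splitPr tE : x \in t by rewrite -(perm_mem st) mem_head.
case: tE st => t1 t2 st.
have {}st : perm_eq s (t2 ++ t1).
  by move: st; rewrite perm_sym perm_catC cat_cons perm_cons perm_sym.
apply: tens_trans (tens_catC (x :: t2) t1).
exact: (tens_cat (tens_refl [:: x]) (IH _ st)).
Qed.

Let tens_map (h : A * B -> A * B) :
    (forall b, exists b', h (0, b) = (0, b')) ->
    (forall a a' b, exists c c' d, [/\ h (a, b) = (c, d), h (a', b) = (c', d)
       & h (a + a', b) = (c + c', d)]) ->
    (forall a b b', exists c d d', [/\ h (a, b) = (c, d), h (a, b') = (c, d')
       & h (a, b + b') = (c, d + d')]) ->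
    (forall r a b, exists c d, h (f r * a, b) = (f r * c, d) /\
       h (a, g r * b) = (c, g r * d)) ->
  forall s t, tens_eq s t -> tens_eq (map h s) (map h t).
Proof.
move=> h0 hDl hDr hS s t; elim=> {s t}.
- by move=> s; apply: tens_refl.
- by move=> s t _; apply: tens_sym.
- by move=> s t u _ st _; apply: tens_trans.
- by move=> s s' t t' _ ? _ ?; rewrite !map_cat; apply: tens_cat.
- by move=> s t; rewrite !map_cat; apply: tens_catC.
- by move=> b /=; have [b' ->] := h0 b; apply: tens_0l.
- move=> a a' b /=; have [c [c' [d [-> -> ->]]]] := hDl a a' b.
  exact: tens_Dl.
- move=> a b b' /=; have [c [d [d' [-> -> ->]]]] := hDr a b b'.
  exact: tens_Dr.
- by move=> r a b /=; have [c [d [-> ->]]] := hS r a b; apply: tens_scale.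
Qed.

Let tens_mapM s t y :
  tens_eq s t -> tens_eq (map (pairM ^~ y) s) (map (pairM ^~ y) t).
Proof.
apply: tens_map => [b|a a' b|a b b'|r a b]; rewrite /pairM /=.
- by exists (b * y.2); rewrite mul0r.
- by exists (a * y.1), (a' * y.1), (b * y.2); rewrite mulrDl.
- by exists (a * y.1), (b * y.2), (b' * y.2); rewrite mulrDl.
- by exists (a * y.1), (b * y.2); rewrite !mulrA.
Qed.

Let tens_mulC s t : tens_eq (tens_mul s t) (tens_mul t s).
Proof.
apply: tens_perm; elim: s => [|x s IH].
  by rewrite /tens_mul; elim: t.
rewrite /tens_mul perm_sym.
rewrite (perm_allpairs_consr pairM t (fun=> x) (fun=> s)) perm_sym /=.
rewrite (eq_map (_ : pairM x =1 pairM ^~ x)) ?perm_cat2l //.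
by move=> y; rewrite /pairM mulrC [_ * y.2]mulrC.
Qed.

Let tens_mul_catl s s' t :
  tens_mul (s ++ s') t = tens_mul s t ++ tens_mul s' t.
Proof. exact: allpairs_cat. Qed.

Let tens_mulA s t u :
  tens_mul s (tens_mul t u) = tens_mul (tens_mul s t) u.
Proof.
elim: s => //= x s IH; rewrite [tens_mul (_ :: s) t]/= tens_mul_catl -IH.
congr (_ ++ _); elim: t {IH} => //= y t IH.
rewrite [tens_mul (y :: t) u]/= map_cat IH; congr (_ ++ _).
by rewrite -map_comp; apply: eq_map => z; rewrite /= /pairM !mulrA.
Qed.

Definition tens_pres : ring_pres.
Proof.
refine (@RingPres (seq (A * B)) tens_eq [::] [:: (1, 1)] tens_opp cat tens_mul
  tens_refl tens_sym tens_trans _ _ _ _ tens_catC _ _ _ _ _ _).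
- move=> s t; apply: tens_map => [b|a a' b|a b b'|r a b] /=.
  + by exists b; rewrite oppr0.
  + by exists (- a), (- a'), b; rewrite opprD.
  + by exists (- a), b, b'.
  + by exists (- a), b; rewrite mulrN.
- by move=> s t u st; apply: tens_cat st (tens_refl _).
- move=> s s' t ss'; apply: tens_trans (tens_mulC _ _) _.
  apply: tens_trans (tens_mulC _ _); elim: t => [|y t IH].
    exact: tens_refl.
  apply: tens_cat IH.
  have E v : [seq pairM y x | x <- v] = map (pairM ^~ y) v.
    by apply: eq_map => x; rewrite /pairM mulrC [_ * x.2]mulrC.
  by rewrite !E; apply: tens_mapM.
- by move=> s t u; rewrite catA; apply: tens_refl.
- by move=> s; apply: tens_refl.
- elim=> [|[a b] s IH]; first exact: tens_refl.
  have ab0 : tens_eq [:: (- a, b); (a, b)] [::].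
    by apply: tens_trans (tens_sym (tens_Dl _ _ _)) _; rewrite addNr;
       apply: tens_0l.
  apply: tens_trans (_ : tens_eq ([:: (- a, b); (a, b)] ++ (tens_opp s ++ s)) _).
    apply: tens_perm; rewrite /= perm_cons.
    by rewrite -[(a, b) :: s]cat1s perm_catCA.
  exact: (tens_cat ab0 IH).
- by move=> s t u; rewrite tens_mulA; apply: tens_refl.
- exact: tens_mulC.
- move=> s; rewrite /tens_mul /= cats0 -[X in tens_eq _ X]map_id.
  rewrite (eq_map (_ : _ =1 id)); first exact: tens_refl.
  by case=> a b; rewrite /pairM /= !mul1r.
- by move=> s t u; rewrite tens_mul_catl; apply: tens_refl.
Defined.

Definition tensor := pres_ring tens_pres.
HB.instance Definition _ := GRing.ComPzRing.on tensor.

Definition tens (a : A) (b : B) : tensor :=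
  rp_class ([:: (a, b)] : rp_sort tens_pres).

Definition tens_inr (b : B) : tensor := tens 1 b.

Let tensNr a b : tens a (- b) = tens (- a) b.
Proof.
apply/rp_classP.
have := tens_scale (-1) a b; rewrite !rmorphN !rmorph1 !mulN1r.
exact: tens_sym.
Qed.

Lemma tens_inr_is_zmod_morphism : zmod_morphism tens_inr.
Proof.
move=> x y; have <- : tens_inr (- y) = - tens_inr y.
  rewrite /tens_inr tensNr.
  exact: (rp_classN ([:: (1, y)] : rp_sort tens_pres)).
rewrite /tens_inr -[RHS](@rp_classD tens_pres); apply/rp_classP.
exact: tens_Dr.
Qed.

Lemma tens_inr_is_monoid_morphism : monoid_morphism tens_inr.
Proof.
split=> // x y; rewrite /tens_inr -[RHS](@rp_classM tens_pres).
by apply/rp_classP; rewrite /= /tens_mul /= /pairM mulr1; apply: tens_refl.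
Qed.

HB.instance Definition _ :=
  GRing.isZmodMorphism.Build B tensor tens_inr tens_inr_is_zmod_morphism.
HB.instance Definition _ :=
  GRing.isMonoidMorphism.Build B tensor tens_inr tens_inr_is_monoid_morphism.

End Tensor.

Section Algebra.
Variables (R S : comPzRingType) (f : {rmorphism R -> S}).

Definition fg_submodule (M : set S) : Prop :=
  exists (n : nat) (x : 'I_n -> S),
    M = [set \sum_i f (c i) * x i | c in [set: 'I_n -> R]].

Definition finite_algebra : Prop := fg_submodule setT.

Definition finite_type_algebra : Prop :=
  exists s : seq S, forall P : {pred S}, subring_closed P ->
    (forall r, f r \in P) -> {subset s <= P} -> forall y, y \in P.

(* R^*_S, where f : R -> S is the inclusion when S is an extension of R. *)
Definition strict_closure : set S :=
  [set a | tens f f a 1 = tens f f 1 a].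

End Algebra.

Section Completion.
Variables (A : comPzRingType) (I : ideal A).

(* The inverse limit of the rings A / I^n: as I^(n+1) is contained in I^n,
   an element of A / I^(n+1) maps to an element of A / I^n iff they have
   a common representative. *)
Record completion := Completion {
  cmpl_val :> forall n, quot (ideal_exp I n);
  cmplP : forall n, exists x : A,
    cmpl_val n = to_quot _ x /\ cmpl_val n.+1 = to_quot _ x }.

HB.instance Definition _ := gen_eqMixin completion.
HB.instance Definition _ := gen_choiceMixin completion.

Lemma cmpl_inj (u v : completion) : (forall n, u n = v n) -> u = v.
Proof.
case: u v => [u uP] [v vP] /= uv.
have {}uv : u = v by apply: functional_extensionality_dep.
by move: vP; rewrite -uv => vP; congr Completion; apply: Prop_irrelevance.
Qed.

Definition to_completion (x : A) : completion.
Proof. by exists (fun n => to_quot _ x) => n; exists x. Defined.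

Definition cmpl_opp (u : completion) : completion.
Proof.
exists (fun n => - u n) => n; have [x [-> ->]] := cmplP u n.
by exists (- x); rewrite !rmorphN.
Defined.

Definition cmpl_add (u v : completion) : completion.
Proof.
exists (fun n => u n + v n) => n.
have [[x [-> ->]] [y [-> ->]]] := conj (cmplP u n) (cmplP v n).
by exists (x + y); rewrite !rmorphD.
Defined.

Definition cmpl_mul (u v : completion) : completion.
Proof.
exists (fun n => u n * v n) => n.
have [[x [-> ->]] [y [-> ->]]] := conj (cmplP u n) (cmplP v n).
by exists (x * y); rewrite !rmorphM.
Defined.

Lemma cmpl_addA : associative cmpl_add.
Proof. by move=> u v w; apply: cmpl_inj => n /=; rewrite addrA. Qed.
Lemma cmpl_addC : commutative cmpl_add.
Proof. by move=> u v; apply: cmpl_inj => n /=; rewrite addrC. Qed.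
Lemma cmpl_add0 : left_id (to_completion 0) cmpl_add.
Proof. by move=> u; apply: cmpl_inj => n /=; rewrite rmorph0 add0r. Qed.
Lemma cmpl_addN : left_inverse (to_completion 0) cmpl_opp cmpl_add.
Proof. by move=> u; apply: cmpl_inj => n /=; rewrite rmorph0 addNr. Qed.
Lemma cmpl_mulA : associative cmpl_mul.
Proof. by move=> u v w; apply: cmpl_inj => n /=; rewrite mulrA. Qed.
Lemma cmpl_mulC : commutative cmpl_mul.
Proof. by move=> u v; apply: cmpl_inj => n /=; rewrite mulrC. Qed.
Lemma cmpl_mul1 : left_id (to_completion 1) cmpl_mul.
Proof. by move=> u; apply: cmpl_inj => n /=; rewrite rmorph1 mul1r. Qed.
Lemma cmpl_mulD : left_distributive cmpl_mul cmpl_add.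
Proof. by move=> u v w; apply: cmpl_inj => n /=; rewrite mulrDl. Qed.

HB.instance Definition _ := GRing.isZmodule.Build completion
  cmpl_addA cmpl_addC cmpl_add0 cmpl_addN.
HB.instance Definition _ := GRing.Zmodule_isComPzRing.Build completion
  cmpl_mulA cmpl_mulC cmpl_mul1 cmpl_mulD.

Lemma to_completion_is_zmod_morphism : zmod_morphism to_completion.
Proof. by move=> x y; apply: cmpl_inj => n /=; rewrite rmorphB. Qed.

Lemma to_completion_is_monoid_morphism : monoid_morphism to_completion.
Proof.
by split=> // x y; apply: cmpl_inj => n /=; rewrite rmorphM.
Qed.

HB.instance Definition _ :=
  GRing.isZmodMorphism.Build A completion to_completion
    to_completion_is_zmod_morphism.
HB.instance Definition _ :=
  GRing.isMonoidMorphism.Build A completion to_completion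
    to_completion_is_monoid_morphism.

End Completion.

Definition regular_local (A : comPzRingType) : Prop :=
  noetherian A /\
  exists (m : ideal A) (s : seq A),
    [/\ local_ring m, krull_dim A (size s) & (m : set A) = ideal_span s].

Definition regular_locus (A : comPzRingType) : set (spec A) :=
  [set p | regular_local (loc_prime p)].

Definition regular_ring (A : comPzRingType) : Prop :=
  noetherian A /\ @regular_locus A = setT.

(* Meant for a field k. *)
Definition geometrically_regular (k B : comPzRingType)
    (g : {rmorphism k -> B}) : Prop :=
  forall (L : fieldType) (h : {rmorphism k -> L}),
    finite_algebra h -> regular_ring (tensor g h).

(* For every prime q of A, the fibre B (x)_A kappa(q) is geometrically
   regular over kappa(q). *)
Definition geometrically_regular_fibres (A B : comPzRingType)
    (f : {rmorphism A -> B}) : Prop :=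
  forall q : spec A,
    geometrically_regular (tens_inr f (to_residue_field q)).

Definition universally_catenary (A : comPzRingType) : Prop :=
  forall (B : comPzRingType) (f : {rmorphism A -> B}),
    finite_type_algebra f -> catenary B.

Definition G_ring (A : comPzRingType) : Prop :=
  forall p : spec A,
    geometrically_regular_fibres (to_completion (loc_prime_ideal p)).

Definition J2_ring (A : comPzRingType) : Prop :=
  forall (B : comPzRingType) (f : {rmorphism A -> B}),
    finite_type_algebra f -> open_spec (@regular_locus B).

Definition excellent (A : comPzRingType) : Prop :=
  [/\ noetherian A, universally_catenary A, G_ring A & J2_ring A].

(* Main.v *)
Require Import Defs.
From HB Require Import structures.
From mathcomp Require Import all_boot all_order all_algebra.
From mathcomp Require Import zify ring.
From mathcomp Require Import boolp classical_sets.

Set Implicit Arguments.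
Unset Strict Implicit.
Unset Printing Implicit Defensive.

Import GRing.Theory.
Local Open Scope ring_scope.

(** Let [T] be the completion of [R], [Q] its total ring of fractions, [N] the
    nilradical of [T], and [N'] the set of nilpotents of [Q].

    Part (1). The integral closure [B] of [T] in [Q] need not be finite, but it is
    finite modulo [N'] ([integral_mod_nil_fin]): its image lies in the product of
    the normalizations of the complete local domains [T / P], for the minimal
    primes [P], and these are finite. Hence some nonzerodivisor [x] satisfies
    [x b = r + n] with [r] in [T] and [n] in [N'], for every [b] in [B]; write
    [nu b] for [n], which is well defined modulo [N]. As [N ^ 2 = 0], also
    [N' ^ 2 = 0], and [x] multiplies [B N] into [N]. So [(a, b) |-> a * nu b] is
    biadditive and balanced over [R] modulo the elements that [x] multiplies into
    [N]. An element [a] of the strict closure satisfies [a (x) 1 = 1 (x) a], and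
    this forces [x * nu a] to lie in [N] ([strict_closure_conductor]). The same
    follows for the span [M] of the strict closure over [T], where [nu q = x q] if
    [q] is nilpotent: thus [x ^ 2] embeds the nilpotents of [M] in the Noetherian
    module [N], while [M] modulo nilpotents is finite like [B]. So [M] is finite,
    generated by finitely many elements of the strict closure, and these generate it
    over [R] because ideals of [R] are contracted from [T] ([strict_closure_fg]).

    The finiteness of the normalization of a complete local domain [D]
    ([complete_domain_finite]) is proved in mixed and equal characteristic at
    once. A coefficient ring [L] of [D], a field or a discrete valuation ring, is the
    intersection of a decreasing sequence of subrings, each of which is a maximal
    subring of the preceding one that meets the maximal ideal in as little as
    possible ([coefficient_ring]). Noether normalization makes [D] finite over a
    ring of power series over [L] ([normalization_exists]). For the latter, a
    property slightly stronger than finiteness of integral closures passes from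
    [A / x] to [A] whenever [x] is a prime element along which [A] is complete
    ([finite_closures_adic], after Tate), so the variables are added one by one.

    Part (2), finiteness implies that the nilradical has square zero. Nilpotent
    fractions are integral, and [n n' (x) 1 = n (x) n' = 1 (x) n n'] for two of them,
    since denominators can be moved from one factor to the other. So such products
    lie in the strict closure, together with their quotients by all powers of a
    nonzerodivisor of the maximal ideal; if the strict closure is finite they vanish
    by Nakayama's lemma ([nilradical_sq0_of_fg]).

    Part (2), conversely. By the argument of part (1) it suffices that the nilradical
    of [T] has square zero ([completion_nilradical_sq0]). Regular local rings are
    domains ([regular_local_domain]), so the fibres of [T] over [R] are reduced;
    hence for each minimal prime [q] of [R], a nilpotent [z] of [T] has a multiple by an
    element outside [q] in [q T]. By [S_1] and prime avoidance, [z] has a multiple by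
    a nonzerodivisor of [R] in the extension of the nilradical of [R]. The product of
    two such multiples is zero, and nonzerodivisors of [R] remain so in [T]. *)

Local Open Scope classical_set_scope.

(** * Ideals and Noetherian rings *)

Section IdealArithmetic.
Variable A : comPzRingType.
Implicit Types (I J K : ideal A) (s : seq A).

Lemma ideal_sum I (n : nat) (F : 'I_n -> A) :
  (forall i, I (F i)) -> I (\sum_i F i).
Proof. by move=> IF; elim/big_ind: _ => // [|x y]; [apply: ideal0|apply: idealD]. Qed.

Lemma idealB I x y : I x -> I y -> I (x - y).
Proof. by move=> Ix Iy; apply: idealD => //; apply: idealN. Qed.

Lemma ideal_mulr I a x : I x -> I (x * a).
Proof. by rewrite mulrC; apply: idealM. Qed.

Lemma ideal_subP I x y : I (x - y) -> I y -> I x.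
Proof. by move=> Ixy Iy; rewrite -(subrK y x); apply: idealD. Qed.

Lemma ideal1 I x : I 1 -> I x.
Proof. by move=> /(idealM x); rewrite mulr1. Qed.

Lemma ideal_gen_sub (X : set A) I : X `<=` I -> ideal_gen X `<=` I.
Proof. by move=> XI x; apply. Qed.

Lemma sub_ideal_gen (X : set A) : X `<=` ideal_gen X.
Proof. by move=> x Xx I; apply. Qed.

Lemma ideal_span_comb s (c : nat -> A) :
  ideal_span s (\sum_(i < size s) c i * s`_i).
Proof.
apply: ideal_sum => i; apply: idealM; apply: sub_ideal_gen.
by rewrite /=; apply: mem_nth.
Qed.

Lemma ideal_spanP s x :
  ideal_span s x <-> exists c : nat -> A, x = \sum_(i < size s) c i * s`_i.
Proof.
split=> [xs|[c ->]]; last exact: ideal_span_comb.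
pose K : set A := [set x | exists c : nat -> A, x = \sum_(i < size s) c i * s`_i].
have K0 : K 0 by exists (fun=> 0); rewrite big1 // => i _; rewrite mul0r.
have KD x1 x2 : K x1 -> K x2 -> K (x1 + x2).
  move=> [c ->] [d ->]; exists (fun i => c i + d i).
  by rewrite -big_split; apply: eq_bigr => i _; rewrite mulrDl.
have KM a x1 : K x1 -> K (a * x1).
  move=> [c ->]; exists (fun i => a * c i).
  by rewrite big_distrr; apply: eq_bigr => i _ /=; rewrite mulrA.
apply: (xs (Ideal K0 KD KM)) => y /= /(nthP 0)[i ltis <-].
exists (fun j => (j == i)%:R); rewrite (bigD1 (Ordinal ltis)) //= eqxx mul1r.
rewrite big1 ?addr0 // => j; rewrite -val_eqE /= => /negbTE ->.
by rewrite mul0r.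
Qed.

Lemma ideal_span_mem s x : x \in s -> ideal_span s x.
Proof. by move=> xs I; apply. Qed.

Lemma ideal_span_sub s I : (forall x, x \in s -> I x) -> ideal_span s `<=` I.
Proof. by move=> sI x; apply. Qed.

Lemma ideal_span1P (a x : A) : ideal_span [:: a] x <-> exists c, x = c * a.
Proof.
split=> [/ideal_spanP[c ->]|[c ->]]; first by exists (c 0%N); rewrite big_ord1.
by apply: idealM; apply: ideal_span_mem; rewrite inE.
Qed.

Definition ideal_add I J : ideal A.
Proof.
exists [set x | exists y z, [/\ I y, J z & x = y + z]].
- by exists 0, 0; split; rewrite ?addr0 //; apply: ideal0.
- move=> _ _ [y [z [Iy Jz ->]]] [y' [z' [Iy' Jz' ->]]].
  by exists (y + y'), (z + z'); split; [apply: idealD|apply: idealD|rewrite addrACA].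
- move=> a _ [y [z [Iy Jz ->]]].
  by exists (a * y), (a * z); split; [apply: idealM|apply: idealM|rewrite mulrDr].
Defined.

Lemma ideal_addl I J : I `<=` ideal_add I J.
Proof. by move=> x Ix; exists x, 0; split; rewrite ?addr0 //; apply: ideal0. Qed.

Lemma ideal_addr I J : J `<=` ideal_add I J.
Proof. by move=> x Jx; exists 0, x; split; rewrite ?add0r //; apply: ideal0. Qed.

Definition ideal_colon I (a : A) : ideal A.
Proof.
exists [set x | I (a * x)].
- by rewrite /= mulr0; apply: ideal0.
- by move=> x y; rewrite /= mulrDr; apply: idealD.
- by move=> c x /= /(idealM c); rewrite mulrCA.
Defined.

Definition ideal_bot : ideal A.
Proof.
exists [set x | x = 0] => //.
- by move=> x y /= -> ->; rewrite addr0.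
- by move=> a x /= ->; rewrite mulr0.
Defined.

Lemma ideal_mul_mem (X Y : set A) x y : X x -> Y y -> ideal_mul X Y (x * y).
Proof. by move=> Xx Yy; apply: sub_ideal_gen; exists x, y. Qed.

Lemma ideal_mul_sub (X Y : set A) K :
  (forall x y, X x -> Y y -> K (x * y)) -> ideal_mul X Y `<=` K.
Proof. by move=> XYK; apply: ideal_gen_sub => _ [x [y [Xx Yy ->]]]; apply: XYK. Qed.

Lemma ideal_exp0 I x : ideal_exp I 0 x.
Proof. exact: sub_ideal_gen. Qed.

Lemma ideal_expS_mem I n x y : I x -> ideal_exp I n y -> ideal_exp I n.+1 (x * y).
Proof. exact: ideal_mul_mem. Qed.

Lemma ideal_expS_sub I n K :
  (forall x y, I x -> ideal_exp I n y -> K (x * y)) -> ideal_exp I n.+1 `<=` K.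
Proof. exact: ideal_mul_sub. Qed.

Lemma ideal_exp1 I : (ideal_exp I 1 : set A) = I.
Proof.
rewrite eqEsubset; split=> [|x Ix].
  by apply: ideal_expS_sub => x y Ix _; apply: ideal_mulr.
by rewrite -[x]mulr1; apply: ideal_expS_mem => //; apply: ideal_exp0.
Qed.

Lemma ideal_expSr I n : ideal_exp I n.+1 `<=` ideal_exp I n.
Proof. by apply: ideal_expS_sub => x y _; apply: idealM. Qed.

Lemma ideal_exp_anti I m n : (m <= n)%N -> ideal_exp I n `<=` ideal_exp I m.
Proof.
move=> /subnK <-; elim: (n - m)%N => // k IH x.
by rewrite addSn => /ideal_expSr/IH.
Qed.

Lemma ideal_expD I m n x y :
  ideal_exp I m x -> ideal_exp I n y -> ideal_exp I (m + n) (x * y).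
Proof.
move=> xm yn; elim: m x xm => [|m IH] x; first by move=> _; apply: idealM.
move=> xm; have : ideal_colon (ideal_exp I (m.+1 + n)) y x.
  apply: (ideal_expS_sub _ xm) => a b Ia bm.
  rewrite /= mulrC -mulrA; exact: (ideal_expS_mem Ia (IH _ bm)).
by rewrite /= mulrC.
Qed.

Lemma ideal_exp_mono I J n : I `<=` J -> ideal_exp I n `<=` ideal_exp J n.
Proof.
move=> IJ; elim: n => // n IH; apply: ideal_expS_sub => x y Ix yn.
by apply: ideal_expS_mem; [apply: IJ|apply: IH].
Qed.

Lemma ideal_exp_sub I n : (0 < n)%N -> ideal_exp I n `<=` I.
Proof. by move=> n0; rewrite -[X in _ `<=` X]ideal_exp1; apply: ideal_exp_anti. Qed.

Lemma ideal_exp_pow I n x : I x -> ideal_exp I n (x ^+ n).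
Proof.
move=> Ix; elim: n => [|n IH]; first exact: ideal_exp0.
by rewrite exprS; apply: ideal_expS_mem.
Qed.

(** Peeling one generator [a] off: each power of [(a, s)] lies in the sum of the
    power of [(s)] and of [a] times the previous power, so that an induction on
    the exponent of [a] in [J] applies to the colon ideal [(J : a)]. *)
Lemma fg_nil_exp s J :
  (forall x, x \in s -> exists n, J (x ^+ n)) ->
  exists n, ideal_exp (ideal_span s) n `<=` J.
Proof.
elim: s J => [|a s IHs] J sJ.
  exists 1%N; rewrite ideal_exp1; exact: ideal_span_sub.
have [m am] := sJ a (mem_head _ _).
have {}sJ x : x \in s -> exists n, J (x ^+ n).
  by move=> xs; apply: sJ; rewrite inE xs orbT.
elim: m J am sJ => [|m IHm] J am sJ.
  by exists 0%N => x _; apply: ideal1; rewrite -(expr0 a).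
have [n1 n1J] : exists n, ideal_exp (ideal_span (a :: s)) n `<=` ideal_colon J a.
  apply: IHm => [|x /sJ [n xn]]; first by rewrite /= -exprS.
  by exists n; apply: idealM.
have [n2 n2J] := IHs _ sJ.
set K := ideal_span (a :: s) in n1J *.
have split_gen x : K x -> exists c y, ideal_span s y /\ x = a * c + y.
  move=> /ideal_spanP[c ->]; rewrite /= big_ord_recl /=.
  exists (c 0%N), (\sum_(i < size s) c i.+1 * s`_i); split.
    exact: (ideal_span_comb (fun i => c i.+1)).
  by rewrite mulrC.
have Ks : ideal_span s `<=` K.
  by apply: ideal_span_sub => x xs; apply: ideal_span_mem; rewrite inE xs orbT.
have Ka : K a by apply: ideal_span_mem; rewrite mem_head.
have split_pow k : ideal_exp K k.+1 `<=` [set x | exists y z,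
    [/\ ideal_exp (ideal_span s) k.+1 y, ideal_exp K k z & x = y + a * z]].
  elim: k => [|k IHk].
    rewrite !ideal_exp1 => x /split_gen[c [y [sy ->]]].
    by exists y, c; split=> //; [apply: ideal_exp0|rewrite addrC].
  pose S : ideal A := ideal_add (ideal_exp (ideal_span s) k.+2)
    (ideal_mul [set a] (ideal_exp K k.+1)).
  have SP x : S x -> exists y z,
      [/\ ideal_exp (ideal_span s) k.+2 y, ideal_exp K k.+1 z & x = y + a * z].
    move=> [y [z [yS zS ->]]].
    have az : ideal_mul [set a] (ideal_exp K k.+1) `<=` [set z |
        (exists2 w, ideal_exp K k.+1 w & z = a * w)].
      have @Q : ideal A.
        exists [set z |
        (exists2 w, ideal_exp K k.+1 w & z = a * w)].
        - by exists 0; [apply: ideal0|rewrite mulr0].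
        - move=> _ _ [w Kw ->] [w' Kw' ->]; exists (w + w'); last by rewrite mulrDr.
          exact: idealD.
        - by move=> b _ [w Kw ->]; exists (b * w); [apply: idealM|rewrite mulrCA].
      apply: (@ideal_mul_sub _ _ Q) => _ w -> Kw; by exists w.
    by have [w Kw ->] := az _ zS; exists y, w.
  suff H : ideal_exp K k.+2 `<=` S by move=> x /H/SP.
  apply: ideal_expS_sub => x y Kx yk.
  have [c [u [su ->]]] := split_gen _ Kx.
  have [v [w [sv Kw yE]]] := IHk _ yk.
  exists (u * v), (a * (c * y + u * w)); split.
  - exact: ideal_expS_mem.
  - apply: ideal_mul_mem => //; apply: idealD; first exact: idealM.
    by apply: ideal_expS_mem => //; apply: Ks.
  - rewrite mulrDl {2}yE; ring.
exists (n1 + n2).+1 => x /split_pow[y [z [sy Kz ->]]]; apply: idealD.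
  by apply: n2J; apply: ideal_exp_anti sy; rewrite leqW // leq_addl.
by apply: n1J; apply: ideal_exp_anti Kz; rewrite leq_addr.
Qed.

End IdealArithmetic.

Section Noetherian.
Variables (A : comPzRingType) (noethA : noetherian A).
Implicit Types (I J K : ideal A).

Lemma noetherian_max (F : set (ideal A)) (I0 : ideal A) : F I0 ->
  exists M, [/\ F M, I0 `<=` M & forall J, F J -> M `<=` J -> J `<=` M].
Proof.
move=> FI0; apply: contrapT => noM.
have next (I : {I : ideal A | F I /\ I0 `<=` I}) :
    {J : {J : ideal A | F J /\ I0 `<=` J} | sval I `<=` sval J /\ ~ sval J `<=` sval I}.
  apply: cid; case: I => I [FI I0I]; apply: contrapT => noJ; apply: noM.
  exists I; split=> // J FJ IJ; apply: contrapT => JI; apply: noJ.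
  have I0J : I0 `<=` J by apply: subset_trans IJ.
  by exists (exist _ J (conj FJ I0J)).
pose c := fix c (n : nat) := if n is k.+1 then sval (next (c k)) else
  exist (fun I : ideal A => F I /\ I0 `<=` I) I0 (conj FI0 (@subset_refl _ _)).
have cS n : sval (c n) `<=` sval (c n.+1) /\ ~ sval (c n.+1) `<=` sval (c n).
  exact: (svalP (next (c n))).
have cmono m n : (m <= n)%N -> sval (c m) `<=` sval (c n).
  move=> /subnK <-; elim: (n - m)%N => // k IH x /IH.
  by have [+ _] := cS (k + m)%N; apply.
have @U : ideal A.
  exists [set x | exists n, sval (c n) x].
  - by exists 0%N; apply: ideal0.
  - move=> x y [m cx] [n cy]; exists (maxn m n).
    by apply: idealD; [apply: cmono cx|apply: cmono cy]; rewrite ?leq_maxl ?leq_maxr.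
  - by move=> a x [n cx]; exists n; apply: idealM.
have [s Us] := noethA U.
have [n sn] : exists n, forall x, x \in s -> sval (c n) x.
  have : forall x, x \in s -> exists n, sval (c n) x.
    move=> x xs; have : (U : set A) x by rewrite Us; apply: ideal_span_mem.
    by [].
  elim: s {Us} => [|a s IH] sc; first by exists 0%N.
  have [|n sn] := IH; first by move=> x xs; apply: sc; rewrite inE xs orbT.
  have [m am] := sc a (mem_head _ _).
  exists (maxn m n) => x; rewrite inE => /predU1P[->|/sn xn].
    by apply: (cmono _ _ _ _ am); rewrite leq_maxl.
  by apply: (cmono _ _ _ _ xn); rewrite leq_maxr.
have [_] := cS n; apply=> x cx; apply: (ideal_span_sub sn).
by rewrite -Us; exists n.+1.
Qed.

(** The topological form of the Artin-Rees lemma: the [I]-adic topology of [A]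
    induces that of [N]. An ideal [Q] which is maximal among those that contain
    [I^k N] and cut out exactly it on [N] contains a power of every [a] in [I]:
    once the chain [(Q : a^m)] is stationary, [Q + (a^m)] cuts out no more. *)
Lemma weak_artin_rees I N k :
  exists n, forall x, ideal_exp I n x -> N x -> ideal_mul (ideal_exp I k) N x.
Proof.
set J := ideal_mul (ideal_exp I k) N.
pose F : set (ideal A) := [set Q | J `<=` Q /\ forall x, Q x -> N x -> J x].
have FJ : F J by split=> [x|x Jx _].
have [Q [[JQ QN] _ Qmax]] := noetherian_max FJ.
suff powQ a : I a -> exists m, Q (a ^+ m).
  have [s Is] := noethA I.
  have [|n nQ] := @fg_nil_exp _ s Q.
    by move=> x xs; apply: powQ; rewrite Is; apply: ideal_span_mem.
  exists n => x In Nx; apply: QN => //; apply: nQ.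
  by apply: ideal_exp_mono In; rewrite Is.
move=> Ia.
have [m mstab] : exists m, forall n x, (m <= n)%N -> Q (a ^+ n * x) -> Q (a ^+ m * x).
  pose G : set (ideal A) := [set K | exists m, K = ideal_colon Q (a ^+ m)].
  have G0 : G (ideal_colon Q (a ^+ 0)) by exists 0%N.
  have [M [[m ->] _ Mmax]] := noetherian_max G0.
  exists m => n x mn; apply: (Mmax (ideal_colon Q (a ^+ n))) => [|y /=].
    by exists n.
  by rewrite -(subnK mn) exprD -mulrA; apply: idealM.
exists m; pose Q' := ideal_add Q (ideal_span [:: a ^+ m]).
suff QQ' : F Q'.
  apply: (Qmax Q' QQ') => [x|]; first exact: ideal_addl.
  by apply: ideal_addr; apply: ideal_span_mem; rewrite mem_head.
split=> [x /JQ|x]; first exact: ideal_addl.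
move=> [q [_ [Qq /ideal_span1P [c ->] ->]]] Nx; apply: QN => //.
apply: idealD => //; rewrite mulrC; apply: (mstab (m + k)%N); first exact: leq_addr.
have : Q (a ^+ k * (q + c * a ^+ m)).
  by apply: JQ; apply: ideal_mul_mem => //; apply: ideal_exp_pow.
move=> /idealB/(_ (idealM (a ^+ k) Qq)).
by congr (ideal_set Q _); rewrite exprD; ring.
Qed.

(** Krull's intersection theorem in [A / b]: by the Artin-Rees lemma the class of [x]
    lies in [I] times the ideal that it generates, and [1 - i] is a unit. *)
Lemma krull_closed I (b : ideal A) (x : A) :
  (forall i, I i -> exists y, (1 - i) * y = 1) ->
  (forall n, exists2 y, b y & ideal_exp I n (x - y)) -> b x.
Proof.
move=> jacI xb; pose N := ideal_add b (ideal_span [:: x]).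
have [n nN] := weak_artin_rees I N 1.
have Nx : N x by apply: ideal_addr; apply: ideal_span_mem; rewrite mem_head.
have [y by_ xyn] := xb n.
have : ideal_mul (ideal_exp I 1) N (x - y).
  by apply: nN => //; apply: idealB => //; apply: ideal_addl.
pose K := ideal_add b (ideal_mul I (ideal_span [:: x])).
have H : ideal_mul (ideal_exp I 1) N `<=` K.
  apply: ideal_mul_sub => i z; rewrite ideal_exp1 => Ii [u [v [bu xv ->]]].
  by exists (i * u), (i * v); split; [apply: idealM|apply: ideal_mul_mem|rewrite mulrDr].
move=> /H [u [v [bu + xE]]].
have H2 : ideal_mul I (ideal_span [:: x]) `<=` [set z | (exists2 i, I i & z = i * x)].
  have @P : ideal A.
    exists [set z | (exists2 i, I i & z = i * x)].
    - by exists 0; [apply: ideal0|rewrite mul0r].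
    - by move=> _ _ [i Ii ->] [j Ij ->]; exists (i + j); [apply: idealD|rewrite mulrDl].
    - by move=> c _ [i Ii ->]; exists (c * i); [apply: idealM|rewrite mulrA].
  apply: (@ideal_mul_sub _ _ _ P) => i z Ii /ideal_span1P[c ->].
  by exists (c * i); [apply: idealM|rewrite mulrCA mulrA].
move=> /H2 [i Ii vE]; have [w w1] := jacI i Ii.
have -> : x = w * (y + u).
  have -> : y + u = (1 - i) * x by rewrite mulrBl mul1r -vE -[x in RHS](subrK y) xE; ring.
  by rewrite mulrA [w * _]mulrC w1 mul1r.
by apply: idealM; apply: idealD.
Qed.

(** Multiplication by a nonzerodivisor [x] is a homeomorphism of [A] onto [(x)]:
    this is the Artin-Rees lemma for [(x)]. It will keep nonzerodivisors regular
    in the completion. *)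
Lemma nzd_weak_artin_rees I (x : A) k : nonzerodivisors A x ->
  exists n, forall y, ideal_exp I n (x * y) -> ideal_exp I k y.
Proof.
move=> xreg; have [n nP] := weak_artin_rees I (ideal_span [:: x]) k.
exists n => y /nP xy.
have /xy {}xy : ideal_span [:: x] (x * y).
  by apply/ideal_span1P; exists y; rewrite mulrC.
have H : ideal_mul (ideal_exp I k) (ideal_span [:: x]) `<=`
    [set z | (exists2 i, ideal_exp I k i & z = x * i)].
  have @P : ideal A.
    exists [set z | (exists2 i, ideal_exp I k i & z = x * i)].
    - by exists 0; [apply: ideal0|rewrite mulr0].
    - by move=> _ _ [i Ii ->] [j Ij ->]; exists (i + j); [apply: idealD|rewrite mulrDr].
    - by move=> c _ [i Ii ->]; exists (c * i); [apply: idealM|rewrite mulrCA].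
  apply: (@ideal_mul_sub _ _ _ P) => i z Ii /ideal_span1P[c ->].
  by exists (c * i); [apply: idealM|rewrite mulrA [x * _]mulrC; ring].
have [i Ii xyE] := H _ xy.
suff -> : y = i by [].
by apply/eqP; rewrite -subr_eq0; apply/eqP/xreg; rewrite mulrBr xyE subrr.
Qed.

End Noetherian.

Definition ideal_preim (A B : comPzRingType) (f : {rmorphism A -> B}) (I : ideal B) :
  ideal A.
Proof.
exists (fun x => I (f x)).
- by rewrite rmorph0; apply: ideal0.
- by move=> x y Ix Iy; rewrite rmorphD; apply: idealD.
- by move=> a x Ix; rewrite rmorphM; apply: idealM.
Defined.

(** * Primes of Noetherian rings *)

Section Primes.
Variables (A : comPzRingType).
Implicit Types (I J K : ideal A) (p q : spec A) (l : seq (spec A)).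

Lemma prime_pow p n (x : A) : p (x ^+ n) -> p x.
Proof.
have [p1 pM] := specP p; elim: n => [/p1//|n IH].
by rewrite exprS => /pM[].
Qed.

Hypothesis noethA : noetherian A.

(** An ideal that is maximal among those avoiding a multiplicative set is prime. *)
Lemma prime_avoiding I (S : mult_set A) : (forall x, I x -> ~ S x) ->
  exists p, I `<=` p /\ forall x, p x -> ~ S x.
Proof.
move=> IS.
have [M [MS IM Mmax]] :=
  noetherian_max noethA (F := [set J | forall x, J x -> ~ S x]) IS.
suff Mp : prime_ideal M by exists (Spec Mp).
split=> [/MS|x y Mxy]; first by apply; apply: mult_set1.
apply: contrapT => /not_orP[Mx My].
have meet z : ~ M z -> exists c m, M m /\ S (m + c * z).
  move=> Mz; apply: contrapT => noS; apply: Mz.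
  apply: (Mmax (ideal_add M (ideal_span [:: z]))).
  - move=> _ [m [_ [Mm /ideal_span1P[c ->] ->]]] Sm; apply: noS.
    by exists c, m.
  - exact: ideal_addl.
  - by apply: ideal_addr; apply: ideal_span_mem; rewrite mem_head.
have [[c [u [Mu Su]]] [d [v [Mv Sv]]]] := conj (meet _ Mx) (meet _ My).
apply: (MS _ _ (mult_setM Su Sv)).
have -> : (u + c * x) * (v + d * y) = (v + d * y) * u + (c * x) * v + (c * d) * (x * y).
  ring.
by do ?apply: idealD; apply: idealM.
Qed.

Lemma list_prod_notin (q : spec A) (l : seq (spec A)) :
  (forall p, List.In p l -> exists x, p x /\ ~ q x) ->
  exists x, (forall p, List.In p l -> p x) /\ ~ q x.
Proof.
have [q1 qM] := specP q; elim: l => [|p l IH] lq; first by exists 1.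
have [x [px qx]] := lq p (or_introl erefl).
have [|y [ly qy]] := IH; first by move=> r lr; apply: lq; right.
exists (x * y); split=> [r [<-|/ly]|/qM[]//]; first exact: ideal_mulr.
exact: idealM.
Qed.

(** Noetherian induction: if [x * y] lies in a maximal counterexample [I] but [x] and
    [y] do not, the primes found for [I + (x)] and for [I + (y)] do for [I]. *)
Lemma radical_primes I : exists l, (forall p, List.In p l -> I `<=` p) /\
  forall x, (forall p, List.In p l -> p x) -> exists n, I (x ^+ n).
Proof.
apply: contrapT => badI.
pose F : set (ideal A) := [set I | ~ exists l,
  (forall p, List.In p l -> I `<=` p) /\
  forall x, (forall p, List.In p l -> p x) -> exists n, I (x ^+ n)].
have [M [Mbad _ Mmax]] := noetherian_max noethA (F := F) badI.
have good (z : A) : ~ M z -> exists l,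
    (forall p, List.In p l -> M `<=` p) /\
    forall x, (forall p, List.In p l -> p x) ->
      exists n c m, M m /\ x ^+ n = m + c * z.
  move=> Mz; apply: contrapT => nol; apply: Mz.
  have zMz : ideal_add M (ideal_span [:: z]) z.
    by apply: ideal_addr; apply: ideal_span_mem; rewrite mem_head.
  apply: (Mmax (ideal_add M (ideal_span [:: z]))) zMz; last exact: ideal_addl.
  move=> [l [lM lx]]; apply: nol; exists l; split=> [p /lM|x /lx [n]].
    by move=> Hp z' Mz'; apply: Hp; apply: ideal_addl.
  by move=> [m [_ [Mm /ideal_span1P[c ->] E]]]; exists n, c, m.
apply: Mbad.
have [M1|M1] := pselect (M 1).
  by exists [::]; split=> // x _; exists 0%N.
have [[x [y [Mxy Mx My]]]|Mp] :=
    pselect (exists x y, [/\ M (x * y), ~ M x & ~ M y]).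
  have [[l1 [l1M l1x]] [l2 [l2M l2x]]] := conj (good _ Mx) (good _ My).
  exists (l1 ++ l2); split=> [p /List.in_app_iff[/l1M|/l2M]//|z zl].
  have [|n [c [m [Mm En]]]] := l1x z.
    by move=> p lp; apply: zl; apply/List.in_app_iff; left.
  have [|n' [c' [m' [Mm' En']]]] := l2x z.
    by move=> p lp; apply: zl; apply/List.in_app_iff; right.
  exists (n + n')%N; rewrite exprD En En'.
  have -> : (m + c * x) * (m' + c' * y) =
    (m' + c' * y) * m + (c * x) * m' + (c * c') * (x * y) by ring.
  by do ?apply: idealD; apply: idealM.
have Mprime : prime_ideal M.
  split=> // x y Mxy; apply: contrapT => /not_orP[Mx My].
  by apply: Mp; exists x, y.
exists [:: Spec Mprime]; split=> [p [<-|]//|x xM].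
by exists 1%N; rewrite expr1; apply: (xM (Spec Mprime)); left.
Qed.

Lemma list_minimal (T : Type) (R : T -> T -> Prop) (l : seq T) (x : T) :
  (forall x, R x x) -> (forall x y z, R x y -> R y z -> R x z) ->
  exists y, [/\ y = x \/ List.In y l, R y x & forall z, List.In z l -> R z y -> R y z].
Proof.
move=> Rxx Rtr; elim: l x => [|a l IH] x; first by exists x; split=> //; left.
have [y [yl yx ymin]] := IH x.
have [[ay ya]|ay] := pselect (R a y /\ ~ R y a).
  have [z [zl za zmin]] := IH a; exists z; split.
  - by right; case: zl => [->|?]; [left|right].
  - exact: (Rtr _ _ _ za (Rtr _ _ _ ay yx)).
  - by move=> w [<-//|/zmin].
exists y; split=> //; first by case: yl; [left|right; right].
move=> z [<-|/ymin//] ay'; apply: contrapT => ya; exact: ay.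
Qed.

(** The minimal primes among finitely many primes whose intersection is the
    nilradical are minimal in the whole spectrum, since any prime contains the
    nilradical, hence one of them. *)
Lemma minimal_primes : exists l, (forall p, List.In p l -> minimal_prime p) /\
  forall x, (forall p, List.In p l -> p x) -> exists n, x ^+ n = 0.
Proof.
have [l [_ lnil]] := radical_primes (ideal_bot A).
pose l' := List.filter (fun p => `[< minimal_prime p >]) l.
have inl' p : List.In p l' <-> List.In p l /\ minimal_prime p.
  by rewrite List.filter_In; split=> -[? /asboolP].
exists l'; split=> [p /inl'[]//|x xl'].
have [p pl|n xn] := lnil x; last by exists n.
have [q [ql qp qmin]] := @list_minimal _ (fun p q : spec A => p `<=` q) l p
  (fun p => @subset_refl _ _) (fun p q r => @subset_trans _ q p r).
have {}ql : List.In q l by case: ql => [->|].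
suff qm : minimal_prime q by apply: qp; apply: xl'; apply/inl'.
move=> r rq.
have [s [sl sr]] : exists s, List.In s l /\ s `<=` r.
  apply: contrapT => nos.
  have [s sl|y [yl ry]] := @list_prod_notin r l.
    apply: contrapT => /forallNP sr; apply: nos; exists s; split=> // y sy.
    by apply: contrapT => ry; apply: (sr y).
  have [n yn] := lnil y yl; apply: ry; apply: (@prime_pow r n).
  by rewrite yn; apply: ideal0.
have /qmin : s `<=` q by apply: subset_trans rq.
by move=> /(_ sl) qs; apply: subset_trans sr.
Qed.

Lemma prime_avoidance I l : (forall p q, List.In p l -> List.In q l ->
    p `<=` q -> q `<=` p) ->
  (forall p, List.In p l -> ~ I `<=` p) ->
  exists x, I x /\ forall p, List.In p l -> ~ p x.
Proof.
elim: l => [|p l IH] inc Il; first by exists 0; split=> //; apply: ideal0.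
have [||x [Ix lx]] := IH.
- by move=> q r ql rl; apply: inc; right.
- by move=> q ql; apply: Il; right.
have [px|px] := pselect (p x); last first.
  by exists x; split=> // q [<-|/lx].
have [e [Ie pe]] : exists e, I e /\ ~ p e.
  apply: contrapT => /forallNP noe; apply: (Il p); first by left.
  by move=> e Ie; apply: contrapT => pe; apply: (noe e).
have [q ql|y [ly py]] := @list_prod_notin p l.
  apply: contrapT => /forallNP noy; apply: (lx q ql).
  apply: (inc q p) px; [by right|by left|].
  by move=> y qy; apply: contrapT => py; apply: (noy y).
have [_ pM] := specP p.
exists (x + y * e); split; first by apply: idealD => //; apply: idealM.
move=> q [<-|ql].
  by move=> /idealB /(_ px); rewrite addrAC subrr add0r => /pM[].
move=> /idealB /(_ (ideal_mulr e (ly q ql))); rewrite addrK; exact: lx.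
Qed.

Lemma local_unit I x : local_ring I -> ~ I x -> exists y, x * y = 1.
Proof.
move=> [_ Iloc] Ix; apply: contrapT => nox; apply: Ix.
have x1 : ~ ideal_span [:: x] 1.
  by move=> /ideal_span1P[c c1]; apply: nox; exists c; rewrite mulrC.
have [M [M1 xM Mmax]] := noetherian_max noethA (F := [set J : ideal A | ~ J 1]) x1.
have <- : (M : set A) = I by apply: Iloc; split=> // J MJ J1; apply: Mmax.
by apply: xM; apply: ideal_span_mem; rewrite mem_head.
Qed.

Lemma local_prime I : local_ring I -> prime_ideal I.
Proof.
move=> Iloc; have [[I1 _] _] := Iloc; split=> // x y Ixy.
apply: contrapT => /not_orP[/(local_unit Iloc) [u xu] /(local_unit Iloc) [v yv]].
apply: I1; have -> : 1 = (u * v) * (x * y) by rewrite -[LHS]mulr1 -{1}xu -yv; ring.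
exact: idealM.
Qed.

Lemma local_jacobson I i : local_ring I -> I i -> exists y, (1 - i) * y = 1.
Proof.
move=> Iloc Ii; apply: (local_unit Iloc) => I1i; have [[I1 _] _] := Iloc.
by apply: I1; rewrite -(subrK i 1); apply: idealD.
Qed.

End Primes.

(** * Finite generation of a submodule modulo another one *)

(** Modules are the subsets of an [A]-algebra [E] that are stable by the
    operations; [fin f M M'] says that [(M + M') / M'] is finitely generated,
    by elements of [M]. *)
Section FiniteModules.
Variable A : comPzRingType.

Definition lin (E : comPzRingType) (f : {rmorphism A -> E}) (c : nat -> A)
  (h : seq E) : E := \sum_(i < size h) f (c i) * h`_i.

Definition submod (E : comPzRingType) (f : {rmorphism A -> E}) (M : set E) :=
  [/\ M 0, forall x y, M x -> M y -> M (x + y) & forall a x, M x -> M (f a * x)].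

Definition fin (E : comPzRingType) (f : {rmorphism A -> E}) (M M' : set E) :=
  exists h : seq E, (forall x, x \in h -> M x) /\
    forall x, M x -> exists c, M' (x - lin f c h).

Section OneAlgebra.
Variables (E : comPzRingType) (f : {rmorphism A -> E}).
Implicit Types (M : set E) (h : seq E) (c d : nat -> A).

Lemma lin0 c : lin f c [::] = 0.
Proof. exact: big_ord0. Qed.

Lemma lin_cons c x h : lin f c (x :: h) = f (c 0%N) * x + lin f (fun i => c i.+1) h.
Proof. by rewrite /lin /= big_ord_recl. Qed.

Lemma lin_ext c d h : (forall i, (i < size h)%N -> c i = d i) -> lin f c h = lin f d h.
Proof. by move=> cd; apply: eq_bigr => i _; rewrite cd. Qed.

Lemma linD c d h : lin f (fun i => c i + d i) h = lin f c h + lin f d h.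
Proof. by rewrite -big_split; apply: eq_bigr => i _ /=; rewrite rmorphD mulrDl. Qed.

Lemma linB c d h : lin f (fun i => c i - d i) h = lin f c h - lin f d h.
Proof. by rewrite -sumrB; apply: eq_bigr => i _ /=; rewrite rmorphB mulrBl. Qed.

Lemma linZ a c h : lin f (fun i => a * c i) h = f a * lin f c h.
Proof. by rewrite [RHS]big_distrr; apply: eq_bigr => i _ /=; rewrite rmorphM mulrA. Qed.

Lemma lin_zero h : lin f (fun=> 0) h = 0.
Proof. by rewrite /lin big1 // => i _; rewrite rmorph0 mul0r. Qed.

Lemma lin_cat c h h' :
  lin f c (h ++ h') = lin f c h + lin f (fun i => c (size h + i)%N) h'.
Proof.
elim: h c => [|x h IH] c; first by rewrite lin0 add0r.
by rewrite cat_cons !lin_cons IH addrA.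
Qed.

Lemma lin_cat_ex c d h h' : exists e, lin f e (h ++ h') = lin f c h + lin f d h'.
Proof.
exists (fun i => if (i < size h)%N then c i else d (i - size h)%N).
rewrite lin_cat; congr (_ + _); apply: lin_ext => i; first by move=> ->.
by move=> _; rewrite ifF ?addKn //; apply: negbTE; rewrite -leqNgt leq_addr.
Qed.

Lemma lin_mem x h : x \in h -> exists c, x = lin f c h.
Proof.
elim: h => // y h IH; rewrite inE => /predU1P[->|/IH[c ->]].
  exists (fun i => (i == 0%N)%:R); rewrite lin_cons /= rmorph1 mul1r.
  by rewrite (@lin_ext _ (fun=> 0)) ?lin_zero ?addr0.
exists (fun i => if i is j.+1 then c j else 0).
by rewrite lin_cons rmorph0 mul0r add0r.
Qed.

Lemma lin_sub M c h : submod f M -> (forall x, x \in h -> M x) -> M (lin f c h).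
Proof.
move=> [M0 MD MZ] hM; rewrite /lin; elim/big_ind: _ => //= i _.
by apply: MZ; apply: hM; apply: mem_nth.
Qed.

Lemma submodB M x y : submod f M -> M x -> M y -> M (x - y).
Proof.
by move=> [M0 MD MZ] Mx My; rewrite -mulN1r -(rmorph1 f) -rmorphN; apply/MD/MZ.
Qed.

Lemma submod_cap M M' : submod f M -> submod f M' -> submod f (M `&` M').
Proof.
move=> [M0 MD MZ] [M0' MD' MZ']; split=> // [x y [? ?] [? ?]|a x [? ?]].
  by split; [apply: MD|apply: MD'].
by split; [apply: MZ|apply: MZ'].
Qed.

Lemma submod0 : submod f [set 0].
Proof. by split=> // [x y -> ->|a x ->]; rewrite ?addr0 ?mulr0. Qed.

Lemma fin_trans M M1 M2 : M1 `<=` M ->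
  fin f M M1 -> fin f M1 M2 -> fin f M M2.
Proof.
move=> M1M [h [hM hP]] [k [kM kP]]; exists (h ++ k); split.
  by move=> x; rewrite mem_cat => /orP[/hM|/kM/M1M].
move=> x /hP [c /kP [d cd]]; have [e eE] := lin_cat_ex c d h k.
by exists e; rewrite eE opprD addrA.
Qed.

Lemma fin_weaken M M1 M2 : M1 `<=` M2 -> fin f M M1 -> fin f M M2.
Proof.
move=> M12 [h [hM hP]]; exists h; split=> // x /hP [c cP].
by exists c; apply: M12.
Qed.

Lemma fin_weaken_in M M1 M2 : submod f M -> (forall x, M x -> M1 x -> M2 x) ->
  fin f M M1 -> fin f M M2.
Proof.
move=> sM M12 [h [hM hP]]; exists h; split=> // x Mx; have [c cP] := hP x Mx.
by exists c; apply: M12 => //; apply: (submodB sM) => //; apply: lin_sub sM _.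
Qed.

End OneAlgebra.

Hypothesis noethA : noetherian A.

(** Over a Noetherian ring, the [m] in [M] such that [g m] lies in [M1'] are of
    finite index as soon as finitely many elements [h] generate the image of
    [g] modulo [M1']. Induction on [h]: the coefficients that may occur on its
    first element form an ideal. *)
Lemma fin_preim (E E1 : comPzRingType) (f : {rmorphism A -> E})
    (f1 : {rmorphism A -> E1}) (g : E -> E1) (M : set E) (M1' : set E1) (h : seq E1) :
  (forall x y, M x -> M y -> g (x + y) = g x + g y) ->
  (forall a x, M x -> g (f a * x) = f1 a * g x) ->
  submod f M -> submod f1 M1' ->
  (forall x, M x -> exists c, M1' (g x - lin f1 c h)) ->
  fin f M [set x | M1' (g x)].
Proof.
move=> gD gZ + sM1'; have [M10 M1D M1Z] := sM1'.
elim: h M gD gZ => [|h0 h IH] M gD gZ sM hM.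
  exists [::]; split=> // x /hM [c]; rewrite lin0 subr0 => gx.
  by exists c; rewrite lin0 subr0.
have [M0 MD MZ] := sM.
have g0 : g 0 = 0 by rewrite -(mulr0 (f 0)) gZ // rmorph0 mul0r.
have gB x y : M x -> M y -> g (x - y) = g x - g y.
  move=> Mx My; rewrite -mulN1r -(rmorph1 f) -rmorphN gD //; last exact: MZ.
  by rewrite gZ // rmorphN rmorph1 mulN1r.
have @J : ideal A.
  exists [set a | exists m c, M m /\ M1' (g m - f1 a * h0 - lin f1 c h)].
  - by exists 0, (fun=> 0); rewrite g0 rmorph0 mul0r lin_zero !subr0.
  - move=> a b [m [c [Mm mc]]] [m' [c' [Mm' mc']]].
    exists (m + m'), (fun i => c i + c' i); split; first exact: MD.
    have := M1D _ _ mc mc'; congr M1'.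
    by rewrite gD // rmorphD linD; ring.
  - move=> b a [m [c [Mm mc]]]; exists (f b * m), (fun i => b * c i).
    split; first exact: MZ.
    have := M1Z b _ mc; congr M1'.
    by rewrite gZ // rmorphM linZ; ring.
have [s Js] := noethA J.
have [ms [msM msP]] : exists ms : seq E, (forall x, x \in ms -> M x) /\
    forall c, exists d, M1' (g (lin f c ms) -
       f1 (\sum_(i < size s) c i * s`_i) * h0 - lin f1 d h).
  have : forall x, x \in s -> J x.
    by move=> x xs; rewrite Js; apply: ideal_span_mem.
  elim: s {Js} => [|a s IHs] sJ.
    exists [::]; split=> // c; exists (fun=> 0).
    by rewrite lin0 g0 big_ord0 rmorph0 mul0r lin_zero !subr0.
  have [|ms [msM msP]] := IHs.
    by move=> x xs; apply: sJ; rewrite inE xs orbT.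
  have [m [e [Mm me]]] := sJ a (mem_head _ _).
  exists (m :: ms); split=> [x|c]; first by rewrite inE => /predU1P[->|/msM].
  have [d dP] := msP (fun i => c i.+1).
  exists (fun i => c 0%N * e i + d i).
  have := M1D _ _ (M1Z (c 0%N) _ me) dP; congr M1'.
  have Mlin : M (lin f (fun i => c i.+1) ms) by apply: lin_sub sM _.
  rewrite lin_cons gD //; last exact: (MZ _ _ Mm).
  rewrite gZ // linD linZ /= big_ord_recl /= !rmorphD !rmorphM.
  by ring.
pose M2 : set E := M `&` [set m | exists c, M1' (g m - lin f1 c h)].
have sM2 : submod f M2.
  split=> [|x y [Mx [c xc]] [My [d yd]]|a x [Mx [c xc]]].
  - by split=> //; exists (fun=> 0); rewrite g0 lin_zero subr0.
  - split; first exact: (MD _ _ Mx My).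
    exists (fun i => c i + d i); have := M1D _ _ xc yd; congr M1'.
    by rewrite gD // linD; ring.
  - split; first exact: (MZ _ _ Mx).
    exists (fun i => a * c i); have := M1Z a _ xc; congr M1'.
    by rewrite gZ // linZ; ring.
have fin2 : fin f M2 [set x | M1' (g x)].
  by apply: IH => // [x y [Mx _] [My _]|a x [Mx _]|x []]; [exact: (gD _ _ Mx My)|exact: (gZ _ _ Mx)|].
apply: fin_trans fin2; first by move=> x [].
exists ms; split=> // m Mm; have [c mc] := hM m Mm.
have : J (c 0%N) by exists m, (fun i => c i.+1); split=> //; rewrite -addrA -opprD -lin_cons.
rewrite Js => /ideal_spanP [b cb]; have [d dP] := msP b.
exists b; split; first by apply: (submodB sM) => //; apply: lin_sub sM _.
exists (fun i => c i.+1 - d i); have := submodB sM1' mc dP; congr M1'.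
by rewrite gB ?lin_cons ?cb ?linB //; [ring|apply: lin_sub sM _].
Qed.

Lemma fin_cap (E : comPzRingType) (f : {rmorphism A -> E}) (M M1 M2 : set E) :
  submod f M -> submod f M1 -> submod f M2 ->
  fin f M M1 -> fin f M M2 -> fin f M (M1 `&` M2).
Proof.
move=> sM sM1 sM2 fM1 [h [hM hP]].
have : fin f (M `&` M1) M2.
  apply: (@fin_preim _ _ f f id _ _ h) => //; first exact: submod_cap.
  by move=> x [/hP].
move=> [k [kM kP]].
have [h1 [h1M h1P]] := fM1.
exists (h1 ++ k); split=> [x|x Mx].
  by rewrite mem_cat => /orP[/h1M//|/kM[]].
have [c xc] := h1P x Mx.
have [|d xd] := kP (x - lin f c h1).
  by split=> //; apply: (submodB sM) => //; apply: lin_sub sM _.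
have [e eE] := lin_cat_ex f c d h1 k.
exists e; rewrite eE opprD addrA; split=> //.
by apply: (submodB sM1) => //; apply: lin_sub sM1 _ => y /kM[].
Qed.

Lemma fin_sub (E : comPzRingType) (f : {rmorphism A -> E}) (M N M' : set E) :
  submod f N -> submod f M' -> N `<=` M -> fin f M M' -> fin f N M'.
Proof.
move=> sN sM' NM [h [_ hP]].
by apply: (@fin_preim _ _ f f id N M' h) => // x /NM/hP.
Qed.

End FiniteModules.

(** * Universal properties *)

(** The rings built below by quotients and localizations are nonzero, or
    fields, for reasons that canonical structures cannot find; the next two
    constructions attach the proofs to the rings. *)
Definition nzring (K : comPzRingType) (K1 : 1 != 0 :> K) : comNzRingType :=
  HB.pack (GRing.ComPzRing.sort K) (GRing.PzSemiRing_isNonZero.Build K K1).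

Section FieldRing.
Variables (K : comPzRingType) (K1 : 1 != 0 :> K).
Hypothesis Kinv : forall x : K, x != 0 -> exists y, y * x = 1.

Definition fr_inv (x : nzring K1) : nzring K1 :=
  if pselect (x != 0) is left x0 then sval (cid (Kinv x0)) else 0.

Lemma fr_mulVf (x : nzring K1) : x != 0 -> fr_inv x * x = 1.
Proof. by rewrite /fr_inv; case: pselect => // x0 _; case: cid. Qed.

Lemma fr_inv0 : fr_inv 0 = 0.
Proof. by rewrite /fr_inv; case: pselect => // x0; exfalso; move/eqP: x0. Qed.

Definition fieldring : fieldType :=
  HB.pack (GRing.ComNzRing.sort (nzring K1)) (GRing.ComNzRing_isField.Build (nzring K1) fr_mulVf fr_inv0).

End FieldRing.

Definition mk_rmorphism (A B : pzRingType) (f : A -> B) (fB : zmod_morphism f)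
    (fM : monoid_morphism f) : {rmorphism A -> B} :=
  HB.pack f (GRing.isZmodMorphism.Build A B f fB)
    (GRing.isMonoidMorphism.Build A B f fM).

(** All maps out of quotients, localizations and tensor products come from this
    one; they are provided as existence statements so that their computation
    rules are the only thing known about them. *)
Lemma pres_lift (P : ring_pres) (E : comPzRingType) (F : rp_sort P -> E) :
  (forall x y, rp_eq x y -> F x = F y) ->
  (forall x y, F (rp_add x y) = F x + F y) ->
  (forall x y, F (rp_mul x y) = F x * F y) -> F (rp_one P) = 1 ->
  exists h : {rmorphism pres_ring P -> E}, forall x, h (rp_class x) = F x.
Proof.
move=> Feq FD FM F1; pose h (z : pres_ring P) : E := F (repr z).
have hE x : h (rp_class x) = F x.
  by apply: Feq; apply/rp_classP; rewrite /rp_class reprK.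
have F0 : F (rp_zero P) = 0.
  by apply: (addrI (F (rp_zero P))); rewrite -FD addr0; apply/Feq/rp_add0.
have FN x : F (rp_opp x) = - F x.
  by apply/eqP; rewrite -addr_eq0 -FD -F0; apply/eqP/Feq/rp_addN.
have hB : zmod_morphism h.
  move=> x y; have [[a ->] [b ->]] := conj (rp_class_surj x) (rp_class_surj y).
  by rewrite -rp_classN -rp_classD !hE FD FN.
have hM : monoid_morphism h.
  split=> [|x y]; first by rewrite -rp_class1 hE.
  have [[a ->] [b ->]] := conj (rp_class_surj x) (rp_class_surj y).
  by rewrite -rp_classM !hE FM.
by exists (mk_rmorphism hB hM).
Qed.

Section QuotientFacts.
Variables (A : comPzRingType) (I : ideal A).

Lemma to_quot_surj (z : quot I) : exists x, z = to_quot I x.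
Proof. exact: (@rp_class_surj (quot_pres I)). Qed.

Lemma to_quot_eq (x y : A) : to_quot I x = to_quot I y <-> I (x - y).
Proof. exact: (@rp_classP (quot_pres I)). Qed.

Lemma to_quot0 (x : A) : to_quot I x = 0 <-> I x.
Proof. by rewrite -(rmorph0 (to_quot I)) to_quot_eq subr0. Qed.

End QuotientFacts.

Lemma surj_factor (A B E : comPzRingType) (p : {rmorphism A -> B})
    (f : {rmorphism A -> E}) : (forall b, exists a, b = p a) ->
  (forall a, p a = 0 -> f a = 0) ->
  exists g : {rmorphism B -> E}, forall a, g (p a) = f a.
Proof.
move=> psurj pf.
pose g (b : B) : E := f (sval (cid (psurj b))).
have gE a : g (p a) = f a.
  rewrite /g; case: cid => b /= pb; apply/eqP; rewrite -subr_eq0 -rmorphB.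
  by apply/eqP/pf; rewrite rmorphB pb subrr.
have gB : zmod_morphism g.
  move=> x y; have [[a ->] [b ->]] := conj (psurj x) (psurj y).
  by rewrite -rmorphB !gE rmorphB.
have gM : monoid_morphism g.
  split=> [|x y]; first by rewrite -(rmorph1 p) gE rmorph1.
  have [[a ->] [b ->]] := conj (psurj x) (psurj y).
  by rewrite -rmorphM !gE rmorphM.
by exists (mk_rmorphism gB gM).
Qed.

Lemma quot_lift (A E : comPzRingType) (I : ideal A) (f : {rmorphism A -> E}) :
  (forall a, I a -> f a = 0) ->
  exists g : {rmorphism quot I -> E}, forall a, g (to_quot I a) = f a.
Proof.
move=> If; apply: (@surj_factor _ _ _ (to_quot I)); first exact: to_quot_surj.
by move=> a /to_quot0/If.
Qed.

Section LocalizationFacts.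
Variables (A : comPzRingType) (S : mult_set A).

Lemma to_loc_eq (x y : A) :
  to_loc S x = to_loc S y <-> exists2 u, S u & u * x = u * y.
Proof.
split=> [/(@rp_classP (loc_pres S)) [u Su] /=|[u Su uxy]].
  by rewrite !mulr1 mulrBr => /eqP; rewrite subr_eq0 => /eqP uxy; exists u.
apply/(@rp_classP (loc_pres S)); exists u => //=.
by rewrite !mulr1 mulrBr uxy subrr.
Qed.

Lemma to_loc0 (x : A) : to_loc S x = 0 <-> exists2 u, S u & u * x = 0.
Proof.
rewrite -(rmorph0 (to_loc S)) to_loc_eq.
by split=> -[u Su E]; exists u; rewrite ?E ?mulr0 // -E mulr0.
Qed.

Lemma to_loc_unit (s : A) : S s -> exists y, to_loc S s * y = 1.
Proof.
move=> Ss; exists (rp_class ((1, mk_denom Ss) : rp_sort (loc_pres S))).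
rewrite /to_loc -[LHS](@rp_classM (loc_pres S)) -[RHS](@rp_class1 (loc_pres S)).
by apply/rp_classP; exists 1; [apply: mult_set1|rewrite /=; ring].
Qed.

Lemma loc_frac (z : loc S) : exists a s, S s /\ z * to_loc S s = to_loc S a.
Proof.
have [[a s] ->] := @rp_class_surj (loc_pres S) z.
exists a, (sval s); split; first exact: denomP.
rewrite /to_loc -[LHS](@rp_classM (loc_pres S)).
by apply/rp_classP; exists 1; [apply: mult_set1|rewrite /=; ring].
Qed.

Lemma loc_lift (E : comPzRingType) (f : {rmorphism A -> E}) :
  (forall s, S s -> exists y, f s * y = 1) ->
  exists g : {rmorphism loc S -> E}, forall a, g (to_loc S a) = f a.
Proof.
move=> Sf.
pose inv (s : denom S) : E := sval (cid (Sf _ (denomP s))).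
have invP s : f (sval s) * inv s = 1 by rewrite /inv; case: cid.
pose F (x : rp_sort (loc_pres S)) : E := f x.1 * inv x.2.
have inv_uniq s y : f (sval s) * y = 1 -> inv s = y.
  move=> sy; rewrite -[LHS]mulr1 -sy mulrA [inv s * _]mulrC invP mul1r //.
have [||||h hE] := @pres_lift (loc_pres S) E F.
- move=> [a s] [b t] /= [u Su /= /(congr1 f)]; rewrite rmorphM rmorph0 rmorphB !rmorphM.
  have [v uv] := Sf u Su => /(congr1 (fun z => v * z)).
  rewrite mulrA [v * _]mulrC uv mul1r mulr0 => /eqP; rewrite subr_eq0 => /eqP ab.
  rewrite /F /= -[LHS]mulr1 -(invP t).
  transitivity ((f a * f (sval t)) * (inv s * inv t)); first by ring.
  by rewrite ab -[RHS]mulr1 -(invP s); ring.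
- move=> [a s] [b t]; rewrite /F /= rmorphD !rmorphM.
  have -> : inv (denomM s t) = inv s * inv t.
    apply: inv_uniq; rewrite /= rmorphM.
    transitivity ((f (sval s) * inv s) * (f (sval t) * inv t)); first by ring.
    by rewrite !invP mulr1.
  rewrite -[f a * inv s in RHS]mulr1 -(invP t) -[f b * inv t]mulr1 -(invP s).
  ring.
- move=> [a s] [b t]; rewrite /F /= rmorphM.
  have -> : inv (denomM s t) = inv s * inv t.
    apply: inv_uniq; rewrite /= rmorphM.
    transitivity ((f (sval s) * inv s) * (f (sval t) * inv t)); first by ring.
    by rewrite !invP mulr1.
  ring.
- by rewrite /F /= rmorph1 mul1r; apply: inv_uniq; rewrite /= rmorph1 mulr1.
exists h => a; rewrite /to_loc hE /F /=.
by rewrite (_ : inv _ = 1) ?mulr1 //; apply: inv_uniq; rewrite /= rmorph1 mulr1.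
Qed.

End LocalizationFacts.

Section TensorFacts.
Variables (R A B : comPzRingType).
Variables (f : {rmorphism R -> A}) (g : {rmorphism R -> B}).

(** Balanced biadditive maps factor through the tensor product. The strict closure
    is tested below on maps that have these properties only modulo a subgroup. *)
Lemma tens_eq_balanced_mod (G : zmodType) (H : set G) (b : A -> B -> G) :
  H 0 -> (forall x y, H x -> H y -> H (x - y)) ->
  (forall x x' y, H (b (x + x') y - (b x y + b x' y))) ->
  (forall x y y', H (b x (y + y') - (b x y + b x y'))) ->
  (forall r x y, H (b (f r * x) y - b x (g r * y))) ->
  forall s t, tens_eq f g s t ->
    H (\sum_(z <- s) b z.1 z.2 - \sum_(z <- t) b z.1 z.2).
Proof.
move=> H0 HB bDl bDr bZ.
have HN x : H x -> H (- x) by move=> Hx; rewrite -sub0r; apply: HB.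
have HD x y : H x -> H y -> H (x + y) by move=> Hx Hy; rewrite -[y]opprK; apply/HB/HN.
move=> s t; elim=> {s t}.
- by move=> s; rewrite subrr.
- by move=> s t _ E; rewrite -opprB; apply: HN.
- by move=> s t u _ E _ /(HD _ _ E); rewrite addrA subrK.
- by move=> s s' t t' _ E _ /(HD _ _ E); rewrite !big_cat /= opprD addrACA.
- by move=> s t; rewrite !big_cat /= [X in _ - X]addrC subrr.
- move=> y; rewrite big_seq1 big_nil /=.
  by have /HN := bDl 0 0 y; rewrite addr0 opprB addrK subr0.
- by move=> x x' y; rewrite big_seq1 /= !big_cons big_nil addr0.
- by move=> x y y'; rewrite big_seq1 /= !big_cons big_nil addr0.
- by move=> r x y; rewrite !big_seq1 /=.
Qed.

Lemma tens_eq_balanced (G : zmodType) (b : A -> B -> G) :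
  (forall x x' y, b (x + x') y = b x y + b x' y) ->
  (forall x y y', b x (y + y') = b x y + b x y') ->
  (forall r x y, b (f r * x) y = b x (g r * y)) ->
  forall s t, tens_eq f g s t ->
    \sum_(z <- s) b z.1 z.2 = \sum_(z <- t) b z.1 z.2.
Proof.
move=> bDl bDr bZ s t st; apply/eqP; rewrite -subr_eq0; apply/eqP.
apply: (@tens_eq_balanced_mod G [set 0] b _ _ _ _ _ s t st) => //.
- by move=> x y -> ->; rewrite subrr.
- by move=> x x' y; rewrite bDl subrr.
- by move=> x y y'; rewrite bDr subrr.
- by move=> r x y; rewrite bZ subrr.
Qed.

Lemma tens_lift (C : comPzRingType) (u : {rmorphism A -> C}) (v : {rmorphism B -> C}) :
  (forall r, u (f r) = v (g r)) ->
  exists h : {rmorphism tensor f g -> C}, forall a b, h (tens f g a b) = u a * v b.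
Proof.
move=> uv.
pose F (s : rp_sort (tens_pres f g)) : C := \sum_(z <- s) u z.1 * v z.2.
have [||||h hE] := @pres_lift (tens_pres f g) C F.
- move=> s t /(tens_eq_balanced (b := fun x y => u x * v y)); apply.
  + by move=> x x' y; rewrite rmorphD mulrDl.
  + by move=> x y y'; rewrite rmorphD mulrDr.
  + by move=> r x y; rewrite !rmorphM uv; ring.
- by move=> s t; rewrite /F /= big_cat.
- move=> s t; rewrite /F /= /tens_mul big_allpairs_dep /= big_distrl.
  apply: eq_bigr => x _ /=; rewrite big_distrr; apply: eq_bigr => y _ /=.
  by rewrite !rmorphM; ring.
- by rewrite /F /= big_seq1 /= !rmorph1 mulr1.
by exists h => a b; rewrite /tens hE /F big_seq1.
Qed.

Lemma tensX a b n : tens f g a b ^+ n = tens f g (a ^+ n) (b ^+ n).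
Proof.
elim: n => [|n IH]; first by rewrite !expr0.
rewrite !exprS IH /tens -[LHS](@rp_classM (tens_pres f g)); apply/rp_classP.
exact: tens_refl.
Qed.

Lemma tens0l b : tens f g 0 b = 0.
Proof. by apply/(@rp_classP (tens_pres f g)); apply: tens_0l. Qed.

End TensorFacts.

(** * Power series and adically complete rings *)

Definition domain (A : comPzRingType) : Prop :=
  forall x y : A, x * y = 0 -> x = 0 \/ y = 0.

(** Completeness along a principal ideal: power series in [x] converge, and
    the powers of [x] separate points. *)
Definition xcomplete (A : comPzRingType) (x : A) : Prop :=
  (forall a : nat -> A, exists s, forall n, exists c,
     s = \sum_(l < n) a l * x ^+ l + c * x ^+ n) /\
  (forall z, (forall n, exists c, z = c * x ^+ n) -> z = 0).

Definition icomplete (A : comPzRingType) (I : ideal A) : Prop :=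
  (forall u : nat -> A, (forall n, ideal_exp I n (u n.+1 - u n)) ->
     exists l, forall n, ideal_exp I n (l - u n)) /\
  (forall z, (forall n, ideal_exp I n z) -> z = 0).

Lemma icomplete_xcomplete (A : comPzRingType) (I : ideal A) (x : A) :
  icomplete I -> I x -> xcomplete x.
Proof.
move=> [Ilim Isep] Ix; split=> [a|z zx]; last first.
  apply: Isep => n; have [c ->] := zx n.
  by apply: idealM; apply: ideal_exp_pow.
have [s sP] : exists s : nat -> A, forall k n,
    ideal_exp I n (s k - \sum_(l < n) a (k + l)%N * x ^+ l).
  suff /choice[s sP] k : exists s, forall n,
      ideal_exp I n (s - \sum_(l < n) a (k + l)%N * x ^+ l) by exists s.
  apply: Ilim => n; rewrite big_ord_recr /= [_ + a _ * _]addrC addrK.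
  by apply: idealM; apply: ideal_exp_pow.
exists (s 0%N) => n; exists (s n); apply/eqP; rewrite -subr_eq0; apply/eqP.
apply: Isep => N.
have -> : s 0%N - (\sum_(l < n) a l * x ^+ l + s n * x ^+ n) =
  (s 0%N - \sum_(l < n + N) a (0 + l)%N * x ^+ l) -
  x ^+ n * (s n - \sum_(l < N) a (n + l)%N * x ^+ l).
  rewrite big_split_ord /= mulrBr mulr_sumr.
  have -> : \sum_(i < N) a (0 + (n + i))%N * x ^+ (n + i) =
            \sum_(i < N) x ^+ n * (a (n + i)%N * x ^+ i).
    by apply: eq_bigr => i _; rewrite add0n exprD; ring.
  by ring.
apply: idealB; first by apply: ideal_exp_anti (sP 0%N (n + N)%N); apply: leq_addl.
by apply: idealM.
Qed.

Lemma icomplete_jacobson (A : comPzRingType) (I : ideal A) (i : A) :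
  icomplete I -> I i -> exists y, (1 - i) * y = 1.
Proof.
move=> cI Ii; have [xlim xsep] := icomplete_xcomplete cI Ii.
have [s sP] := xlim (fun=> 1); exists s.
apply/eqP; rewrite -subr_eq0; apply/eqP/xsep => n.
have [c ->] := sP n; exists ((1 - i) * c - 1).
have -> : \sum_(l < n) 1 * i ^+ l = \sum_(l < n) i ^+ l.
  by apply: eq_bigr => l _; rewrite mul1r.
rewrite mulrDr -[(1 - i) * \sum_(l < n) _]opprK -mulNr opprB -subrX1.
by ring.
Qed.

Section PowerSeries.
Variable A : comNzRingType.

Record pseries := PSeries { pcoef : nat -> A }.

HB.instance Definition _ := gen_eqMixin pseries.
HB.instance Definition _ := gen_choiceMixin pseries.

Lemma pseries_eq (f g : pseries) : (forall n, pcoef f n = pcoef g n) -> f = g.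
Proof. by case: f g => [f] [g] /= fg; congr PSeries; apply: funext. Qed.

Definition ps_trunc (f : pseries) n : {poly A} := \poly_(i < n) pcoef f i.

Definition ps_opp (f : pseries) := PSeries (fun n => - pcoef f n).
Definition ps_add (f g : pseries) := PSeries (fun n => pcoef f n + pcoef g n).
Definition ps_mul (f g : pseries) :=
  PSeries (fun n => \sum_(i < n.+1) pcoef f i * pcoef g (n - i)).
Definition ps_const (a : A) := PSeries (fun n => if n is 0 then a else 0).
Definition ps_X := PSeries (fun n => (n == 1%N)%:R).

Lemma ps_coefM (f g : pseries) (p q : {poly A}) n :
  (forall i, (i <= n)%N -> p`_i = pcoef f i) ->
  (forall i, (i <= n)%N -> q`_i = pcoef g i) ->
  (p * q)`_n = pcoef (ps_mul f g) n.
Proof.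
move=> pf qg; rewrite coefM /=; apply: eq_bigr => i _.
by rewrite pf ?qg ?leq_subr // -ltnS.
Qed.

Lemma ps_trunc_coef f n i : (i <= n)%N -> (ps_trunc f n.+1)`_i = pcoef f i.
Proof. by rewrite coef_poly ltnS => ->. Qed.

Lemma ps_addA : associative ps_add.
Proof. by move=> f g h; apply: pseries_eq => n /=; rewrite addrA. Qed.
Lemma ps_addC : commutative ps_add.
Proof. by move=> f g; apply: pseries_eq => n /=; rewrite addrC. Qed.
Lemma ps_add0 : left_id (ps_const 0) ps_add.
Proof. by move=> f; apply: pseries_eq => -[|n] /=; rewrite add0r. Qed.
Lemma ps_addN : left_inverse (ps_const 0) ps_opp ps_add.
Proof. by move=> f; apply: pseries_eq => -[|n] /=; rewrite addNr. Qed.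
Lemma ps_mulC : commutative ps_mul.
Proof.
move=> f g; apply: pseries_eq => n.
rewrite -(ps_coefM (@ps_trunc_coef f n) (@ps_trunc_coef g n)) mulrC.
exact: ps_coefM (@ps_trunc_coef g n) (@ps_trunc_coef f n).
Qed.
Lemma ps_mulA : associative ps_mul.
Proof.
move=> f g h; apply: pseries_eq => n.
have mulT u v i : (i <= n)%N ->
    (ps_trunc u n.+1 * ps_trunc v n.+1)`_i = pcoef (ps_mul u v) i.
  by move=> ni; apply: ps_coefM => j ji; rewrite ps_trunc_coef // (leq_trans ji).
rewrite -(ps_coefM (@ps_trunc_coef f n) (mulT g h)) mulrA.
exact: ps_coefM (mulT f g) (@ps_trunc_coef h n).
Qed.
Lemma ps_mul1 : left_id (ps_const 1) ps_mul.
Proof.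
move=> f; apply: pseries_eq => n /=; rewrite big_ord_recl /= mul1r subn0.
by rewrite big1 ?addr0 // => i _; rewrite mul0r.
Qed.
Lemma ps_mulD : left_distributive ps_mul ps_add.
Proof.
move=> f g h; apply: pseries_eq => n /=; rewrite -big_split.
by apply: eq_bigr => i _ /=; rewrite mulrDl.
Qed.

HB.instance Definition _ := GRing.isZmodule.Build pseries
  ps_addA ps_addC ps_add0 ps_addN.

Lemma ps_1neq0 : ps_const 1 != 0 :> pseries.
Proof. by apply/eqP => /(congr1 (fun f => pcoef f 0)) /= /eqP; rewrite oner_eq0. Qed.

HB.instance Definition _ := GRing.Zmodule_isComNzRing.Build pseries
  ps_mulA ps_mulC ps_mul1 ps_mulD ps_1neq0.

Lemma ps_const_zmod : zmod_morphism ps_const.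
Proof. by move=> a b; apply: pseries_eq => -[|n] //=; rewrite subr0. Qed.
Lemma ps_const_monoid : monoid_morphism ps_const.
Proof.
split=> // a b; apply: pseries_eq => -[|n] /=; first by rewrite big_ord1.
by rewrite big_ord_recl /= mulr0 big1 ?addr0 // => i _; rewrite mul0r.
Qed.
HB.instance Definition _ := GRing.isZmodMorphism.Build A pseries ps_const ps_const_zmod.
HB.instance Definition _ := GRing.isMonoidMorphism.Build A pseries ps_const ps_const_monoid.

Definition ps_coef0 (f : pseries) := pcoef f 0.

Lemma ps_coef0_zmod : zmod_morphism ps_coef0. Proof. by []. Qed.
Lemma ps_coef0_monoid : monoid_morphism ps_coef0.
Proof. by split=> // f g; rewrite /ps_coef0 /= big_ord1. Qed.
HB.instance Definition _ := GRing.isZmodMorphism.Build pseries A ps_coef0 ps_coef0_zmod.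
HB.instance Definition _ := GRing.isMonoidMorphism.Build pseries A ps_coef0 ps_coef0_monoid.

Lemma pcoefD f g n : pcoef (f + g : pseries) n = pcoef f n + pcoef g n.
Proof. by []. Qed.

Lemma pcoefXM f n : pcoef (ps_X * f : pseries) n = if n is k.+1 then pcoef f k else 0.
Proof.
case: n => [|n]; first by rewrite /= big_ord1 mul0r.
rewrite /= big_ord_recl /= mul0r add0r big_ord_recl /= mul1r.
by rewrite subSS subn0 big1 ?addr0 // => i _; rewrite mul0r.
Qed.

Lemma pcoefXnM f k n :
  pcoef (ps_X ^+ k * f : pseries) n = if (n < k)%N then 0 else pcoef f (n - k).
Proof.
elim: k n => [|k IH] n; first by rewrite expr0 mul1r subn0.
by rewrite exprS -mulrA pcoefXM; case: n => // n; rewrite IH ltnS subSS.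
Qed.

Lemma pcoefCM a f n : pcoef (ps_const a * f : pseries) n = a * pcoef f n.
Proof.
by rewrite /= big_ord_recl /= subn0 big1 ?addr0 // => i _; rewrite mul0r.
Qed.

Lemma pcoef_sum n (F : 'I_n -> pseries) k :
  pcoef (\sum_i F i) k = \sum_i pcoef (F i) k.
Proof.
elim: n F => [|n IH] F; first by rewrite !big_ord0; case: k.
by rewrite !big_ord_recr /= -IH.
Qed.

Definition ps_drop k f := PSeries (fun n => pcoef f (k + n)).

Lemma ps_split f k :
  f = \sum_(l < k) ps_const (pcoef f l) * ps_X ^+ l + ps_drop k f * ps_X ^+ k.
Proof.
apply: pseries_eq => n; rewrite pcoefD pcoef_sum mulrC pcoefXnM.
transitivity (\sum_(l < k) (if n == l then pcoef f n else 0) +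
    (if (n < k)%N then 0 else pcoef f n)); last first.
  congr (_ + _); last by case: ltnP => // kn; rewrite /= subnKC.
  apply: eq_bigr => l _; rewrite pcoefCM -[ps_X ^+ l]mulr1 pcoefXnM.
  case: ltngtP => [||->]; rewrite ?mulr0 //; last by rewrite subnn mulr1.
  by move=> ln; case E: (n - l)%N => [|j]; rewrite ?mulr0 //; move: ln; rewrite -subn_gt0 E.
case: ltnP => nk.
  rewrite (bigD1 (Ordinal nk)) //= eqxx big1 ?addr0 // => i.
  by rewrite -val_eqE /= eq_sym => /negbTE ->.
by rewrite big1 ?add0r // => i _; rewrite gtn_eqF // (leq_trans (ltn_ord i)).
Qed.

Lemma ps_coef0P f : ps_coef0 f = 0 <-> exists c, f = c * ps_X.
Proof.
split=> [f0|[c ->]]; last by rewrite mulrC /ps_coef0 pcoefXM.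
exists (ps_drop 1 f); rewrite {1}(ps_split f 1) big_ord1.
by rewrite -[pcoef f 0]/(ps_coef0 f) f0 rmorph0 mul0r add0r.
Qed.

Lemma ps_coef0_surj a : exists f, a = ps_coef0 f.
Proof. by exists (ps_const a). Qed.

Lemma ps_xcomplete : xcomplete (ps_X : pseries).
Proof.
split=> [a|z zX]; last first.
  apply: pseries_eq => n; have [c ->] := zX n.+1.
  by rewrite mulrC pcoefXnM ltnSn; case: n {zX}.
pose s k := PSeries (fun n => \sum_(l < n.+1) pcoef (a (k + l)%N) (n - l)).
exists (s 0%N) => n; exists (s n); elim: n => [|n IH].
  by rewrite big_ord0 add0r mulr1.
rewrite big_ord_recr /= {1}IH -addrA; congr (_ + _).
rewrite exprS mulrA -mulrDl; congr (_ * _).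
apply: pseries_eq => -[|j]; rewrite pcoefD [_ * ps_X]mulrC pcoefXM.
  by rewrite /= big_ord1 addn0 addr0.
rewrite [LHS]/= big_ord_recl /= addn0 subn0; congr (_ + _).
by apply: eq_bigr => i _; rewrite /bump /= add1n addnS subSS addSn.
Qed.

Lemma ps_domain : domain A -> domain pseries.
Proof.
move=> domA f g fg0; apply: contrapT => /not_orP[f0 g0].
have low (h : pseries) : h <> 0 -> exists k h', h = ps_X ^+ k * h' /\ pcoef h' 0 <> 0.
  move=> h0; have [n hn] : exists n, pcoef h n != 0.
    apply: contrapT => /forallNP hn; apply: h0; apply: pseries_eq => n.
    by have /negP := hn n; rewrite negbK => /eqP ->; case: n.
  have [k hk kmin] := ex_minnP (ex_intro (fun n => pcoef h n != 0) n hn).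
  exists k, (ps_drop k h); split; last by rewrite /= addn0; apply/eqP.
  rewrite {1}(ps_split h k) big1 ?add0r 1?mulrC // => i _.
  have /eqP -> : pcoef h i == 0.
    by apply/contraT => /kmin; rewrite leqNgt ltn_ord.
  by rewrite rmorph0 mul0r.
have [i [f' [fE f'0]]] := low _ f0; have [j [g' [gE g'0]]] := low _ g0.
have : pcoef (f * g) (i + j) = pcoef f' 0 * pcoef g' 0.
  have -> : f * g = ps_X ^+ (i + j) * (f' * g') by rewrite fE gE exprD; ring.
  by rewrite pcoefXnM ltnn subnn -[LHS]/(ps_coef0 (f' * g')) rmorphM.
rewrite fg0 => /esym E; have {}E : pcoef f' 0 * pcoef g' 0 = 0 by rewrite E; case: (i + j)%N.
by have [] := domA _ _ E.
Qed.

(** Substitution of [x] for the variable, for a ring that is [x]-adically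
    complete: the value is the unique limit of the partial sums. *)
Lemma ps_eval (D : comNzRingType) (f : {rmorphism A -> D}) (x : D) : xcomplete x ->
  exists F : {rmorphism pseries -> D}, (forall a, F (ps_const a) = f a) /\ F ps_X = x.
Proof.
move=> [xlim xsep].
pose S (p : pseries) (s : D) := forall n, exists c,
  s = \sum_(l < n) f (pcoef p l) * x ^+ l + c * x ^+ n.
have Suniq p s t : S p s -> S p t -> s = t.
  move=> ps pt; apply/eqP; rewrite -subr_eq0; apply/eqP/xsep => n.
  have [[c ->] [d ->]] := conj (ps n) (pt n).
  by exists (c - d); ring.
have [F FP] := choice (fun p => xlim (fun l => f (pcoef p l))).
have SF p : S p (F p) by apply: FP.
have truncE p n : \sum_(l < n) f (pcoef p l) * x ^+ l = (map_poly f (ps_trunc p n)).[x].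
  rewrite (@horner_coef_wide _ n) ?size_map_poly ?size_poly //.
    by apply: eq_bigr => i _; rewrite coef_map coef_poly ltn_ord.
  by apply: leq_trans (size_poly _ _); apply: size_poly.
have FB : zmod_morphism F.
  move=> p q; apply: (Suniq (p - q)) => // n.
  have [[c ->] [d ->]] := conj (SF p n) (SF q n); exists (c - d).
  have -> : \sum_(l < n) f (pcoef (p - q) l) * x ^+ l =
      \sum_(l < n) f (pcoef p l) * x ^+ l - \sum_(l < n) f (pcoef q l) * x ^+ l.
    by rewrite -sumrB; apply: eq_bigr => l _; rewrite -mulrBl -rmorphB.
  by ring.
have SX n : \sum_(l < n) f (pcoef ps_X l) * x ^+ l = if (n <= 1)%N then 0 else x.
  case: n => [|[|n]]; rewrite ?big_ord0 //; first by rewrite big_ord1 rmorph0 mul0r.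
  rewrite 2!big_ord_recl big1 => [|i _]; last by rewrite rmorph0 mul0r.
  by rewrite rmorph0 mul0r add0r addr0 rmorph1 mul1r.
have SC a n : \sum_(l < n.+1) f (pcoef (ps_const a) l) * x ^+ l = f a.
  by rewrite big_ord_recl big1 ?addr0 ?mulr1 // => i _; rewrite rmorph0 mul0r.
have FC a : F (ps_const a) = f a.
  apply: (Suniq (ps_const a)) => // -[|n]; first by exists (f a); rewrite big_ord0 add0r mulr1.
  by exists 0; rewrite SC mul0r addr0.
have FX : F ps_X = x.
  apply: (Suniq ps_X) => // n; rewrite SX; case: n => [|[|n]] /=.
  - by exists x; rewrite add0r mulr1.
  - by exists 1; rewrite add0r mul1r.
  - by exists 0; rewrite mul0r addr0.
have FM : monoid_morphism F.
  split=> [|p q]; first by rewrite -[1]/(ps_const 1) FC rmorph1.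
  apply: (Suniq (p * q)) => // n.
  have [[c ->] [d ->]] := conj (SF p n) (SF q n); rewrite !truncE.
  set P := map_poly f _; set Q := map_poly f _.
  pose W := drop_poly n (ps_trunc p n * ps_trunc q n).
  have PQ : P * Q = map_poly f (ps_trunc (p * q) n) + map_poly f W * 'X^n.
    rewrite -(map_polyXn f) -!rmorphM -rmorphD; congr (map_poly f _).
    rewrite -{1}[_ * _](poly_take_drop n); congr (_ + _).
    apply/polyP => i; rewrite coef_take_poly coef_poly; case: ltnP => // ni.
    by apply: ps_coefM => j ji; rewrite coef_poly (leq_ltn_trans ji).
  exists ((map_poly f W).[x] + c * Q.[x] + d * P.[x] + c * d * x ^+ n).
  have := congr1 (fun p => p.[x]) PQ; rewrite !hornerE => E.
  transitivity (P.[x] * Q.[x] + (c * Q.[x] + d * P.[x] + c * d * x ^+ n) * x ^+ n).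
    by ring.
  by rewrite E; ring.
by exists (mk_rmorphism FB FM).
Qed.

End PowerSeries.

(** Successive approximation: modulo [b] the error of a combination of the [d] is a
    multiple of [f y], and the corrections add up to power series in [y]. *)
Lemma complete_nakayama (A D : comPzRingType) (f : {rmorphism A -> D}) (y : A)
    (d b : seq D) : xcomplete y -> xcomplete (f y) ->
  (forall z, exists c, ideal_span (f y :: b) (z - lin f c d)) ->
  (forall z, exists c, ideal_span b (z - lin f c d)).
Proof.
move=> [ylim _] [xlim xsep] gen z; set x := f y in xlim xsep gen *.
have step u : exists cen : (nat -> A) * (nat -> D) * D,
    u = lin f cen.1.1 d + \sum_(i < size b) cen.1.2 i * b`_i + cen.2 * x.
  have [c /ideal_spanP [e E]] := gen u; exists (c, fun i => e i.+1, e 0%N) => /=.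
  by rewrite -[LHS](subrK (lin f c d)) E /= big_ord_recl /=; ring.
have [st stP] := choice step.
pose u n := iter n (fun v => (st v).2) z.
pose C l i := (st (u l)).1.1 i; pose E l i := (st (u l)).1.2 i.
have uE n : z = \sum_(l < n) (lin f (C l) d + \sum_(i < size b) E l i * b`_i) * x ^+ l
              + u n * x ^+ n.
  elim: n => [|n IH]; first by rewrite big_ord0 add0r mulr1.
  by rewrite {1}IH big_ord_recr /= {1}(stP (u n)) exprS /C /E; ring.
have [c cP] := choice (fun i => ylim (fun l => C l i)).
have [e eP] := choice (fun i => xlim (fun l => E l i)).
exists c; apply/ideal_spanP; exists e; apply/eqP; rewrite -subr_eq0.
apply/eqP/xsep => n.
have [c' c'P] := choice (fun i => cP i n); have [e' e'P] := choice (fun i => eP i n).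
have -> : lin f c d = \sum_(l < n) lin f (C l) d * x ^+ l + lin f c' d * x ^+ n.
  rewrite /lin.
  under [in RHS]eq_bigr do rewrite mulr_suml.
  rewrite exchange_big mulr_suml -big_split; apply: eq_bigr => i _ /=.
  rewrite {1}(c'P i) rmorphD rmorphM rmorphXn rmorph_sum /= mulrDl mulr_suml.
  congr (_ + _); last by rewrite /x; ring.
  by apply: eq_bigr => l _; rewrite rmorphM rmorphXn /= /x; ring.
have -> : \sum_(i < size b) e i * b`_i =
    \sum_(l < n) (\sum_(i < size b) E l i * b`_i) * x ^+ l +
    (\sum_(i < size b) e' i * b`_i) * x ^+ n.
  under [in RHS]eq_bigr do rewrite mulr_suml.
  rewrite exchange_big mulr_suml -big_split; apply: eq_bigr => i _ /=.
  rewrite {1}(e'P i) mulrDl mulr_suml; congr (_ + _); last by ring.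
  by apply: eq_bigr => l _; ring.
exists (u n - lin f c' d - \sum_(i < size b) e' i * b`_i).
rewrite {1}(uE n).
under eq_bigr do rewrite mulrDl.
by rewrite big_split /=; ring.
Qed.

(** * Adic descent of the Noetherian property *)

Lemma noetherian_surj (A B : comPzRingType) (p : {rmorphism A -> B}) :
  (forall b, exists a, b = p a) -> noetherian A -> noetherian B.
Proof.
move=> psurj noethA J; pose K := ideal_preim p J.
have [s Ks] := noethA K; exists (map p s).
rewrite eqEsubset; split=> [b|]; last first.
  apply: ideal_span_sub => _ /mapP[a as_ ->].
  by have : (K : set A) a by rewrite Ks; apply: ideal_span_mem.
have [a ->] := psurj b => Ja; have : (K : set A) a by [].
rewrite Ks => /ideal_spanP[c ->]; rewrite rmorph_sum; apply: ideal_sum => i.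
by rewrite rmorphM; apply: idealM; apply: ideal_span_mem; apply: map_f; apply: mem_nth.
Qed.

Section AdicNoetherian.
Variables (A A0 : comPzRingType) (x : A) (p : {rmorphism A -> A0}).
Hypotheses (psurj : forall b, exists a, b = p a)
  (pker : forall a, p a = 0 -> exists c, a = c * x)
  (xc : xcomplete x) (noethA0 : noetherian A0).

Let img (K : ideal A) : ideal A0.
Proof.
exists [set b | exists2 a, K a & b = p a].
- by exists 0; rewrite ?rmorph0 //; apply: ideal0.
- by move=> _ _ [a Ka ->] [b Kb ->]; exists (a + b); rewrite ?rmorphD //; apply: idealD.
- move=> b _ [a Ka ->]; have [c ->] := psurj b.
  by exists (c * a); rewrite ?rmorphM //; apply: idealM.
Defined.

Let img_gens (K : ideal A) : exists g : seq A, (forall a, a \in g -> K a) /\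
  forall a, K a -> exists (c : nat -> A) a',
    a = \sum_(i < size g) c i * g`_i + a' * x.
Proof.
have [s Ks] := noethA0 (img K).
have [g [gK gs]] : exists g : seq A, (forall a, a \in g -> K a) /\ map p g = s.
  have : forall b, b \in s -> img K b by move=> b bs; rewrite Ks; apply: ideal_span_mem.
  elim: s {Ks} => [|b s IH] sK; first by exists [::].
  have [a Ka ->] := sK b (mem_head _ _).
  have [|g [gK <-]] := IH; first by move=> c cs; apply: sK; rewrite inE cs orbT.
  by exists (a :: g); split=> // c; rewrite inE => /predU1P[->|/gK].
exists g; split=> // a Ka; have : img K (p a) by exists a.
rewrite Ks -gs => /ideal_spanP[c]; rewrite size_map => E.
have [c' c'P] := choice (fun i => psurj (c i)).
have [|a' a'P] := pker (a := a - \sum_(i < size g) c' i * g`_i).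
  rewrite rmorphB E rmorph_sum -sumrB big1 // => i _.
  by rewrite (nth_map 0) ?ltn_ord // rmorphM -c'P subrr.
by exists c', a'; rewrite -a'P addrC subrK.
Qed.

(** As in Hilbert's basis theorem: for an ideal [J] the images in [A / x] of the
    ideals [(J : x ^ n)] increase, so they are stationary from some [N] on.
    Successive approximation along [x] shows that lifts of generators of the image
    of [(J : x ^ N)] generate it, and descending induction on [N] reaches [J]. *)
Lemma xadic_noetherian : noetherian A.
Proof.
move=> J; pose K n := ideal_colon J (x ^+ n).
have [N KN] : exists N, forall n, (N <= n)%N -> img (K n) `<=` img (K N).
  pose F : set (ideal A0) := [set M | exists n, M = img (K n)].
  have F0 : F (img (K 0%N)) by exists 0%N.
  have [M [[N ->] _ Nmax]] := noetherian_max noethA0 F0.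
  exists N => n Nn; apply: Nmax; first by exists n.
  move=> _ [a Ka ->]; exists a => //=.
  by rewrite -(subnK Nn) exprD -mulrA; apply: idealM.

have fgN : exists s, (K N : set A) = ideal_span s.
  have [g [gK gP]] := img_gens (K N); exists g.
  rewrite eqEsubset; split; last exact: ideal_span_sub.
  have step (u : {na : nat * A | K (N + na.1)%N na.2}) :
      {c : (nat -> A) * A | (sval u).2 = \sum_(i < size g) c.1 i * g`_i + c.2 * x /\
        K (N + (sval u).1.+1)%N c.2}.
    apply: cid; case: u => -[n a] /= Ka.
    have [b Kb pab] : img (K N) (p a).
      by apply: (KN (N + n)%N (leq_addr _ _)); exists a.
    have [c [a1 bE]] := gP b Kb.
    have [|a2 a2E] := pker (a := a - b); first by rewrite rmorphB pab subrr.
    have aE : a = \sum_(i < size g) c i * g`_i + (a1 + a2) * x.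
      by rewrite -[LHS](subrK b) a2E bE; ring.
    exists (c, a1 + a2); split=> //=; rewrite addnS exprSr -mulrA.
    have -> : x * (a1 + a2) = a - \sum_(i < size g) c i * g`_i by rewrite aE; ring.
    rewrite mulrBr; apply: idealB => //; rewrite exprD mulrC mulrA.
    apply: ideal_mulr; rewrite mulrC mulr_sumr; apply: ideal_sum => i.
    by rewrite mulrCA; apply: idealM; apply: gK; apply: mem_nth.
  move=> a Ka.
  have Ka0 : K (N + 0)%N a by rewrite addn0.
  pose next (u : {na : nat * A | K (N + na.1)%N na.2}) :
     {na : nat * A | K (N + na.1)%N na.2} :=
   exist (fun na : nat * A => K (N + na.1)%N na.2)
     ((sval u).1.+1, (sval (step u)).2) (svalP (step u)).2.
  pose u n := iter n next (exist (fun na : nat * A => K (N + na.1)%N na.2) (0%N, a) Ka0).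
  pose c l := (sval (step (u l))).1.
  have aE n : a = \sum_(l < n) (\sum_(i < size g) c l i * g`_i) * x ^+ l +
      (sval (u n)).2 * x ^+ n.
    elim: n => [|n IH]; first by rewrite big_ord0 add0r mulr1.
    rewrite {1}IH big_ord_recr /= {1}(svalP (step (u n))).1 exprS /c.
    by ring.
  have [xlim xsep] := xc.
  have [s sP] := choice (fun i => xlim (fun l => c l i)).
  apply/ideal_spanP; exists s; apply/eqP; rewrite -subr_eq0; apply/eqP/xsep => n.
  have [s' s'P] := choice (fun i => sP i n).
  exists ((sval (u n)).2 - \sum_(i < size g) s' i * g`_i).
  rewrite {1}(aE n).
  have -> : \sum_(i < size g) s i * g`_i =
    \sum_(l < n) (\sum_(i < size g) c l i * g`_i) * x ^+ l +
    (\sum_(i < size g) s' i * g`_i) * x ^+ n.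
    under [in RHS]eq_bigr do rewrite mulr_suml.
    rewrite exchange_big mulr_suml -big_split; apply: eq_bigr => i _ /=.
    rewrite {1}(s'P i) mulrDl mulr_suml; congr (_ + _); last by ring.
    by apply: eq_bigr => l _; ring.
  by ring.
have [s] : exists s, (K 0%N : set A) = ideal_span s.
  elim: N fgN {KN} => // n IH [h hE]; apply: IH.
  have [g [gK gP]] := img_gens (K n); exists (g ++ map ( *%R^~ x) h).
  rewrite eqEsubset; split=> [a Ka|]; last first.
    apply: ideal_span_sub => a; rewrite mem_cat => /orP[/gK//|/mapP[b bh ->]].
    have : (K n.+1 : set A) b by rewrite hE; apply: ideal_span_mem.
    by rewrite /K /= exprSr -mulrA [x * _]mulrC.
  have [c [a' aE]] := gP a Ka.
  have : (K n.+1 : set A) a'.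
    rewrite /K /= exprSr -mulrA [x * _]mulrC.
    have -> : a' * x = a - \sum_(i < size g) c i * g`_i by rewrite aE; ring.
    rewrite mulrBr; apply: idealB => //; rewrite mulr_sumr; apply: ideal_sum => i.
    by rewrite mulrCA; apply: idealM; apply: gK; apply: mem_nth.
  rewrite hE => /ideal_spanP[e a'E]; rewrite aE a'E mulr_suml; apply: idealD.
    apply: ideal_sum => i; apply: idealM; apply: ideal_span_mem.
    by rewrite mem_cat mem_nth.
  apply: ideal_sum => i; rewrite -mulrA; apply: idealM; apply: ideal_span_mem.
  by rewrite mem_cat; apply/orP; right; apply/mapP; exists h`_i; rewrite ?mem_nth.
move=> E; exists s; rewrite -E eqEsubset; split=> a; rewrite /K /= expr0 mul1r //.
Qed.

End AdicNoetherian.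

Lemma ps_noetherian (A : comNzRingType) : noetherian A -> noetherian (pseries A).
Proof.
apply: (@xadic_noetherian _ _ (ps_X A) (@ps_coef0 A)).
- exact: ps_coef0_surj.
- by move=> f /ps_coef0P.
- exact: ps_xcomplete.
Qed.

(** * The completion of a Noetherian local ring *)

(** Adjoining one power series variable for each generator of the ideal presents
    a complete ring as a quotient of a Noetherian one. *)
Lemma noetherian_power_series_cover (R D : comNzRingType) (f : {rmorphism R -> D})
    (d xs : seq D) : noetherian R -> (forall x, x \in xs -> xcomplete x) ->
  (forall z, exists c, ideal_span xs (z - lin f c d)) ->
  exists (A : comNzRingType) (F : {rmorphism A -> D}),
    noetherian A /\ forall z, exists c, z = lin F c d.
Proof.
elim: xs R f => [|x xs IH] R f noethR xsc gen.
  exists R, f; split=> // z; have [c] := gen z.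
  by move=> /ideal_spanP[e]; rewrite big_ord0 => /eqP; rewrite subr_eq0 => /eqP; exists c.
have xc : xcomplete x by apply: xsc; rewrite mem_head.
have [F [FC FX]] := ps_eval f xc.
apply: (IH _ F); first exact: ps_noetherian.
  by move=> y ys; apply: xsc; rewrite inE ys orbT.
apply: (@complete_nakayama _ _ F (ps_X R)); rewrite ?FX //; first exact: ps_xcomplete.
move=> z; have [c cP] := gen z; exists (fun i => ps_const (c i)).
rewrite (_ : lin F _ d = lin f c d) //.
by apply: eq_bigr => i _; rewrite FC.
Qed.

Section Completion.
Variables (R : comNzRingType) (m : ideal R).
Hypotheses (noethR : noetherian R) (mloc : local_ring m).

Local Notation T := (completion m).
Local Notation iota := (to_completion m).

Lemma cmpl_down (t : T) n k x :
  t (n + k)%N = to_quot _ x -> t n = to_quot _ x.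
Proof.
elim: k x => [|k IH] x; first by rewrite addn0.
rewrite addnS => tx; have [y [ty]] := cmplP t (n + k).
rewrite tx => /to_quot_eq xy; apply: IH; rewrite ty; apply/to_quot_eq.
by rewrite -opprB; apply: idealN; apply: ideal_expSr.
Qed.

Lemma cmpl_le (t : T) n k x : (n <= k)%N ->
  t k = to_quot _ x -> t n = to_quot _ x.
Proof. by move=> /subnKC <-; apply: cmpl_down. Qed.

Lemma cmpl_lim (u : nat -> R) : (forall l, ideal_exp m l (u l.+1 - u l)) ->
  exists t : T, forall l, t l = to_quot _ (u l).
Proof.
move=> uC.
have uP n : exists x : R, to_quot (ideal_exp m n) (u n) = to_quot _ x /\
    to_quot (ideal_exp m n.+1) (u n.+1) = to_quot _ x.
  exists (u n.+1); split=> //; apply/to_quot_eq.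
  by rewrite -opprB; apply: idealN.
by exists (@Completion _ _ (fun n => to_quot _ (u n)) uP).
Qed.

Lemma cmpl_rep (t : T) : exists u : nat -> R,
  (forall l, t l = to_quot _ (u l)) /\ forall l, ideal_exp m l (u l.+1 - u l).
Proof.
have [u uP] := choice (fun l => to_quot_surj (t l)).
exists u; split=> // l; apply/to_quot_eq; rewrite -uP.
by apply/esym/(@cmpl_le _ _ l.+1).
Qed.

Lemma cmpl_1neq0 : 1 != 0 :> T.
Proof.
apply/eqP => /(congr1 (fun t : T => t 1%N)) /= /to_quot_eq.
by rewrite subr0 ideal_exp1; case: mloc => -[].
Qed.

Definition cmpl_ker (n : nat) : ideal T.
Proof.
exists (fun t : T => t n = 0).
- exact: (rmorph0 (to_quot _)).
- by move=> x y xn yn; rewrite /= -[LHS]/(x n + y n) xn yn addr0.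
- by move=> a x xn; rewrite /= -[LHS]/(a n * x n) xn mulr0.
Defined.

Lemma cmpl_kerM i j s t : cmpl_ker i s -> cmpl_ker j t -> cmpl_ker (i + j) (s * t).
Proof.
rewrite /cmpl_ker /= => si tj.
have [x sx] := to_quot_surj (s (i + j)%N); have [y ty] := to_quot_surj (t (i + j)%N).
rewrite sx ty -rmorphM; apply/to_quot0/ideal_expD; apply/to_quot0.
  by rewrite -si; apply/esym/(cmpl_le _ sx)/leq_addr.
by rewrite -tj; apply/esym/(cmpl_le _ ty)/leq_addl.
Qed.

Lemma iota_ker n x : cmpl_ker n (iota x) <-> ideal_exp m n x.
Proof. exact: to_quot0. Qed.

Definition cmpl_ideal := cmpl_ker 1.

Lemma iota_exp n x : ideal_exp m n x -> ideal_exp cmpl_ideal n (iota x).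
Proof.
elim: n x => [|n IH] x; first by move=> _; apply: ideal_exp0.
apply: (@ideal_expS_sub _ _ _ (ideal_preim iota (ideal_exp cmpl_ideal n.+1))) => y z my mz.
rewrite /ideal_preim /ideal_set rmorphM; apply: ideal_expS_mem; last exact: IH.
by apply/iota_ker; rewrite ideal_exp1.
Qed.

Lemma exp_span_coef (g : seq R) n k y : (ideal_exp m n : set R) = ideal_span g ->
  ideal_exp m (k + n) y ->
  exists c : nat -> R, (forall i, ideal_exp m k (c i)) /\
    y = \sum_(i < size g) c i * g`_i.
Proof.
move=> gE; elim: k y => [|k IH] y.
  rewrite add0n gE => /ideal_spanP[c ->]; exists c; split=> // i.
  exact: ideal_exp0.
have @K : ideal R.
  exists [set y | exists c : nat -> R, (forall i, ideal_exp m k.+1 (c i)) /\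
    y = \sum_(i < size g) c i * g`_i].
  - exists (fun=> 0); split=> [i|]; first exact: ideal0.
    by rewrite big1 // => i _; rewrite mul0r.
  - move=> _ _ [c [cm ->]] [d [dm ->]]; exists (fun i => c i + d i).
    split=> [i|]; first exact: idealD.
    by rewrite -big_split; apply: eq_bigr => i _; rewrite mulrDl.
  - move=> a _ [c [cm ->]]; exists (fun i => a * c i).
    split=> [i|]; first exact: idealM.
    by rewrite mulr_sumr; apply: eq_bigr => i _; rewrite mulrA.
rewrite addSn; apply: (@ideal_expS_sub _ _ _ K) => x z mx /IH[c [cm ->]].
exists (fun i => x * c i); split=> [i|]; first exact: ideal_expS_mem.
by rewrite mulr_sumr; apply: eq_bigr => i _; rewrite mulrA.
Qed.

Lemma cmpl_sum_at (k : nat) (F : 'I_k -> T) n : (\sum_i F i : T) n = \sum_i (F i n).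
Proof.
by elim: k F => [|k IH] F; rewrite ?big_ord0 ?rmorph0 // !big_ord_recr /= -IH.
Qed.

(** The completion is complete for the powers of its maximal ideal, because the
    power [m ^ n] is finitely generated: an element which vanishes modulo [m ^ n]
    is a combination of its generators, the coefficients being limits. *)
Lemma cmpl_ker_span n g t : (ideal_exp m n : set R) = ideal_span g ->
  cmpl_ker n t -> ideal_span (map iota g) t.
Proof.
move=> gE tn.
have [u [tu uC]] := cmpl_rep t.
have [c cP] : exists c : nat -> nat -> R, forall j,
    (forall i, ideal_exp m j (c j i)) /\
    u (j + n).+1 - u (j + n)%N = \sum_(i < size g) c j i * g`_i.
  suff /choice[c cP] j : exists c : nat -> R, (forall i, ideal_exp m j (c i)) /\
    u (j + n).+1 - u (j + n)%N = \sum_(i < size g) c i * g`_i by exists c.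
  exact: exp_span_coef gE (uC _).
have [gam gamP] : exists gam : nat -> T, forall i l,
    gam i l = to_quot _ (\sum_(j < l) c j i).
  suff /choice[h hP] i : exists h : T, forall l,
    h l = to_quot _ (\sum_(j < l) c j i) by exists h.
  apply: cmpl_lim => l; rewrite big_ord_recr /= [_ + c l i]addrC addrK.
  by have [] := cP l.
have un : ideal_exp m n (u n).
  by apply/to_quot0; rewrite -tu.
have -> : t = iota (u n) + \sum_(i < size g) gam i * iota g`_i.
  apply: cmpl_inj => l.
  have -> : (iota (u n) + \sum_(i < size g) gam i * iota g`_i : T) l =
     to_quot _ (u n) + (\sum_(i < size g) gam i * iota g`_i : T) l by [].
  rewrite cmpl_sum_at (@cmpl_le t l (l + n) _ (leq_addr _ _) (tu _)).
  have -> : \sum_(i < size g) (gam i * iota g`_i : T) l =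
      to_quot _ (\sum_(i < size g) (\sum_(j < l) c j i) * g`_i).
    by rewrite rmorph_sum; apply: eq_bigr => i _; rewrite -[LHS]/(gam i l * to_quot _ g`_i) gamP rmorphM.
  rewrite -rmorphD; congr (to_quot _ _).
  elim: l => [|l IH].
    by rewrite big1 ?addr0 // => i _; rewrite big_ord0 mul0r.
  rewrite addSn -[LHS](subrK (u (l + n)%N)) (cP l).2 IH addrC -addrA.
  congr (_ + _); rewrite -big_split; apply: eq_bigr => i _ /=.
  by rewrite big_ord_recr mulrDl.
apply: idealD; last first.
  apply: ideal_sum => i; apply: idealM; apply: ideal_span_mem.
  by apply: map_f; apply: mem_nth.
move: un; rewrite gE => /ideal_spanP[e ->]; rewrite rmorph_sum.
apply: ideal_sum => i; rewrite rmorphM; apply: idealM; apply: ideal_span_mem.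
by apply: map_f; apply: mem_nth.
Qed.

Lemma cmpl_ker_exp n t : cmpl_ker n t -> ideal_exp cmpl_ideal n t.
Proof.
have [g gE] := noethR (ideal_exp m n); move=> /(cmpl_ker_span gE).
apply: ideal_span_sub => _ /mapP[x xg ->]; apply: iota_exp.
by rewrite gE; apply: ideal_span_mem.
Qed.

Lemma cmpl_exp_ker n : ideal_exp cmpl_ideal n `<=` cmpl_ker n.
Proof.
elim: n => [|n IH] t.
  by move=> _; have [x tx] := to_quot_surj (t 0%N); rewrite /= tx; apply/to_quot0/ideal_exp0.
by apply: ideal_expS_sub => x y xI /IH; apply: (@cmpl_kerM 1).
Qed.

Lemma cmpl_icomplete : icomplete cmpl_ideal.
Proof.
split=> [u uC|z zI]; last by apply: cmpl_inj => n; apply: cmpl_exp_ker.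
have uE n : u n.+1 n = u n n.
  have : u n.+1 n - u n n = 0 by have := cmpl_exp_ker (uC n).
  by move=> /eqP; rewrite subr_eq0 => /eqP.
have lP n : exists x : R, u n n = to_quot _ x /\ u n.+1 n.+1 = to_quot _ x.
  by have [x [x1 x2]] := cmplP (u n.+1) n; exists x; rewrite -uE.
exists (@Completion _ _ (fun n => u n n) lP) => n; apply: cmpl_ker_exp.
exact: subrr.
Qed.

Lemma cmpl_approx n t : exists r, ideal_exp cmpl_ideal n (t - iota r).
Proof.
have [r tr] := to_quot_surj (t n); exists r; apply: cmpl_ker_exp.
by rewrite /cmpl_ker /= -[X in X = _]/(t n - to_quot _ r) tr subrr.
Qed.

Lemma cmpl_unit t : ~ cmpl_ideal t -> exists y, t * y = 1.
Proof.
move=> It; have [r tr] := cmpl_approx 1 t.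
rewrite ideal_exp1 in tr.
have mr : ~ m r.
  move=> mr; apply: It; rewrite -(subrK (iota r) t); apply: idealD => //.
  by apply/iota_ker; rewrite ideal_exp1.
have [y ry] := local_unit noethR mloc mr.
have [|z zP] := @icomplete_jacobson _ _ (1 - t * iota y) cmpl_icomplete.
  have -> : 1 - t * iota y = - (iota y * (t - iota r)).
    by rewrite -(rmorph1 iota) -ry rmorphM; ring.
  by apply: idealN; apply: idealM.
by exists (iota y * z); rewrite mulrA; move: zP; rewrite opprB addrC subrK.
Qed.

Lemma cmpl_noetherian : noetherian T.
Proof.
pose T' : comNzRingType := nzring cmpl_1neq0.
have [s ms] := noethR m.
have [|||A [F [noethA gen]]] :=
    @noetherian_power_series_cover R T' iota [:: 1] (map iota s).
- exact: noethR.
- move=> _ /mapP[x xs ->]; apply: (icomplete_xcomplete cmpl_icomplete).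
  by apply/iota_ker; rewrite ideal_exp1 ms; apply: ideal_span_mem.
- move=> z; have [r] := cmpl_approx 1 z; rewrite ideal_exp1 => zr.
  exists (fun=> r); rewrite lin_cons lin0 addr0 mulr1.
  by apply: (@cmpl_ker_span 1) => //; rewrite ideal_exp1.
apply: (@noetherian_surj A T' F) => // z; have [c ->] := gen z.
by exists (c 0%N); rewrite lin_cons lin0 addr0 mulr1.
Qed.

(** Ideals of [R] are contracted from the completion, because they are closed:
    the coefficients of a combination may be approximated by elements of [R]. *)
Lemma cmpl_span s a : ideal_span (map iota s) (iota a) -> ideal_span s a.
Proof.
move=> /ideal_spanP[c]; rewrite size_map => aE.
apply: (@krull_closed _ noethR m); first by move=> i; apply: local_jacobson.
move=> n; have [d dP] := choice (fun i => cmpl_approx n (c i)).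
exists (\sum_(i < size s) d i * s`_i); first exact: ideal_span_comb.
apply/iota_ker; apply: cmpl_exp_ker.
have -> : iota (a - \sum_(i < size s) d i * s`_i) =
    iota a - \sum_(i < size s) iota (d i * s`_i) by rewrite rmorphB rmorph_sum.
rewrite aE -sumrB; apply: ideal_sum => i; rewrite (nth_map 0) ?ltn_ord // rmorphM -mulrBl.
by apply: ideal_mulr.
Qed.

Lemma cmpl_nzd x : nonzerodivisors R x -> nonzerodivisors T (iota x).
Proof.
move=> xreg t xt; apply: cmpl_inj => k.
have [n nP] := nzd_weak_artin_rees noethR m k xreg.
have [r tr] := to_quot_surj (t (n + k)%N).
rewrite (@cmpl_le t k (n + k) _ (leq_addl _ _) tr); apply/to_quot0/nP.
apply: (@ideal_exp_anti _ _ _ (n + k)); first exact: leq_addr.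
have := congr1 (fun s : T => s (n + k)%N) xt.
by rewrite -[LHS]/(to_quot _ x * t (n + k)%N) tr -rmorphM => /to_quot0.
Qed.

End Completion.

(** * Subrings *)

(** Zorn's lemma for families of subsets ordered by inclusion. *)
Lemma zorn_sets (T : Type) (F : set (set T)) (C0 : set T) : F C0 ->
  (forall G : set (set T), G `<=` F -> G !=set0 ->
     (forall X Y, G X -> G Y -> X `<=` Y \/ Y `<=` X) -> F (\bigcup_(X in G) X)) ->
  exists M, F M /\ forall X, F X -> M `<=` X -> X `<=` M.
Proof.
move=> FC0 Fchain; pose U := {X : set T | F X}.
pose leU (X Y : U) : bool := `[< sval X `<=` sval Y >].
have [|||A Atot|[M FM] Mmax] := @Zorn U leU.
- by move=> X; apply/asboolP.
- by move=> X Y Z /asboolP XY /asboolP YZ; apply/asboolP/(subset_trans XY).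
- move=> [X FX] [Y FY] /asboolP XY /asboolP YX.
  by apply: eq_exist; rewrite eqEsubset.
- have [[X0 AX0]|A0] := pselect (exists X, A X); last first.
    by exists (exist _ C0 FC0) => X AX; exfalso; apply: A0; exists X.
  pose G : set (set T) := [set X | exists2 Y, A Y & X = sval Y].
  have FG : F (\bigcup_(X in G) X).
    apply: Fchain => [_ [[Y FY] _ ->]//||].
      by exists (sval X0); exists X0.
    move=> _ _ [X AX ->] [Y AY ->].
    by case: (Atot X Y AX AY) => /asboolP; [left|right].
  exists (exist _ _ FG) => X AX; apply/asboolP => x Xx /=.
  by exists (sval X) => //; exists X.
exists M; split=> // X FX MX.
have leMX : leU (exist _ M FM) (exist _ X FX) by apply/asboolP.
by have /(congr1 sval) /= <- := Mmax _ leMX.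
Qed.

Section Subrings.
Variable D : comNzRingType.
Implicit Types (S C E : set D).

Definition subr S := [/\ S 1, forall x y, S x -> S y -> S (x - y) &
  forall x y, S x -> S y -> S (x * y)].

Lemma sr0 S : subr S -> S 0.
Proof. by move=> [S1 SB _]; rewrite -(subrr 1); apply: SB. Qed.

Lemma srN S x : subr S -> S x -> S (- x).
Proof. by move=> sS Sx; rewrite -sub0r; have [_ SB _] := sS; apply: SB => //; apply: sr0. Qed.

Lemma srD S x y : subr S -> S x -> S y -> S (x + y).
Proof. by move=> sS Sx Sy; rewrite -[y]opprK; have [_ SB _] := sS; apply: SB => //; apply: srN. Qed.

Lemma srM S x y : subr S -> S x -> S y -> S (x * y).
Proof. by case=> _ _ SM; apply: SM. Qed.

Lemma srX S x n : subr S -> S x -> S (x ^+ n).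
Proof.
move=> sS Sx; elim: n => [|n IH]; first by case: sS.
by rewrite exprS; apply: srM.
Qed.

Lemma sr_sum S (n : nat) (F : 'I_n -> D) : subr S -> (forall i, S (F i)) -> S (\sum_i F i).
Proof.
by move=> sS SF; elim/big_ind: _ => // [|x y]; [apply: sr0|apply: srD].
Qed.

Lemma sr_nat S n : subr S -> S n%:R.
Proof.
move=> sS; elim: n => [|n IH]; first exact: sr0.
by rewrite -natr1; apply: srD => //; case: sS.
Qed.

Lemma sr_muln S x n : subr S -> S x -> S (x *+ n).
Proof. by move=> sS Sx; rewrite -mulr_natr; apply: srM => //; apply: sr_nat. Qed.

Definition polyIn S (P : {poly D}) := forall i, S P`_i.

Lemma sr_horner S P b : subr S -> polyIn S P -> S b -> S P.[b].
Proof.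
move=> sS SP Sb; rewrite horner_coef; apply: sr_sum => // i.
by apply: srM => //; apply: srX.
Qed.

Definition adj S (b : D) : set D := [set x | exists P, polyIn S P /\ x = P.[b]].

Lemma polyInC S c : subr S -> S c -> polyIn S c%:P.
Proof. by move=> sS Sc i; rewrite coefC; case: ifP => // _; apply: sr0. Qed.

Lemma polyInM S P Q : subr S -> polyIn S P -> polyIn S Q -> polyIn S (P * Q).
Proof.
move=> sS SP SQ i; rewrite coefM; apply: sr_sum => // j.
exact: srM.
Qed.

Lemma polyInB S P Q : subr S -> polyIn S P -> polyIn S Q -> polyIn S (P - Q).
Proof. by move=> sS SP SQ i; rewrite coefB; have [_ SB _] := sS; apply: SB. Qed.

Lemma adj_subr S b : subr S -> subr (adj S b).
Proof.
move=> sS; split.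
- by exists 1%:P; rewrite hornerC; split=> //; apply: polyInC => //; case: sS.
- move=> _ _ [P [SP ->]] [Q [SQ ->]]; exists (P - Q).
  by rewrite !hornerE; split=> //; apply: polyInB.
- move=> _ _ [P [SP ->]] [Q [SQ ->]]; exists (P * Q).
  by rewrite !hornerE; split=> //; apply: polyInM.
Qed.

Lemma sub_adj S b : subr S -> S `<=` adj S b.
Proof. by move=> sS x Sx; exists x%:P; rewrite hornerC; split=> //; apply: polyInC. Qed.

Lemma mem_adj S b : subr S -> adj S b b.
Proof.
move=> sS; exists 'X; rewrite hornerX; split=> // i; rewrite coefX.
exact: sr_nat.
Qed.

Lemma adj_sub S E b : subr E -> S `<=` E -> E b -> adj S b `<=` E.
Proof. by move=> sE SE Eb _ [P [SP ->]]; apply: sr_horner => // i; apply: SE. Qed.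

(** The binomial coefficients ['C(p, i)] with [0 < i < p] are divisible by [p]. *)
Lemma frobenius_mod S p x y : prime p -> subr S -> S x -> S y ->
  exists2 z, S z & (x + y) ^+ p = x ^+ p + y ^+ p + p%:R * z.
Proof.
move=> pp sS Sx Sy; case: p pp => // p pp.
exists (\sum_(i < p) (x ^+ (p.+1 - i.+1) * y ^+ i.+1) *+ ('C(p.+1, i.+1) %/ p.+1)).
  apply: sr_sum => // i; apply: sr_muln => //.
  by apply: srM => //; apply: srX.
rewrite exprDn big_ord_recr big_ord_recl /= bin0 binn subn0 subnn !expr0 mulr1 mul1r !mulr1n.
rewrite addrAC; congr (_ + _); rewrite mulr_sumr; apply: eq_bigr => i _ /=.
rewrite mulr_natl -mulrnA /bump /= add1n divnK //.
by apply: prime_dvd_bin => //=; rewrite ltnS.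
Qed.

End Subrings.

(** * Algebraic relations in a residue field *)

Lemma size_lead_cancel (R : comNzRingType) (H G : {poly R}) (a c : R) :
  H != 0 -> G != 0 -> (size G <= size H)%N -> a * lead_coef H = c * lead_coef G ->
  (size (a%:P * H - c%:P * 'X^(size H - size G) * G)%R < size H)%N.
Proof.
move=> H0 G0 GH acE.
have Hs : (0 < size H)%N by rewrite lt0n size_poly_eq0.
have Gs : (0 < size G)%N by rewrite lt0n size_poly_eq0.
rewrite -[X in (_ < X)%N](ltn_predK Hs) ltnS; apply/leq_sizeP => j jH.
rewrite coefB -mulrA !coefCM coefXnM ltnNge.
have -> : (size H - size G <= j)%N.
  by apply: leq_trans jH; rewrite -subn1 leq_sub2l.
move: jH; rewrite leq_eqVlt => /predU1P[<-|jH] /=.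
  have -> : ((size H).-1 - (size H - size G))%N = (size G).-1.
    by move: Hs Gs GH; lia.
  by rewrite -!lead_coefE acE subrr.
have Hj : (size H <= j)%N by rewrite -(ltn_predK Hs).
rewrite !nth_default ?mulr0 ?subrr //.
by apply: leq_trans (leq_sub2r _ Hj); rewrite subKn.
Qed.

Section ResidueRelations.
Variables (k : fieldType) (S : set k).
Hypothesis sS : subr S.

(** A relation of minimal degree divides every other one up to scalars. *)
Lemma min_relation b : (exists Q : {poly k}, [/\ polyIn S Q, Q != 0 & Q.[b] = 0]) ->
  exists Q : {poly k}, [/\ polyIn S Q, Q != 0, Q.[b] = 0 &
    forall G, polyIn S G -> G.[b] = 0 -> (size G < size Q)%N -> G = 0].
Proof.
move=> [Q0 [SQ0 Q00 Q0b]].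
pose P n := `[< exists Q : {poly k}, [/\ polyIn S Q, Q != 0, Q.[b] = 0 & size Q = n] >].
have exP : exists n, P n by exists (size Q0); apply/asboolP; exists Q0.
have [n /asboolP [Q [SQ Qn0 Qb Qn]] nmin] := ex_minnP exP.
exists Q; split=> // G SG Gb GQ; apply/eqP; apply: contraTT GQ => G0.
by rewrite -leqNgt Qn; apply: nmin; apply/asboolP; exists G.
Qed.

(** If [b ^ p] lies in the subfield [S], the polynomial [X ^ p - b ^ p], which is
    [(X - b) ^ p], has no factor of smaller degree over [S] unless [b] is in [S]. *)
Lemma purely_insep_relation p b (Q : {poly k}) : p \in [pchar k] ->
  (forall x, S (x ^+ p)) -> ~ S b -> polyIn S Q -> (size Q <= p)%N -> Q.[b] = 0 ->
  Q = 0.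
Proof.
move=> pk Sp Sb SQ Qp Qb; apply/eqP; apply: contraT => Q0.
have pp : prime p := pcharf_prime pk.
have Sinv x : S x -> S x^-1.
  move=> Sx; have [->|x0] := eqVneq x 0; first by rewrite invr0; apply: sr0.
  have -> : x^-1 = x ^+ p.-1 * (x^-1) ^+ p.
    rewrite -[in RHS](prednK (prime_gt0 pp)) exprS mulrCA -exprMn divff //.
    by rewrite expr1n mulr1.
  by apply: srM => //; apply: srX.
have [G [SG G0 Gb Gmin]] : exists G : {poly k}, [/\ polyIn S G, G != 0, G.[b] = 0 &
    forall H, polyIn S H -> H.[b] = 0 -> (size H < size G)%N -> H = 0].
  by apply: min_relation; exists Q.
have GQ : (size G <= size Q)%N.
  by rewrite leqNgt; apply/negP => /(Gmin _ SQ Qb)/eqP; apply/negP.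
have lG0 : lead_coef G != 0 by rewrite lead_coef_eq0.
have Gdvd n : forall H : {poly k}, (size H <= n)%N -> polyIn S H -> H.[b] = 0 -> G %| H.
  elim: n => [|n IH] H Hn SH Hb.
    by move: Hn; rewrite leqn0 size_poly_eq0 => /eqP ->; apply: dvdp0.
  have [HG|GH] := ltnP (size H) (size G); first by rewrite (Gmin H) // dvdp0.
  have H0 : H != 0.
    by rewrite -size_poly_eq0 -lt0n (leq_trans _ GH) // lt0n size_poly_eq0.
  pose c := lead_coef H / lead_coef G; pose K := 1%:P * H - c%:P * 'X^(size H - size G) * G.
  have Sc : S c by apply: srM => //; [apply: SH|apply/Sinv/SG].
  have -> : H = K + c%:P * 'X^(size H - size G) * G by rewrite subrK mul1r.
  apply: dvdp_add; last exact: dvdp_mulIr.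
  apply: IH.
  - rewrite -ltnS (leq_trans _ Hn) //; apply: size_lead_cancel => //.
    by rewrite mul1r /c divfK.
  - rewrite /K mul1r; apply: polyInB => //; apply: polyInM => //; apply: polyInM => //; first exact: polyInC.
    by move=> i; rewrite coefXn; apply: sr_nat.
  - by rewrite /K !hornerE Hb Gb !mulr0 subr0.
have XpE : 'X^p - (b ^+ p)%:P = ('X - b%:P) ^+ p.
  have pP : p \in [pchar {poly k}] by rewrite pchar_poly.
  by rewrite -!(pFrobenius_autE pP) rmorphB /= !pFrobenius_autE rmorphXn.
have : G %| 'X^p - (b ^+ p)%:P.
  apply: (Gdvd _ _ (leqnn _)); last by rewrite !hornerE subrr.
  apply: polyInB => //; last exact: polyInC.
  by move=> i; rewrite coefXn; apply: sr_nat.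
rewrite XpE => /dvdp_exp_XsubCP[j jp /eqpP [[c d] /= /andP[c0 d0] cdG]].
have sG : size G = j.+1.
  by rewrite -(size_scale _ c0) cdG size_scale // size_exp_XsubC.
have j0 : (0 < j)%N.
  rewrite lt0n; apply/eqP => j0; move: cdG; rewrite j0 expr0 => /(congr1 (fun P => P.[b])).
  by rewrite !hornerE Gb mulr0 => /esym/eqP; apply/negP.
have jp' : (j < p)%N by rewrite -sG (leq_trans GQ).
have jk : (j%:R : k) != 0.
  by rewrite -(dvdn_pcharf pk); apply/negP => /(dvdn_leq j0); rewrite leqNgt jp'.
have XE : ('X - b%:P) ^+ j = \prod_(x <- nseq j b) ('X - x%:P).
  by rewrite big_nseq -Monoid.iteropE /=.
have co : (('X - b%:P) ^+ j)`_j.-1 = - (b *+ j).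
  have := @coefPn_prod_XsubC k (nseq j b); rewrite size_nseq -lt0n => /(_ j0).
  rewrite -XE => ->; congr (- _); elim: (j) => [|i IH]; first by rewrite big_nil.
  by rewrite /= big_cons IH mulrS.
have col : (('X - b%:P) ^+ j)`_j = 1.
  have /monicP : ('X - b%:P) ^+ j \is monic by rewrite monic_exp ?monicXsubC.
  by rewrite lead_coefE size_exp_XsubC.
have E1 := congr1 (fun P : {poly k} => P`_j.-1) cdG; have E2 := congr1 (fun P : {poly k} => P`_j) cdG.
rewrite !coefZ co in E1; rewrite !coefZ col mulr1 in E2.
exfalso; apply: Sb.
have -> : b = - (G`_j.-1 * (G`_j)^-1 * (j%:R)^-1).
  have Gj : G`_j != 0 by apply: contraNneq d0 => Gj; rewrite -E2 Gj mulr0.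
  have dE : d = c * G`_j by rewrite E2.
  have E3 : G`_j.-1 = - (G`_j * (b *+ j)).
    apply: (mulfI c0); rewrite E1 dE; ring.
  by rewrite E3 -mulr_natr; field; rewrite jk.
apply: srN => //; do ?apply: srM => //; apply: Sinv => //; exact: sr_nat.
Qed.

End ResidueRelations.

(** * Coefficient rings of complete local domains *)

Lemma residue_field_exists (D : comNzRingType) (I : ideal D) :
  ~ I 1 -> (forall d, ~ I d -> exists y, d * y = 1) ->
  exists (k : fieldType) (res : {rmorphism D -> k}),
    (forall x, exists d, x = res d) /\ (forall d, res d = 0 <-> I d).
Proof.
move=> I1 Iunit.
have res_neq0 : 1 != 0 :> quot I.
  by apply/eqP; rewrite -(rmorph1 (to_quot I)) => /to_quot0.
have res_inv (x : quot I) : x != 0 -> exists y, y * x = 1.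
  have [d ->] := to_quot_surj x => /eqP d0.
  have [|y dy] := Iunit d; first by move=> Id; apply: d0; apply/to_quot0.
  by exists (to_quot I y); rewrite -rmorphM mulrC dy rmorph1.
exists (fieldring res_neq0 res_inv), (to_quot I).
by split; [exact: to_quot_surj|exact: to_quot0].
Qed.

Lemma taylor2 (D : comNzRingType) (P : {poly D}) (b e : D) :
  exists c, P.[b + e] = P.[b] + P^`().[b] * e + c * e ^+ 2.
Proof.
elim/poly_ind: P => [|P a [c IH]].
  by exists 0; rewrite deriv0 !horner0; ring.
exists (P^`().[b] + c * (b + e)).
by rewrite derivD derivM derivX derivC !hornerE IH /=; ring.
Qed.

Section Stages.
Variables (D : comNzRingType) (I : ideal D) (res_field : fieldType).
Variable (res : {rmorphism D -> res_field}).
Hypotheses (I1 : ~ I 1) (Iunit : forall d, ~ I d -> exists y, d * y = 1).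
Hypotheses (res_surj : forall x, exists d, x = res d) (res0 : forall d, res d = 0 <-> I d).

Lemma max_prime x y : I (x * y) -> I x \/ I y.
Proof.
move=> Ixy; apply: contrapT => /not_orP[/Iunit[u xu] /Iunit[v yv]].
apply: I1; have -> : 1 = (u * v) * (x * y) by rewrite -[LHS]mulr1 -{1}xu -yv; ring.
exact: idealM.
Qed.

Lemma max_primeX x n : I (x ^+ n) -> I x.
Proof. by elim: n => [/I1//|n IH]; rewrite exprS => /max_prime[]. Qed.

Variable q : nat.
Local Notation pi := (q%:R : D).
Hypothesis Ipi : I pi.

(** An approximation of a coefficient ring: [E] maps onto the residue field, and
    modulo [I ^ n.+1] the kernel of this map is generated by [q]. *)
Definition coef_stage n (E : set D) :=
  [/\ subr E, ideal_exp I n.+1 `<=` E, forall d, exists2 e, E e & I (d - e) &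
    forall e, E e -> I e -> exists2 e', E e' & ideal_exp I n.+1 (e - pi * e')].

Lemma coef_stage0 : coef_stage 0 setT.
Proof.
split=> // [d|e _ Ie]; first by exists d; rewrite ?subrr //; apply: ideal0.
by exists 0 => //; rewrite mulr0 subr0 ideal_exp1.
Qed.

Section Step.
Variables (n : nat) (E : set D).
Hypothesis stE : coef_stage n E.

Let sE : subr E. Proof. by case: stE. Qed.
Let IE : ideal_exp I n.+1 `<=` E. Proof. by case: stE. Qed.
Let E_onto d : exists2 e, E e & I (d - e). Proof. by case: stE. Qed.
Let E_ker e : E e -> I e -> exists2 e', E e' & ideal_exp I n.+1 (e - pi * e').
Proof. by case: stE => _ _ _; apply. Qed.

(** In a stage that follows [E] the elements of [I] have to be [small]: multiples
    of the residue characteristic modulo [I ^ n.+2]. *)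
Let Epi : E pi. Proof. exact: sr_nat. Qed.

Definition small c := exists2 e, E e & ideal_exp I n.+2 (c - pi * e).

Definition refinement (P C : set D) :=
  [/\ subr C, C `<=` E, ideal_exp I n.+2 `<=` C, P `<=` C &
      forall c, C c -> I c -> small c].

Lemma small0 : small 0.
Proof. by exists 0; [apply: sr0|rewrite mulr0 subr0; apply: ideal0]. Qed.

Lemma smallD x y : small x -> small y -> small (x + y).
Proof.
move=> [e Ee xe] [e' Ee' ye']; exists (e + e'); first exact: srD.
have -> : x + y - pi * (e + e') = (x - pi * e) + (y - pi * e') by ring.
exact: idealD.
Qed.

Lemma smallM a x : E a -> small x -> small (a * x).
Proof.
move=> Ea [e Ee xe]; exists (a * e); first exact: srM.
have -> : a * x - pi * (a * e) = a * (x - pi * e) by ring.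
exact: idealM.
Qed.

Lemma small_exp x : ideal_exp I n.+2 x -> small x.
Proof. by move=> x2; exists 0; rewrite ?mulr0 ?subr0 //; apply: sr0. Qed.

Lemma small_horner (C : set D) (P : {poly D}) b : refinement set0 C -> polyIn C P -> E b ->
  (forall i, I P`_i) -> small P.[b].
Proof.
move=> [_ _ _ _ Csmall] CP Eb IP; rewrite horner_coef.
elim/big_ind: _ => [|x y|i _]; [exact: small0|exact: smallD|].
by rewrite mulrC; apply: smallM; [apply: srX|apply: Csmall].
Qed.

(** A maximal subring with small intersection with [I] contains every [b] that
    can be adjoined to it without losing this property. *)
Lemma refinement_max (P C0 : set D) : refinement P C0 ->
  exists C, refinement P C /\ forall b, E b ->
    (forall Q, polyIn C Q -> I Q.[b] -> small Q.[b]) -> C b.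
Proof.
move=> PC0; have [|C [PC Cmax]] := @zorn_sets D (refinement P) C0 PC0.
  move=> G GF [X0 GX0] Gtot.
  have GF' X : G X -> refinement P X by move=> /GF.
  have common x y : (\bigcup_(X in G) X) x -> (\bigcup_(X in G) X) y ->
      exists2 X, G X & X x /\ X y.
    move=> [X GX Xx] [Y GY Yy].
    have [XY|YX] := Gtot X Y GX GY; first by exists Y => //; split=> //; apply: XY.
    by exists X => //; split=> //; apply: YX.
  split.
  - split.
    + by exists X0 => //; have [[]] := GF' _ GX0.
    + move=> x y Gx Gy; have [X GX [Xx Xy]] := common x y Gx Gy.
      by exists X => //; have [[_ XB _] _ _ _ _] := GF' _ GX; apply: XB.
    + move=> x y Gx Gy; have [X GX [Xx Xy]] := common x y Gx Gy.
      by exists X => //; have [[_ _ XM] _ _ _ _] := GF' _ GX; apply: XM.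
  - by move=> x [X GX Xx]; have [_ XE _ _ _] := GF' _ GX; apply: XE.
  - by move=> x x2; exists X0 => //; have [_ _ XI _ _] := GF' _ GX0; apply: XI.
  - by move=> x Px; exists X0 => //; have [_ _ _ XP _] := GF' _ GX0; apply: XP.
  - by move=> x [X GX Xx]; have [_ _ _ _ XS] := GF' _ GX; apply: XS.
exists C; split=> // b Eb Qb; have [sC CE CI CP CS] := PC.
have Cb : C `<=` adj C b by apply: sub_adj.
apply: (Cmax (adj C b)) (mem_adj _ sC) => //; split.
- exact: adj_subr.
- exact: adj_sub.
- exact: subset_trans Cb.
- exact: subset_trans Cb.
- by move=> _ [Q [CQ ->]]; apply: Qb.
Qed.

(** Once such a subring [C] maps onto the residue field, multiples of [q] by
    elements of [E] are multiples of [q] by elements of [C] modulo [I ^ n.+2]: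
    iterating [e = c + q e1] leaves a multiple of [q ^ n.+2], which lies there. *)
Lemma refinement_stage (P C : set D) : refinement P C ->
  (forall d, exists2 c, C c & I (d - c)) ->
  coef_stage n.+1 C /\ forall e, E e -> exists2 c, C c & ideal_exp I n.+1 (e - c).
Proof.
move=> [sC CE CI _ CS] Conto.
have Cpi : C pi by apply: sr_nat.
have split1 e : E e -> exists c1 e1, [/\ C c1, E e1 & ideal_exp I n.+1 (e - c1 - pi * e1)].
  move=> Ee; have [c Cc ec] := Conto e.
  have [|//|e1 Ee1 E1] := E_ker (e := e - c).
    by have [_ EB _] := sE; apply: EB => //; apply: CE.
  by exists c, e1.
have approx k e : E e -> exists c e', [/\ C c, E e' &
    ideal_exp I n.+2 (pi * e - pi * c - pi ^+ k.+1 * e')].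
  elim: k e => [|k IH] e Ee.
    exists 0, e; split=> //; first exact: sr0.
    by rewrite expr1 mulr0 subr0 subrr; apply: ideal0.
  have [c [e' [Cc Ee' H]]] := IH e Ee.
  have [c1 [e1 [Cc1 Ee1 H1]]] := split1 e' Ee'.
  exists (c + pi ^+ k * c1), e1; split=> //.
    by apply: srD => //; apply: srM => //; apply: srX.
  have -> : pi * e - pi * (c + pi ^+ k * c1) - pi ^+ k.+2 * e1 =
    (pi * e - pi * c - pi ^+ k.+1 * e') + pi ^+ k * (pi * (e' - c1 - pi * e1)).
    by rewrite !exprS; ring.
  by apply: idealD => //; apply: idealM; apply: ideal_expS_mem.
have piC e : E e -> exists2 c, C c & ideal_exp I n.+2 (pi * e - pi * c).
  move=> Ee; have [c [e' [Cc _ H]]] := approx n.+1 e Ee; exists c => //.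
  apply: (ideal_subP (y := pi ^+ n.+2 * e')) => //.
  by apply: ideal_mulr; apply: ideal_exp_pow.
split=> [|e Ee].
  split=> // c Cc Ic; have [e Ee H] := CS c Cc Ic.
  have [c' Cc' H'] := piC e Ee; exists c' => //.
  by rewrite -(subrK (pi * e) c) -addrA; apply: idealD.
have [c1 [e1 [Cc1 Ee1 H1]]] := split1 e Ee; have [c Cc H] := piC e1 Ee1.
exists (c1 + pi * c); first by apply: srD => //; apply: srM.
have -> : e - (c1 + pi * c) = (e - c1 - pi * e1) + (pi * e1 - pi * c) by ring.
by apply: idealD => //; apply: ideal_expSr.
Qed.

Definition next_stage (E' : set D) := coef_stage n.+1 E' /\ E' `<=` E /\
  forall e, E e -> exists2 c, E' c & ideal_exp I n.+1 (e - c).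

Let img (C : set D) : set res_field := [set x | exists2 c, C c & x = res c].

Let img_subr C : subr C -> subr (img C).
Proof.
move=> sC; split.
- by exists 1; rewrite ?rmorph1 //; case: sC.
- move=> _ _ [c Cc ->] [d Cd ->]; exists (c - d); rewrite ?rmorphB //.
  by have [_ CB _] := sC; apply: CB.
- move=> _ _ [c Cc ->] [d Cd ->]; exists (c * d); rewrite ?rmorphM //.
  exact: srM.
Qed.

Let img_poly C Q : polyIn C Q -> polyIn (img C) (map_poly res Q).
Proof. by move=> CQ i; rewrite coef_map; exists Q`_i. Qed.

Let img_lift C (Q : {poly res_field}) : subr C -> polyIn (img C) Q -> exists Q',
  [/\ polyIn C Q', map_poly res Q' = Q & size Q' = size Q].
Proof.
move=> sC SQ.
have [c cP] : exists c : nat -> D, forall i, [/\ C (c i), res (c i) = Q`_i & Q`_i = 0 -> c i = 0].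
  suff /choice[c cP] i : exists d, [/\ C d, res d = Q`_i & Q`_i = 0 -> d = 0] by exists c.
  have [Qi|Qi] := eqVneq (Q`_i) 0; first by exists 0; rewrite rmorph0 Qi; split=> //; apply: sr0.
  have [d Cd dE] := SQ i; exists d; rewrite dE; split=> // d0.
  by move: Qi; rewrite dE d0 eqxx.
exists (\poly_(i < size Q) c i); have mapE : map_poly res (\poly_(i < size Q) c i) = Q.
  apply/polyP => i; rewrite coef_map coef_poly; case: ltnP => [_|Qi].
    by have [] := cP i.
  by rewrite raddf0 nth_default.
split=> // [i|].
  by rewrite coef_poly; case: ifP => _; [have [] := cP i|apply: sr0].
apply/eqP; rewrite eqn_leq size_poly /= -{1}mapE.
by rewrite size_poly.
Qed.

(** Residue characteristic [q > 0]: the [q]-th powers of [E], which have to be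
    kept, are determined modulo [q E + I ^ n.+2] by their residues. *)
Lemma next_stage_pchar : prime q -> exists E', next_stage E'.
Proof.
move=> qp.
pose C0 : set D := [set x | exists r s, [/\ E r, E s &
  ideal_exp I n.+2 (x - r ^+ q - pi * s)]].
pose P : set D := [set x | exists2 e, E e & x = e ^+ q].
have q0 : (0 < q)%N by apply: prime_gt0.
have PC0 : refinement P C0.
  have frobD x y : E x -> E y -> exists2 z, E z & (x + y) ^+ q = x ^+ q + y ^+ q + pi * z.
    exact: frobenius_mod.
  split.
  - split.
    + exists 1, 0; split=> //; [by case: sE|exact: sr0|].
      by rewrite expr1n mulr0 subr0 subrr; apply: ideal0.
    + move=> x y [r [s [Er Es H]]] [r' [s' [Er' Es' H']]].
      have Er'' := srN sE Er'.
      have [z Ez Hz] := frobD r (- r') Er Er''.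
      have [w Ew Hw] := frobD r' (- r') Er' Er''.
      exists (r - r'), (s - s' + w - z); split.
      * by have [_ EB _] := sE; apply: EB.
      * have [_ EB _] := sE; apply: (EB (s - s' + w) z) => //; apply: srD => //; exact: (EB s s').
      * rewrite Hz.
        have -> : (- r') ^+ q = - r' ^+ q - pi * w.
          move: Hw; rewrite subrr expr0n eqn0Ngt q0 /= => Hw.
          by apply/eqP; rewrite -subr_eq0 [X in _ == X]Hw; apply/eqP; ring.
        have -> : x - y - (r ^+ q + (- r' ^+ q - pi * w) + pi * z) - pi * (s - s' + w - z) =
           (x - r ^+ q - pi * s) - (y - r' ^+ q - pi * s') by ring.
        exact: idealB.
    + move=> x y [r [s [Er Es H]]] [r' [s' [Er' Es' H']]].
      exists (r * r'), (r ^+ q * s' + s * r' ^+ q + pi * s * s'); split.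
      * exact: srM.
      * do ?apply: srD => //; do ?apply: srM => //; exact: srX.
      * have -> : x * y - (r * r') ^+ q - pi * (r ^+ q * s' + s * r' ^+ q + pi * s * s') =
          y * (x - r ^+ q - pi * s) + (r ^+ q + pi * s) * (y - r' ^+ q - pi * s').
          by rewrite exprMn; ring.
        by apply: idealD; apply: idealM.
  - move=> x [r [s [Er Es H]]].
    have -> : x = (x - r ^+ q - pi * s) + r ^+ q + pi * s by ring.
    apply: srD => //; last exact: srM.
    apply: srD => //; last exact: srX.
    by apply: IE; apply: ideal_expSr.
  - move=> x H; exists 0, 0; split; [exact: sr0|exact: sr0|].
    by rewrite expr0n eqn0Ngt q0 mulr0 !subr0.
  - move=> _ [e Ee ->]; exists e, 0; split=> //; first exact: sr0.
    by rewrite subrr mulr0 subr0; apply: ideal0.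
  - move=> c [r [s [Er Es H]]] Ic.
    have Ir : I r.
      apply: (@max_primeX r q).
      have -> : r ^+ q = c - pi * s - (c - r ^+ q - pi * s) by ring.
      apply: idealB; last by apply: ideal_exp_sub H.
      by apply: idealB => //; apply: ideal_mulr.
    have [e Ee He] := E_ker Er Ir.
    exists (pi ^+ q.-1 * e ^+ q + s).
      by apply: srD => //; apply: srM; rewrite //; apply: srX.
    have -> : c - pi * (pi ^+ q.-1 * e ^+ q + s) =
       (c - r ^+ q - pi * s) + (r ^+ q - (pi * e) ^+ q).
      have piq : pi ^+ q = pi * pi ^+ q.-1 by rewrite -exprS (ltn_predK q0).
      by rewrite [(pi * e) ^+ q]exprMn piq; ring.
    apply: idealD => //; rewrite subrXX mulrC; apply: ideal_expS_mem => //.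
    have [q' qE] : exists q', q = q'.+2 by case: (q) qp => [|[|q']] // _; exists q'.
    apply: ideal_sum => i.
    have Iepi : I (pi * e) by apply: ideal_mulr.
    case: (nat_of_ord i) => [|j]; last by apply: idealM; rewrite exprS; apply: ideal_mulr.
    by rewrite subn0 qE /= exprS -mulrA; apply: ideal_mulr.
have [C [PC Cb]] := refinement_max PC0.
have [sC CE CI CP CS] := PC.
exists C; suff Conto d : exists2 c, C c & I (d - c).
  by have [? ?] := refinement_stage PC Conto.
have [b Eb db] := E_onto d.
suff [c Cc bc] : exists2 c, C c & I (b - c).
  by exists c => //; rewrite -(subrK b d) -addrA; apply: idealD.
apply: contrapT => nob; apply: (nob); exists b; last by rewrite subrr; apply: ideal0.
have nob' : ~ img C (res b).
  move=> [c Cc bc]; apply: nob; exists c => //; apply/res0.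
  by rewrite rmorphB bc subrr.
have qk : q \in [pchar res_field].
  rewrite inE qp /=; apply/eqP; rewrite -(rmorph_nat res); exact/res0.
have imgp x : img C (x ^+ q).
  have [y ->] := res_surj x; have [e Ee ye] := E_onto y.
  exists (e ^+ q); first by apply: CP; exists e.
  rewrite rmorphXn; congr (_ ^+ q); apply/eqP; rewrite -subr_eq0 -rmorphB.
  exact/eqP/res0.
apply: Cb => // Q; have [n' Qn'] := ubnP (size Q).
elim: n' Q Qn' => // n' IH Q Qn' CQ IQ.
have [Qq|qQ] := leqP (size Q) q.
  have Q0 : map_poly res Q = 0.
    apply: (purely_insep_relation (img_subr sC) qk imgp nob' (img_poly CQ)).
      by apply: leq_trans (size_poly _ _) Qq.
    by rewrite horner_map; apply/res0.
  apply: (@small_horner C) => // [|i]; first by split=> //; apply: sub0set.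
  by apply/res0; rewrite -coef_map Q0 coef0.
pose Q' := take_poly q Q + (b ^+ q)%:P * drop_poly q Q.
have QQ' : Q.[b] = Q'.[b].
  by rewrite -{1}(poly_take_drop q Q) !hornerE; ring.
rewrite QQ'; apply: IH; last by rewrite -QQ'.
  rewrite (leq_ltn_trans (size_polyD _ _)) // gtn_max.
  apply/andP; split; first by rewrite (leq_ltn_trans (size_take_poly _ _)) // (leq_trans qQ).
  rewrite mul_polyC (leq_ltn_trans (size_scale_leq _ _)) // size_drop_poly.
  by rewrite -ltnS (leq_trans _ Qn') // ltnS ltn_subLR ?(ltnW qQ) // -[X in (X < _)%N]add0n ltn_add2r.
move=> i; rewrite coefD coefCM coef_take_poly coef_drop_poly.
apply: srD => //; first by case: ifP => // _; apply: sr0.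
by apply: srM => //; apply: CP; exists b.
Qed.

(** Residue characteristic [0]: a residue which is algebraic over those of [C] is
    a simple root, so one Newton step improves its lift. *)
Lemma next_stage_char0 : q = 0%N -> (forall j, (0 < j)%N -> ~ I j%:R) ->
  exists E', next_stage E'.
Proof.
move=> q0 char0; have pi0 : pi = 0 by rewrite q0.
have smallP c : small c <-> ideal_exp I n.+2 c.
  split=> [[e _]|]; last exact: small_exp.
  by rewrite pi0 mul0r subr0.
pose C0 : set D := [set x | exists z : int, ideal_exp I n.+2 (x - z%:~R)].
have int_in z : I (z%:~R) -> z = 0 :> int.
  case: z => [[//|j]|j] H; first by have := char0 j.+1 isT H.
  by case: (char0 j.+1 isT); rewrite -[_%:R]opprK; apply: idealN.
have PC0 : refinement set0 C0.
  split.
  - split.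
    + by exists 1; rewrite subrr; apply: ideal0.
    + move=> x y [z H] [w H']; exists (z - w).
      have -> : x - y - (z - w)%:~R = (x - z%:~R) - (y - w%:~R).
        by rewrite rmorphB /=; ring.
      exact: idealB.
    + move=> x y [z H] [w H']; exists (z * w).
      have -> : x * y - (z * w)%:~R = y * (x - z%:~R) + z%:~R * (y - w%:~R).
        by rewrite rmorphM /=; ring.
      by apply: idealD; apply: idealM.
  - move=> x [z H]; rewrite -(subrK (z%:~R) x); apply: srD => //.
      by apply: IE; apply: ideal_expSr.
    by case: z {H} => j; [exact: sr_nat|apply: srN => //; exact: sr_nat].
  - by move=> x H; exists 0; rewrite subr0.
  - exact: sub0set.
  - move=> c [z H] Ic; apply/smallP; suff z0 : z = 0 by rewrite z0 subr0 in H.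
    apply: int_in; have -> : z%:~R = c - (c - z%:~R) by ring.
    by apply: idealB => //; apply: ideal_exp_sub H.
have [C [PC Cb]] := refinement_max PC0.
have [sC CE CI _ CS] := PC.
exists C; suff Conto d : exists2 c, C c & I (d - c).
  by have [? ?] := refinement_stage PC Conto.
have [b Eb db] := E_onto d.
suff [c Cc bc] : exists2 c, C c & I (b - c).
  by exists c => //; rewrite -(subrK b d) -addrA; apply: idealD.
have zero_small b' Q : E b' -> polyIn C Q -> map_poly res Q = 0 -> small Q.[b'].
  move=> Eb' CQ Q0; apply: (small_horner PC) => // i.
  by apply/res0; rewrite -coef_map Q0 coef0.
have [alg|trans] := pselect (exists Q : {poly res_field},
    [/\ polyIn (img C) Q, Q != 0 & Q.[res b] = 0]); last first.
  exists b; last by rewrite subrr; apply: ideal0.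
  apply: Cb => // Q CQ IQ; apply: zero_small => //; apply: contrapT => Q0.
  apply: trans; exists (map_poly res Q); split; [exact: img_poly|exact/eqP|].
  by rewrite horner_map; apply/res0.
have [Q [SQ Q0 Qb Qmin]] := min_relation alg.
have [P [CP PQ sPQ]] := img_lift sC SQ.
have EP : polyIn E P by move=> i; apply: CE.
have IPb : I P.[b] by apply/res0; rewrite -horner_map PQ.
have Pb : ideal_exp I n.+1 P.[b].
  have [e _] := E_ker (sr_horner sE EP Eb) IPb.
  by rewrite pi0 mul0r subr0.
have Q1 : (1 < size Q)%N.
  rewrite ltnNge; apply/negP => /size1_polyC Qc; move: Qb Q0; rewrite Qc hornerC => ->.
  by rewrite eqxx.
have IPb' : ~ I P^`().[b].
  move=> /res0; rewrite -horner_map -deriv_map PQ => Q'b.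
  have Q'0 : Q^`() = 0.
    apply: Qmin => //; last by apply: lt_size_deriv.
    by move=> i; rewrite coef_deriv; apply: sr_muln => //; exact: img_subr.
  have := congr1 (fun R : {poly res_field} => R`_(size Q).-2) Q'0.
  rewrite coef_deriv coef0 -mulr_natr (_ : (size Q).-2.+1 = (size Q).-1); last first.
    by case: (size Q) Q1 => [|[]].
  move=> /eqP; rewrite mulf_eq0 -lead_coefE lead_coef_eq0 (negbTE Q0) /=.
  rewrite -(rmorph_nat res) => /eqP/res0; apply: char0.
  by case: (size Q) Q1 => [|[]].
have [u Pu] := Iunit IPb'.
pose e := - P.[b] * u; pose b' := b + e.
have In1e : ideal_exp I n.+1 e by apply: ideal_mulr; apply: idealN.
have Eb' : E b' by apply: srD => //; apply: IE.
have bb' : res b' = res b.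
  rewrite rmorphD; have -> : res e = 0 by apply/res0; apply: ideal_exp_sub In1e.
  by rewrite addr0.
have Pb' : ideal_exp I n.+2 P.[b'].
  have [c ->] := taylor2 P b e.
  have -> : P.[b] + P^`().[b] * e + c * e ^+ 2 = c * e ^+ 2.
    have -> : P^`().[b] * e = - P.[b] * (P^`().[b] * u) by rewrite /e; ring.
    by rewrite Pu; ring.
  apply: idealM; apply: (@ideal_exp_anti _ _ _ (n.+1 + n.+1)).
    by rewrite addSn addnS ltnS ltnS leq_addr.
  by rewrite expr2; apply: ideal_expD.
exists b'; last first.
  have -> : b - b' = - e by rewrite /b'; ring.
  by apply: idealN; apply: ideal_exp_sub In1e.
apply: Cb => // G; have [j Gj] := ubnP (size G).
elim: j G Gj => // j IH G Gj CG IG.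
have Gb : (map_poly res G).[res b] = 0 by rewrite -bb' horner_map; apply/res0.
have [GQ|QG] := ltnP (size (map_poly res G)) (size Q).
  by apply: zero_small => //; apply: (Qmin _ (img_poly CG) Gb GQ).
have PG : (size P <= size G)%N by rewrite sPQ (leq_trans QG) // size_poly.
have P0 : P != 0 by rewrite -size_poly_eq0 sPQ -lt0n ltnW.
have G0 : G != 0 by rewrite -size_poly_eq0 -lt0n (leq_trans _ PG) // lt0n size_poly_eq0.
pose H := (lead_coef P)%:P * G - (lead_coef G)%:P * 'X^(size G - size P) * P.
have CH : polyIn C H.
  apply: polyInB => //; first by apply: polyInM => //; apply: polyInC => //; apply: CP.
  apply: polyInM => //; apply: polyInM => //; first by apply: polyInC => //; apply: CG.
  by move=> i; rewrite coefXn; apply: sr_nat.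
have HE : H.[b'] = lead_coef P * G.[b'] - lead_coef G * b' ^+ (size G - size P) * P.[b'].
  by rewrite !hornerE.
have sH : (size H < j)%N.
  apply: (@leq_trans (size G)); last by rewrite -ltnS.
  by apply: size_lead_cancel => //; rewrite mulrC.
have IH' : I H.[b'].
  rewrite HE; apply: idealB; first exact: idealM.
  by apply: idealM; apply: ideal_exp_sub Pb'.
have /smallP := IH H sH CH IH'; rewrite HE => smH.
apply/smallP.
have lP : ~ I (lead_coef P).
  move=> /res0; rewrite lead_coefE sPQ -coef_map PQ -lead_coefE => /eqP.
  by rewrite lead_coef_eq0; apply/negP.
have [v Pv] := Iunit lP.
have -> : G.[b'] = v * ((lead_coef P * G.[b'] -
    lead_coef G * b' ^+ (size G - size P) * P.[b']) +
    lead_coef G * b' ^+ (size G - size P) * P.[b']).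
  by rewrite subrK mulrA [v * _]mulrC Pv mul1r.
by apply: idealM; apply: idealD => //; apply: idealM.
Qed.

End Step.
End Stages.

Section SubringType.
Variables (D : comNzRingType) (S : set D).

Definition sr_pred (sS : subr S) : {pred D} := fun x => `[< S x >].

Variable sS : subr S.

Lemma sr_closed : subring_closed (sr_pred sS).
Proof.
have [S1 SB SM] := sS; split=> [|x y /asboolP Sx /asboolP Sy|x y /asboolP Sx /asboolP Sy].
- exact/asboolP.
- by apply/asboolP; apply: SB.
- by apply/asboolP; apply: SM.
Qed.
HB.instance Definition _ := GRing.isSubringClosed.Build D (sr_pred sS) sr_closed.

Definition sr_type := {x : D | x \in sr_pred sS}.
HB.instance Definition _ := [isSub of sr_type for sval].
HB.instance Definition _ := [Choice of sr_type by <:].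
HB.instance Definition _ := [SubChoice_isSubComNzRing of sr_type by <:].

Definition sr_mk x (Sx : S x) : sr_type := exist _ x (asboolT Sx).

Lemma sr_val_zmod : zmod_morphism (sval : sr_type -> D).
Proof. by []. Qed.
Lemma sr_val_monoid : monoid_morphism (sval : sr_type -> D).
Proof. by []. Qed.

Definition sr_val : {rmorphism sr_type -> D} := mk_rmorphism sr_val_zmod sr_val_monoid.

Lemma sr_valP (x : sr_type) : S (sr_val x).
Proof. exact/asboolP/(valP x). Qed.

Lemma sr_val_inj : injective sr_val.
Proof. exact: val_inj. Qed.

End SubringType.

Section CoefficientRing.
Variables (D : comNzRingType) (I : ideal D).
Hypotheses (I1 : ~ I 1) (Iunit : forall d, ~ I d -> exists y, d * y = 1).
Hypotheses (noethD : noetherian D) (domD : domain D) (cD : icomplete I).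

Let residue_char : exists q, I q%:R /\
  forall n E, coef_stage I q n E -> exists E', next_stage I q n E E'.
Proof.
have [k [res [res_surj res0]]] := residue_field_exists I1 Iunit.
have [[p [pp Ip]]|nop] := pselect (exists p, prime p /\ I p%:R).
  exists p; split=> // n E stE.
  exact: (next_stage_pchar I1 Iunit res_surj res0 Ip stE).
exists 0%N; split=> [|n E stE]; first exact: ideal0.
have char0 j : (0 < j)%N -> ~ I j%:R.
  have [n' jn] := ubnP j; elim: n' j jn => // n' IH j jn j0 Ij.
  have [j1|j1] := leqP j 1.
    by apply: I1; move: Ij; rewrite (_ : j = 1%N) //; apply/eqP; rewrite eqn_leq j1 j0.
  have jE : j = (pdiv j * (j %/ pdiv j))%N by rewrite mulnC divnK // pdiv_dvd.
  move: Ij; rewrite jE natrM => /(max_prime I1 Iunit)[Ip|].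
    by apply: nop; exists (pdiv j); rewrite pdiv_prime.
  apply: IH; last by rewrite divn_gt0 ?pdiv_gt0 // dvdn_leq // pdiv_dvd.
  by rewrite -ltnS (leq_trans _ jn) // ltnS ltn_Pdiv // prime_gt1 // pdiv_prime.
have I0 : I (0%:R) by apply: ideal0.
exact: (next_stage_char0 Iunit res0 I0 stE erefl char0).
Qed.

(** The intersection of the stages is closed, so it inherits from them that it
    maps onto the residue field. As [D] is a domain, multiplication by [q] is
    either zero or a homeomorphism onto its image; this is why the kernel, which
    lies in the closure of the multiples of [q], consists of multiples of [q]. *)
Lemma coefficient_ring : exists (L : comNzRingType) (f : {rmorphism L -> D}) (y : L),
  [/\ injective f, I (f y), forall a, I (f a) -> exists c, a = c * y,
      forall d, exists a, I (d - f a) & xcomplete y].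
Proof.
have [q [Iq nextE]] := residue_char.
set pi : D := q%:R in Iq.
pose st n := {E : set D | coef_stage I q n E}.
pose next n (E : st n) : st n.+1 :=
  let E' := cid (nextE n (sval E) (svalP E)) in exist _ (sval E') (svalP E').1.
pose c := fix c n : st n := if n is k.+1 then next k (c k) else
  exist (coef_stage I q 0) setT (coef_stage0 I q).
pose E n := sval (c n).
have stE n : coef_stage I q n (E n) := svalP (c n).
have nextP n : next_stage I q n (E n) (E n.+1).
  exact: (svalP (cid (nextE n (sval (c n)) (svalP (c n))))).
have sE n : subr (E n) by have [] := stE n.
have IE n : ideal_exp I n.+1 `<=` E n by have [] := stE n.
have E_onto n d : exists2 e, E n e & I (d - e) by have [_ _ + _] := stE n; apply.
have E_ker n e : E n e -> I e -> exists2 e', E n e' & ideal_exp I n.+1 (e - pi * e').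
  by have [_ _ _ +] := stE n; apply.
have E_step n e : E n e -> exists2 e', E n.+1 e' & ideal_exp I n.+1 (e - e').
  by have [_ [_ +]] := nextP n; apply.
have E_anti n k : E (n + k)%N `<=` E n.
  elim: k => [|k IH]; first by rewrite addn0.
  by rewrite addnS; have [_ [+ _]] := nextP (n + k)%N => /subset_trans; apply.
pose L : set D := [set d | forall n, E n d].
have L_closed d : (forall k, exists2 l, L l & ideal_exp I k (d - l)) -> L d.
  move=> dL n; have [l Ll dl] := dL n.+1.
  by rewrite -(subrK l d); apply: srD => //; apply: IE.
have sL : subr L.
  split=> [n|x y Lx Ly n|x y Lx Ly n]; first by have [] := sE n.
    by have [_ EB _] := sE n; apply: EB; [apply: Lx|apply: Ly].
  by apply: srM; [exact: sE|apply: Lx|apply: Ly].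
have Lpi : L pi by apply: sr_nat.
have [Ilim Isep] := cD.
have E_approx N e : E N e -> exists2 l, L l & ideal_exp I N.+1 (e - l).
  move=> Ee.
  pose step k (x : {e | E (N + k)%N e}) : {e | E (N + k.+1)%N e} :=
    let y := cid2 (E_step _ _ (svalP x)) in exist _ (s2val y)
      (eq_ind_r (fun n => E n (s2val y)) (s2valP y) (addnS N k)).
  pose u := fix u k : {e | E (N + k)%N e} := if k is j.+1 then step j (u j) else
    exist (E (N + 0)%N) e (eq_ind_r (fun n => E n e) Ee (addn0 N)).
  have uP k : ideal_exp I (N + k).+1 (sval (u k) - sval (u k.+1)).
    exact: (s2valP' (cid2 (E_step _ _ (svalP (u k))))).
  have [l lP] : exists l, forall n, ideal_exp I n (l - sval (u n)).
    apply: Ilim => n; rewrite -opprB; apply: idealN.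
    by apply: ideal_exp_anti (uP n); rewrite leqW // leq_addl.
  have luk k : ideal_exp I (N + k).+1 (l - sval (u k)).
    have -> : l - sval (u k) = (l - sval (u (N + k).+1)) + (sval (u (N + k).+1) - sval (u k)) by ring.
    apply: idealD => //.
    have H j : ideal_exp I (N + k).+1 (sval (u (j + k)%N) - sval (u k)).
      elim: j => [|j IH]; first by rewrite subrr; apply: ideal0.
      have -> : sval (u (j.+1 + k)%N) - sval (u k) =
        - (sval (u (j + k)%N) - sval (u (j + k).+1)) + (sval (u (j + k)%N) - sval (u k)).
        by rewrite addSn; ring.
      apply: idealD => //; apply: idealN.
      by apply: ideal_exp_anti (uP (j + k)%N); rewrite ltnS leq_add2l leq_addl.
    by have := H N.+1; rewrite addSn.
  exists l; last by rewrite -opprB; apply: idealN; apply: (ideal_exp_anti _ (luk 0%N)); rewrite ltnS leq_addr.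
  move=> n; apply: (E_anti n N); rewrite addnC.
  rewrite -(subrK (sval (u n)) l); apply: srD => //; last exact: (svalP (u n)).
  exact: IE.
have kerL l : L l -> I l -> exists2 l', L l' & l = pi * l'.
  move=> Ll Il.
  have appr n : exists2 g, L g & ideal_exp I n.+1 (l - pi * g).
    have [e Ee le] := E_ker n l (Ll n) Il; have [g Lg eg] := E_approx n e Ee.
    exists g => //; have -> : l - pi * g = (l - pi * e) + pi * (e - g) by ring.
    by apply: idealD => //; apply: idealM.
  have [pi0|pi0] := eqVneq pi 0.
    exists 0; first exact: sr0.
    rewrite mulr0; apply: Isep => n; have [g _] := appr n.
    by rewrite pi0 mul0r subr0; apply: ideal_expSr.
  have pireg : nonzerodivisors D pi.
    by move=> x /domD[] // p0; move: pi0; rewrite p0 eqxx.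
  have [nu nuP] := choice (fun k => nzd_weak_artin_rees noethD I k pireg).
  have [g gP] : exists g : nat -> D, forall n, L (g n) /\ ideal_exp I n.+1 (l - pi * g n).
    suff /choice[h hP] n : exists h, L h /\ ideal_exp I n.+1 (l - pi * h) by exists h.
    by have [h] := appr n; exists h.
  pose M k := (\sum_(j < k.+1) nu j + k)%N.
  have M1 k : (nu k <= M k)%N by rewrite /M big_ord_recr /= -addnA addnCA leq_addr.
  have M2 k : (k <= M k)%N by rewrite leq_addl.
  have M3 k : (M k <= M k.+1)%N by rewrite /M [in X in (_ <= X)%N]big_ord_recr /= -addnA leq_add2l addnS leqW // leq_addl.
  have [w wP] : exists w, forall k, ideal_exp I k (w - g (M k)).
    apply: Ilim => k; apply: nuP.
    have -> : pi * (g (M k.+1) - g (M k)) = (l - pi * g (M k)) - (l - pi * g (M k.+1)) by ring.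
    apply: (@ideal_exp_anti _ _ _ (M k).+1); first exact: leqW.
    apply: idealB; first by have [] := gP (M k).
    have [_ H] := gP (M k.+1); apply: (ideal_exp_anti _ H); exact: M3.
  exists w; first by apply: L_closed => k; exists (g (M k)) => //; have [] := gP (M k).
  apply/eqP; rewrite -subr_eq0; apply/eqP/Isep => k.
  have -> : l - pi * w = (l - pi * g (M k)) - pi * (w - g (M k)) by ring.
  apply: idealB; last by apply: idealM.
  by have [_] := gP (M k); apply: ideal_exp_anti; apply: leqW.
exists (sr_type sL), (sr_val sL), (sr_mk sL Lpi); split.
- exact: sr_val_inj.
- exact: Iq.
- move=> a Ia; have [l' Ll' E1] := kerL _ (sr_valP a) Ia.
  by exists (sr_mk sL Ll'); apply: (@sr_val_inj _ _ sL); rewrite rmorphM mulrC; apply: E1.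
- move=> d; have [e Ee de] := E_onto 0%N d; have [l Ll el] := E_approx 0%N e Ee.
  exists (sr_mk sL Ll); rewrite ideal_exp1 in el.
  by rewrite -(subrK e d) -addrA; apply: idealD.
- have [xlim xsep] := icomplete_xcomplete cD Iq.
  split=> [a|z zP]; last first.
    apply: (@sr_val_inj _ _ sL); rewrite rmorph0; apply: xsep => n.
    have [c' ->] := zP n; exists (sr_val sL c'); by rewrite rmorphM rmorphXn.
  have [s sP] := xlim (fun l => sr_val sL (a l)).
  have Ls : L s.
    apply: L_closed => k; have [d ->] := sP k.
    exists (\sum_(l < k) sr_val sL (a l) * pi ^+ l).
      by apply: (sr_sum sL) => l; apply: (srM sL); [exact: (sr_valP (a _))|apply: (srX _ sL)].
    by rewrite [_ + d * _]addrC addrK; apply: idealM; apply: ideal_exp_pow.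
  exists (sr_mk sL Ls) => n.
  have sumE m : sr_val sL (\sum_(l < m) a l * sr_mk sL Lpi ^+ l) =
      \sum_(l < m) sr_val sL (a l) * pi ^+ l.
    by rewrite rmorph_sum; apply: eq_bigr => l _; rewrite rmorphM rmorphXn.
  suff [d Ld dE] : exists2 d, L d & s = \sum_(l < n) sr_val sL (a l) * pi ^+ l + d * pi ^+ n.
    exists (sr_mk sL Ld); apply: (@sr_val_inj _ _ sL).
    by rewrite rmorphD rmorphM rmorphXn sumE; apply: dE.
  have [pi0|pi0] := eqVneq pi 0.
    have [d dE] := sP n; case: n dE => [|n] dE.
      by exists s => //; rewrite big_ord0 mulr1 add0r.
    by exists 0; [exact: sr0|rewrite dE pi0 expr0n !mulr0].
  have [d dP] := choice sP; exists (d n); last exact: dP.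
  apply: L_closed => k; exists (\sum_(l < k) sr_val sL (a (n + l)%N) * pi ^+ l).
    by apply: (sr_sum sL) => l; apply: (srM sL); [exact: (sr_valP (a _))|apply: (srX _ sL)].
  suff -> : d n = \sum_(l < k) sr_val sL (a (n + l)%N) * pi ^+ l + d (n + k)%N * pi ^+ k.
    by rewrite [_ + d _ * _]addrC addrK; apply: idealM; apply: ideal_exp_pow.
  have piXn : nonzerodivisors D (pi ^+ n).
    elim: n {dP} => [|j IH] x; first by rewrite mul1r.
    by rewrite exprS -mulrA => /domD[p0|/IH//]; move: pi0; rewrite p0 eqxx.
  apply/eqP; rewrite -subr_eq0; apply/eqP/piXn.
  have := dP n; rewrite {1}(dP (n + k)%N) big_split_ord /= exprD.
  have -> : \sum_(i < k) sr_val sL (a (n + i)%N) * pi ^+ (n + i) =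
      pi ^+ n * \sum_(l < k) sr_val sL (a (n + l)%N) * pi ^+ l.
    by rewrite mulr_sumr; apply: eq_bigr => i _; rewrite exprD; ring.
  move=> /eqP; rewrite -addrA (inj_eq (addrI _)) => /eqP E1.
  by rewrite mulrBr [pi ^+ n * d n]mulrC -E1; ring.
Qed.

End CoefficientRing.

(** * Finiteness of integral closures under an adic limit *)

Section LinearAlgebra.
Variables (A Q : comNzRingType) (f : {rmorphism A -> Q}) (r : nat).
Hypothesis Ainv : forall a, a <> 0 -> exists y, f a * y = 1.
Hypothesis dep : forall v : nat -> Q, exists a : nat -> A,
  (exists2 i, (i <= r)%N & a i <> 0) /\ \sum_(i < r.+1) f (a i) * v i = 0.

Lemma fA_inj a : f a = 0 -> a = 0.
Proof.
move=> fa; apply: contrapT => a0; have [y] := Ainv a0.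
by rewrite fa mul0r => /esym/eqP; rewrite oner_eq0.
Qed.

Lemma fA_reg a q : a <> 0 -> f a * q = 0 -> q = 0.
Proof.
move=> /Ainv [y ay] aq; rewrite -[q]mul1r -ay [f a * y]mulrC -mulrA aq.
exact: mulr0.
Qed.

Lemma subfield_domain : domain A.
Proof.
move=> a b ab; have [->|a0] := pselect (a = 0); first by left.
by right; apply/fA_inj/(fA_reg a0); rewrite -rmorphM ab rmorph0.
Qed.

Definition indep (v : seq Q) := forall a : nat -> A, lin f a v = 0 ->
  forall i, (i < size v)%N -> a i = 0.

Lemma indep_size v : indep v -> (size v <= r)%N.
Proof.
move=> vind; rewrite leqNgt; apply/negP => rv.
have [a [[i ir ai]]] := dep (nth 0 v).
pose b j := if (j <= r)%N then a j else 0.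
suff : \sum_(j < r.+1) f (a j) * v`_j = lin f b v.
  move=> -> /vind /(_ i (leq_ltn_trans ir rv)); rewrite /b ir; exact: ai.
rewrite /lin -(subnKC rv) big_split_ord /= [X in _ = _ + X]big1 ?addr0 => [|j _].
  by apply: eq_bigr => j _; rewrite /b -ltnS ltn_ord.
by rewrite /b leqNgt ltnS -ltnS ltnS leq_addr /= rmorph0 mul0r.
Qed.

(** A maximal independent family is a basis of [Q] over the fractions of [A]. *)
Lemma basis_exists : exists v : seq Q, indep v /\
  forall q, exists d a, d <> 0 /\ f d * q = lin f a v.
Proof.
pose P n := `[< exists v, indep v /\ size v = n >].
have P0 : exists n, P n by exists 0%N; apply/asboolP; exists [::].
have Pr n : P n -> (n <= r)%N by move=> /asboolP [v [vind <-]]; apply: indep_size.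
have [n /asboolP[v [vind vn]] nmax] := ex_maxnP P0 Pr.
exists v; split=> // q; have nind : ~ indep (q :: v).
  move=> qv; have : P (size (q :: v)) by apply/asboolP; exists (q :: v).
  by move=> /nmax; rewrite /= vn ltnn.
apply: contrapT => noda; apply: nind => a; rewrite lin_cons => av.
have a0 : a 0%N = 0.
  apply: contrapT => a0; apply: noda; exists (a 0%N), (fun i => - a i.+1); split=> //.
  rewrite -[LHS](addrK (lin f (fun i => a i.+1) v)) av sub0r.
  by rewrite -mulN1r -(rmorph1 f) -rmorphN -linZ; apply: lin_ext => i _; rewrite mulN1r.
move: av; rewrite a0 rmorph0 mul0r add0r => /vind av [|i] //.
by rewrite /= ltnS => /av.
Qed.

Lemma lin_submod (v : seq Q) : submod f [set q | exists c, q = lin f c v].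
Proof.
split=> [|_ _ [c ->] [d ->]|a _ [c ->]].
- by exists (fun=> 0); rewrite lin_zero.
- by exists (fun i => c i + d i); rewrite linD.
- by exists (fun i => a * c i); rewrite linZ.
Qed.

Lemma fin_lin (v : seq Q) : fin f [set q | exists c, q = lin f c v] [set 0].
Proof.
exists v; split=> [x /(lin_mem f)[c ->]|x [c ->]]; first by exists c.
by exists c; rewrite /= subrr.
Qed.

Hypothesis noethA : noetherian A.

(** If the powers of [q] have a common denominator they generate a submodule of
    a finitely generated one, so [q] is integral. *)
Lemma integral_common_denominator (v : seq Q) d q : d <> 0 ->
  (forall n, exists c, f d * q ^+ n = lin f c v) -> integralOver f q.
Proof.
move=> d0 qv; have [y dy] := Ainv d0.
pose N : set Q := [set z | exists P : {poly A}, z = f d * (map_poly f P).[q]].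
have sN : submod f N.
  split=> [|_ _ [P ->] [P' ->]|a _ [P ->]].
  - by exists 0; rewrite rmorph0 horner0 mulr0.
  - by exists (P + P'); rewrite rmorphD hornerD mulrDr.
  - by exists (a%:P * P); rewrite rmorphM /= map_polyC hornerM hornerC mulrCA.
have Nv : N `<=` [set z | exists c, z = lin f c v].
  move=> _ [P ->]; rewrite horner_coef mulr_sumr.
  have [L0 LD LZ] := lin_submod v.
  elim/big_ind: _ => // i _; rewrite coef_map mulrCA; exact/LZ/qv.
have [h [hN hP]] : fin f N [set 0].
  by apply: (fin_sub noethA sN (submod0 _) Nv); apply: fin_lin.
have [K [R hR]] : exists K, exists R : nat -> {poly A}, forall i, (i < size h)%N ->
    (size (R i) <= K)%N /\ h`_i = f d * (map_poly f (R i)).[q].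
  elim: h hN {hP} => [|z h IH] hN; first by exists 0%N, (fun=> 0).
  have [|K [R hR]] := IH; first by move=> x xh; apply: hN; rewrite inE xh orbT.
  have [P zP] := hN z (mem_head _ _).
  exists (maxn K (size P)), (fun i => if i is j.+1 then R j else P) => -[|i] /=.
    by rewrite leq_maxr.
  by rewrite ltnS => /hR[RK ->]; split=> //; rewrite leq_max RK.
have NK : N (f d * q ^+ K) by exists 'X^K; rewrite map_polyXn hornerXn.
have [c] := hP _ NK; rewrite /= => /eqP; rewrite subr_eq0 => /eqP E.
pose S : {poly A} := \sum_(i < size h) (c i)%:P * R i.
have sS : (size S <= K)%N.
  rewrite /S; elim/big_ind: _ => [|P P' PK PK'|i _]; first by rewrite size_poly0.
    by rewrite (leq_trans (size_polyD _ _)) // geq_max PK.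
  rewrite mul_polyC (leq_trans (size_scale_leq _ _)) //.
  by have [] := hR i (ltn_ord i).
have qK : q ^+ K = (map_poly f S).[q].
  have E1 : f d * q ^+ K = f d * (map_poly f S).[q].
    rewrite E /S rmorph_sum horner_sum mulr_sumr; apply: eq_bigr => i _.
    rewrite rmorphM /= map_polyC hornerM hornerC mulrCA.
    by have [_ ->] := hR i (ltn_ord i).
  by rewrite -[LHS]mul1r -[RHS]mul1r -dy [f d * y]mulrC -!mulrA E1.
exists ('X^K - S).
  rewrite monicE lead_coefE.
  have sXS : size ('X^K - S) = K.+1.
    by rewrite size_polyDl size_polyXn // size_polyN ltnS.
  by rewrite sXS /= coefB coefXn eqxx [S`_K]nth_default ?subr0.
by rewrite rootE rmorphB hornerD hornerN /= map_polyXn hornerXn qK subrr.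
Qed.

Lemma integral_powers b : integralOver f b -> exists v : seq Q, forall n,
  exists c, b ^+ n = lin f c v.
Proof.
move=> [P Pm /eqP Pb].
exists [seq b ^+ i | i <- iota 0 (size P).-1] => n.
have sz : size [seq b ^+ i | i <- iota 0 (size P).-1] = (size P).-1.
  by rewrite size_map size_iota.
have linE c : lin f c [seq b ^+ i | i <- iota 0 (size P).-1] =
    \sum_(i < (size P).-1) f (c i) * b ^+ i.
  rewrite /lin sz; apply: eq_bigr => i _.
  by rewrite (nth_map 0%N) ?size_iota // nth_iota.
pose R := Pdiv.Ring.rmodp 'X^n P; exists (fun i => R`_i); rewrite linE.
have P0 : P != 0 by apply: monic_neq0.
have sR : (size R <= (size P).-1)%N.
  by rewrite -ltnS (leq_trans (Pdiv.Ring.ltn_rmodpN0 _ P0)) // leqSpred.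
have -> : b ^+ n = (map_poly f R).[b].
  have := Pdiv.RingMonic.rdivp_eq Pm 'X^n => /(congr1 (fun p => (map_poly f p).[b])).
  rewrite rmorphD rmorphM !hornerE /= map_polyXn hornerXn => ->.
  by rewrite Pb mulr0 add0r.
rewrite (horner_coef_wide _ (leq_trans (size_poly _ _) sR)).
by apply: eq_bigr => i _; rewrite coef_map.
Qed.

End LinearAlgebra.

(** A universal form of Japaneseness: [Q] ranges over the reduced algebras that
    are finite over the fraction field of [A]. Fraction fields are avoided: the
    nonzero elements of [A] are units in [Q], and the rank is bounded by [r]. *)
Definition finite_closures (A : comNzRingType) : Prop :=
  forall (Q : comNzRingType) (f : {rmorphism A -> Q}) (r : nat),
    (forall a, a <> 0 -> exists y, f a * y = 1) ->
    (forall (q : Q) n, q ^+ n = 0 -> q = 0) ->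
    (forall v : nat -> Q, exists a : nat -> A,
       (exists2 i, (i <= r)%N & a i <> 0) /\ \sum_(i < r.+1) f (a i) * v i = 0) ->
  exists h : seq Q, forall q, integralOver f q -> exists c, q = lin f c h.

Lemma finite_closures_field (A : comNzRingType) :
  (forall a : A, a <> 0 -> exists y, a * y = 1) -> finite_closures A.
Proof.
move=> Ainv Q f r fA _ dep; have [v [_ vP]] := basis_exists dep.
exists v => q _; have [d [a [d0 dq]]] := vP q; have [y dy] := Ainv d d0.
exists (fun i => y * a i); rewrite linZ -dq mulrA -rmorphM mulrC.
by rewrite [y * d]mulrC dy rmorph1 mulr1.
Qed.

(** Tate's criterion: if [x] is a prime element of the noetherian domain [A], which is
    complete along [x], then the finiteness of integral closures passes from
    [A / x] to [A]. Let [B] be the integral closure of [A] in [Q] and [C] its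
    localization at the complement of [(x)]. In [C] the radical [I] of [x C] is
    invertible, and some power of it lies in [x C]; the quotient [C / I] is a
    reduced algebra over the fraction field of [A / x], so the image of [B] in it
    is finite. Climbing the powers of [I] shows that [B] is finite modulo [x C], that
    is modulo [x B], and completeness concludes. *)
Section AdicFiniteness.
Variables (A A0 : comNzRingType) (p : {rmorphism A -> A0}) (x : A).
Hypotheses (noethA : noetherian A) (psurj : forall b, exists a, b = p a)
  (pker : forall a, p a = 0 <-> exists c, a = c * x)
  (xc : xcomplete x) (x0 : x <> 0) (domA0 : domain A0) (finA0 : finite_closures A0).
Variables (Q : comNzRingType) (f : {rmorphism A -> Q}) (r : nat).
Hypotheses (Qinv : forall a, a <> 0 -> exists y, f a * y = 1)
  (Qred : forall (q : Q) n, q ^+ n = 0 -> q = 0)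
  (Qdep : forall v : nat -> Q, exists a : nat -> A,
       (exists2 i, (i <= r)%N & a i <> 0) /\ \sum_(i < r.+1) f (a i) * v i = 0).

Let X := f x.
Let B : set Q := integralOver f.
Let domA : domain A := subfield_domain Qinv.

Let px : p x = 0. Proof. by apply/pker; exists 1; rewrite mul1r. Qed.

Let pM d e : p d <> 0 -> p e <> 0 -> p (d * e) <> 0.
Proof. by move=> d0 e0; rewrite rmorphM => /domA0[]. Qed.

Let pX d n : p d <> 0 -> p (d ^+ n) <> 0.
Proof.
move=> d0; elim: n => [|n IH]; first by rewrite rmorph1; apply/eqP/oner_neq0.
by rewrite exprS; apply: pM.
Qed.

Let p_neq0 d : p d <> 0 -> d <> 0.
Proof. by move=> d0 E; apply: d0; rewrite E rmorph0. Qed.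

Let x_cancel n a b : x ^+ n * a = x ^+ n * b -> a = b.
Proof.
elim: n => [|n IH]; first by rewrite !mul1r.
rewrite exprS -!mulrA => /eqP; rewrite -subr_eq0 -mulrBr => /eqP/domA[//|/eqP].
by rewrite subr_eq0 => /eqP/IH.
Qed.

Let X_cancel n a b : X ^+ n * a = X ^+ n * b -> a = b.
Proof.
move=> E; apply/eqP; rewrite -subr_eq0; apply/eqP/(fA_reg Qinv (a := x ^+ n)).
  elim: n {E} => [|n IH]; first by apply/eqP/oner_neq0.
  by rewrite exprS => /domA[].
by rewrite rmorphXn -/X mulrBr E subrr.
Qed.

Let prime_cancel d n a b : p d <> 0 -> d * a = x ^+ n * b -> exists c, a = x ^+ n * c.
Proof.
move=> d0; elim: n a b => [|n IH] a b E; first by exists a; rewrite mul1r.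
have /pker[a' aE] : p a = 0.
  have := congr1 p E; rewrite !rmorphM rmorphXn px expr0n mul0r.
  by move=> /domA0[].
have [c cE] : exists c, a' = x ^+ n * c.
  apply: (IH a' b); apply: (x_cancel (n := 1)).
  rewrite expr1; transitivity (d * a); first by rewrite aE; ring.
  by rewrite E exprS mulrA.
by exists c; rewrite aE cE exprS; ring.
Qed.

Let rank_mod (v : nat -> Q) : exists a : nat -> A,
  (exists2 i, (i <= r)%N & p (a i) <> 0) /\ \sum_(i < r.+1) f (a i) * v i = 0.
Proof.
have [a [[i ir ai] av]] := Qdep v.
have [n an] : exists n, forall c, a i <> c * x ^+ n.
  apply: contrapT => non; apply: ai; have [_ xsep] := xc; apply: xsep => n.
  apply: contrapT => noc; apply: non; exists n => c ac; apply: noc.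
  by exists c.
elim: n a an av {ai} => [|n IH] a an av.
  by case: (an (a i)); rewrite mulr1.
have [[j jr aj]|noj] := pselect (exists2 j, (j <= r)%N & p (a j) <> 0).
  by exists a; split=> //; exists j.
have [b bP] : exists b : nat -> A, forall j, (j <= r)%N -> a j = b j * x.
  suff /choice[b bP] j : exists b, (j <= r)%N -> a j = b * x by exists b.
  have [jr|jr] := leqP j r; last by exists 0.
  have /pker[c cE] : p (a j) = 0 by apply: contrapT => aj; apply: noj; exists j.
  by exists c.
apply: (IH b); first by move=> c bc; apply: (an c); rewrite bP // bc exprSr mulrA.
apply: (X_cancel (n := 1)); rewrite mulr0 mulr_sumr -[RHS]av; apply: eq_bigr => j _.
by rewrite bP -1?ltnS // rmorphM /X; ring.
Qed.

Let sB : subr B.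
Proof.
split=> [|u v|u v]; [exact: integral1|exact: integral_sub|exact: integral_mul].
Qed.

Let BA a : B (f a). Proof. exact: integral_id. Qed.

Let common_den v (l : seq Q) : (forall q, exists d a, d <> 0 /\ f d * q = lin f a v) ->
  exists d, d <> 0 /\ forall c, exists a, f d * lin f c l = lin f a v.
Proof.
move=> vP; elim: l => [|w l [d [d0 dP]]].
  exists 1; split=> [|c]; first by apply/eqP/oner_neq0.
  by exists (fun=> 0); rewrite lin0 lin_zero mulr0.
have [e [a [e0 ew]]] := vP w; exists (d * e); split=> [/domA[]//|c].
have [b bP] := dP (fun i => c i.+1); exists (fun i => d * c 0%N * a i + e * b i).
by rewrite linD !linZ -ew -bP lin_cons !rmorphM; ring.
Qed.

(** Depth: as [x] is prime and does not divide [d], an element that lies in the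
    integral closure after multiplication by [d] as well as by [x] belongs to it. *)
Let closure_cap d q : p d <> 0 -> B (f d * q) -> B (X * q) -> B q.
Proof.
move=> d0 /integral_powers[v1 v1P] /integral_powers[v2 v2P].
have [v [vind vP]] := basis_exists Qdep.
have [d1 [d10 d1P]] := common_den v1 vP; have [d2 [d20 d2P]] := common_den v2 vP.
have d12 : d1 * d2 <> 0 by move=> /domA[].
apply: (@integral_common_denominator _ _ _ Qinv noethA v (d1 * d2)) => // n.
have [c1 E1] := v1P n; have [c2 E2] := v2P n.
have [a1 E1'] := d1P c1; have [a2 E2'] := d2P c2.
have e1 : f (d1 * d2 * d ^+ n) * q ^+ n = lin f (fun i => d2 * a1 i) v.
  rewrite linZ -E1' -E1 exprMn !rmorphM rmorphXn; ring.
have e2 : f (d1 * d2 * x ^+ n) * q ^+ n = lin f (fun i => d1 * a2 i) v.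
  rewrite linZ -E2' -E2 exprMn !rmorphM rmorphXn /X; ring.
have rel i : (i < size v)%N -> x ^+ n * (d2 * a1 i) - d ^+ n * (d1 * a2 i) = 0.
  move: i; apply: vind.
  transitivity (f (x ^+ n) * lin f (fun i => d2 * a1 i) v -
                f (d ^+ n) * lin f (fun i => d1 * a2 i) v).
    by rewrite linB !linZ.
  by rewrite -e1 -e2 !rmorphM; ring.
have [a aP] : exists a : nat -> A, forall i, (i < size v)%N -> d1 * a2 i = x ^+ n * a i.
  suff /choice[a aP] i : exists a, (i < size v)%N -> d1 * a2 i = x ^+ n * a by exists a.
  have [iv|iv] := ltnP i (size v); last by exists 0.
  have [||c cE] := @prime_cancel (d ^+ n) n (d1 * a2 i) (d2 * a1 i).
  - exact: pX.
  - by apply/esym/eqP; rewrite -subr_eq0 rel.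
  by exists c.
exists a; apply: (X_cancel (n := n)).
transitivity (f (d1 * d2 * x ^+ n) * q ^+ n); first by rewrite !rmorphM rmorphXn /X; ring.
by rewrite e2 (@lin_ext _ _ f _ (fun i => x ^+ n * a i)) // linZ rmorphXn.
Qed.

Let C : set Q := [set q | exists2 d, p d <> 0 & B (f d * q)].

Let BC : B `<=` C.
Proof. by move=> q Bq; exists 1; rewrite ?rmorph1 ?mul1r //; apply/eqP/oner_neq0. Qed.

Let sC : subr C.
Proof.
split; first by apply: BC; case: sB.
- move=> u v [d d0 Bu] [e e0 Bv]; exists (d * e); first exact: pM.
  have -> : f (d * e) * (u - v) = f e * (f d * u) - f d * (f e * v) by rewrite rmorphM; ring.
  by have [_ BB _] := sB; apply: BB; apply: (srM sB).
- move=> u v [d d0 Bu] [e e0 Bv]; exists (d * e); first exact: pM.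
  have -> : f (d * e) * (u * v) = (f d * u) * (f e * v) by rewrite rmorphM; ring.
  exact: (srM sB).
Qed.

Let CA a : C (f a). Proof. by apply: BC. Qed.

Let Cinv d : p d <> 0 -> exists2 e, C e & f d * e = 1.
Proof.
move=> d0; have [e de] := Qinv (p_neq0 d0); exists e => //.
by exists d => //; rewrite de; case: sB.
Qed.

Let BCX q : B q -> (exists2 c, C c & q = X * c) -> exists2 b, B b & q = X * b.
Proof.
move=> Bq [c [d d0 Bdc] qE]; exists c => //.
by apply: (closure_cap d0) => //; rewrite -qE.
Qed.

Let xC q := exists2 c, C c & q = X * c.

Let xCM c q : C c -> xC q -> xC (c * q).
Proof. by move=> Cc [e Ce ->]; exists (c * e); [apply: (srM sC)|rewrite mulrCA]. Qed.

Let xCD q q' : xC q -> xC q' -> xC (q + q').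
Proof. by move=> [e Ce ->] [e' Ce' ->]; exists (e + e'); [apply: (srD sC)|rewrite mulrDr]. Qed.

Let xC_sum n (F : 'I_n -> Q) : (forall i, xC (F i)) -> xC (\sum_i F i).
Proof.
move=> FC; have xC0 : xC 0 by exists 0; [exact: (sr0 sC)|rewrite mulr0].
apply: (big_ind xC xC0); first by move=> u v; apply: xCD.
by move=> i _; apply: FC.
Qed.

(** Monic equations over [C] are monic equations over [A] after scaling. *)
Let C_closed w n (a : nat -> A) g : (0 < n)%N -> p (a n) <> 0 -> C g ->
  \sum_(1 <= i < n.+1) f (a i) * w ^+ i = g -> C w.
Proof.
move=> n0 an [d d0 Bg] E; exists (d * a n); first exact: pM.
set u := f d * f (a n).
pose c i := if i == 0%N then - (f d * g) * (f d ^+ n.-1 * f (a n) ^+ n.-1)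
  else f (a i) * (f d ^+ (n - i) * f (a n) ^+ (n.-1 - i)).
pose P : {poly Q} := 'X^n + \poly_(i < n) c i.
have Bc i : B (c i).
  have BfX e k : B (f e ^+ k) by apply: (srX _ sB).
  rewrite /c; case: eqP => _; last by do ?apply: (srM sB).
  by apply: (srM sB); [apply: (srN sB)|apply: (srM sB)].
have mP : P \is monic.
  rewrite monicE lead_coefE size_polyDl size_polyXn; last by rewrite ltnS size_poly.
  by rewrite /= coefD coefXn eqxx coef_poly ltnn addr0.
rewrite rmorphM -/u; apply: (integral_root_monic mP).
  rewrite rootE hornerD hornerXn horner_poly.
  set w' := u * w.
  have cE i : (0 < i < n)%N -> c i * w' ^+ i = f d ^+ n * f (a n) ^+ n.-1 * (f (a i) * w ^+ i).
    move=> /andP[i0 iltn]; rewrite /c gtn_eqF // /w' /u !exprMn.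
    have -> : f d ^+ n = f d ^+ (n - i) * f d ^+ i by rewrite -exprD subnK // ltnW.
    have -> : f (a n) ^+ n.-1 = f (a n) ^+ (n.-1 - i) * f (a n) ^+ i.
      by rewrite -exprD subnK // -ltnS prednK.
    by ring.
  have c0E : c 0%N * w' ^+ 0 = - (f d ^+ n * f (a n) ^+ n.-1 * g).
    have dn : f d ^+ n = f d * f d ^+ n.-1 by rewrite -exprS prednK.
    by rewrite /c /= dn; ring.
  have wn : w' ^+ n = f d ^+ n * f (a n) ^+ n.-1 * (f (a n) * w ^+ n).
    have ann : f (a n) ^+ n = f (a n) * f (a n) ^+ n.-1 by rewrite -exprS prednK.
    by rewrite /w' /u !exprMn ann; ring.
  rewrite -(big_mkord xpredT (fun i => c i * w' ^+ i)) big_ltn // c0E wn.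
  rewrite -E big_nat_recr //= (eq_big_nat _ _ cE) mulrDr mulr_sumr.
  by apply/eqP; ring.
apply/integral_poly => i; rewrite coefD coefXn coef_poly.
apply: (srD sB); first by case: (i == n); [exact: integral1|exact: integral0].
by case: ifP => _ //; apply: integral0.
Qed.

(** A relation among the powers of [w] modulo [x] becomes monic over [C], as the
    multiples of [x * w ^ n] go to the other side. *)
Let C_almost w : (forall n, C (X * w ^+ n)) -> C w.
Proof.
move=> wC; have [a [[i ir ai] av]] := rank_mod (fun i => w ^+ i.+1).
pose P i := (i <= r)%N && (p (a i) != 0).
have P0 : exists i, P i by exists i; rewrite /P ir; apply/eqP.
have Pr j : P j -> (j <= r)%N by case/andP.
have [n /andP[nr /eqP an] nmax] := ex_maxnP P0 Pr.
apply: (@C_closed w n.+1 (fun i => a i.-1) (\sum_(1 <= i < n.+2) f (a i.-1) * w ^+ i)) => //.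
rewrite big_add1 big_mkord /=.
have rn : r.+1 = (n.+1 + (r - n))%N by rewrite addSn subnKC.
move: av; rewrite rn big_split_ord /= => /eqP; rewrite addr_eq0 => /eqP ->.
apply: (srN sC); apply: (sr_sum sC) => j.
have /pker[b ->] : p (a (n.+1 + j)%N) = 0.
  have [jr|jr] := leqP (n.+1 + j)%N r.
    apply: contrapT => /eqP aj; have := nmax (n.+1 + j)%N.
    by rewrite /P jr aj => /(_ isT); rewrite leqNgt addSn ltnS leq_addr.
  by have := ltn_ord j; rewrite ltn_subRL => /(leq_trans jr); rewrite addSn ltnn.
rewrite rmorphM -mulrA; apply: (srM sC) => //; exact: wC.
Qed.

Let Ct := sr_type sC.
Let cv : {rmorphism Ct -> Q} := sr_val sC.
Let cvP (c : Ct) : C (cv c). Proof. exact: (sr_valP c). Qed.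
Let cv_inj : injective cv. Proof. exact: sr_val_inj. Qed.

Let xCt : ideal Ct.
Proof.
exists (fun c => xC (cv c)).
- by exists 0; [exact: (sr0 sC)|rewrite rmorph0 mulr0].
- by move=> u v; rewrite rmorphD; apply: xCD.
- by move=> u v; rewrite rmorphM; apply: xCM.
Defined.

Let It : ideal Ct.
Proof.
exists (fun c => exists n, xCt (c ^+ n)).
- by exists 1%N; apply: ideal0.
- move=> u v [m um] [n vn]; exists (m + n)%N.
  rewrite exprDn; apply: ideal_sum => i; rewrite -mulr_natl; apply: idealM.
  have [ni|ni] := leqP n i.
    by rewrite -(subnK ni) exprD mulrA; apply: idealM.
  have -> : (m + n - i = (n - i) + m)%N by move: (nat_of_ord i) ni => k ni; rewrite addnC addnBAC // ltnW.
  by rewrite exprD mulrAC; apply: idealM.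
- by move=> u v [n vn]; exists n; rewrite exprMn; apply: idealM.
Defined.

Let I q := exists2 c : Ct, It c & cv c = q.
Let Inv z := forall q, I q -> C (z * q).
Let F q := exists s : seq (Q * Q), (forall u, u \in s -> I u.1 /\ Inv u.2) /\
  q = \sum_(u <- s) u.1 * u.2.

Let IC q : I q -> C q. Proof. by move=> [c _ <-]; apply: cvP. Qed.

Let IX : I X.
Proof.
exists (sr_mk sC (CA x)) => //; exists 1%N; rewrite expr1.
by exists 1; [case: sC|rewrite mulr1].
Qed.

Let IM c q : C c -> I q -> I (c * q).
Proof.
move=> Cc [d Id <-]; exists (sr_mk sC Cc * d); last by rewrite rmorphM.
exact: idealM.
Qed.

Let ID q q' : I q -> I q' -> I (q + q').
Proof.
by move=> [d Id <-] [e Ie <-]; exists (d + e); [apply: idealD|rewrite rmorphD].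
Qed.

Let I0 : I 0. Proof. by exists 0; [apply: ideal0|rewrite rmorph0]. Qed.

Let Inv1 : Inv 1. Proof. by move=> q; rewrite mul1r; apply: IC. Qed.

Let IF q : I q -> F q.
Proof.
move=> Iq; exists [:: (q, 1)]; rewrite big_seq1 mulr1; split=> // u.
by rewrite inE => /eqP ->.
Qed.

Let FC q : F q -> C q.
Proof.
move=> [s [sI ->]]; elim: s sI => [|u s IH] sI; first by rewrite big_nil; apply: (sr0 sC).
rewrite big_cons; apply: (srD sC); last first.
  by apply: IH => v vs; apply: sI; rewrite inE vs orbT.
by rewrite mulrC; have [Iu Iv] := sI u (mem_head _ _); apply: Iv.
Qed.

Let FD q q' : F q -> F q' -> F (q + q').
Proof.
move=> [s [sI ->]] [t [tI ->]]; exists (s ++ t); rewrite big_cat; split=> // u.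
by rewrite mem_cat => /orP[/sI|/tI].
Qed.

Let FM c q : C c -> F q -> F (c * q).
Proof.
move=> Cc [s [sI ->]]; exists [seq (c * u.1, u.2) | u <- s]; split.
  by move=> _ /mapP[u us ->] /=; have [Iu Iv] := sI u us; split=> //; apply: IM.
by rewrite big_map mulr_sumr; apply: eq_bigr => u _; rewrite mulrA.
Qed.

(** [F] is the trace ideal [I I^-1]. A relation among the powers of [q] modulo [x],
    divided by its first coefficient that is nonzero there, has the form
    [u * q ^ n]. *)
Let F_nil q : F q -> exists u n, [/\ C u, F (u - 1) & xC (u * q ^+ n)].
Proof.
move=> Fq; have [a [[i ir ai] av]] := rank_mod (fun i => q ^+ i).
have P0 : exists i, (i <= r)%N && (p (a i) != 0) by exists i; rewrite ir; apply/eqP.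
have [n /andP[nr /eqP an] nmin] := ex_minnP P0.
have [e Ce ae] := Cinv an; have Cq := FC Fq.
pose v := \sum_(j < r - n) f (a (n.+1 + j)%N) * q ^+ j.
have Cv : C v by apply: (sr_sum sC) => j; apply: (srM sC) => //; apply: (srX _ sC).
exists (1 + e * v * q), n; split.
- apply: (srD sC); first by case: sC.
  by apply: (srM sC) => //; apply: (srM sC).
- by rewrite addrAC subrr add0r; apply: FM => //; apply: (srM sC).
- have rn : r.+1 = (n + (r - n).+1)%N by rewrite addnS subnKC.
  have -> : (1 + e * v * q) * q ^+ n =
      e * \sum_(j < (r - n).+1) f (a (n + j)%N) * q ^+ (n + j).
    have ae' : e * f (a n) = 1 by rewrite mulrC.
    rewrite big_ord_recl /= addn0 mulrDr [e * (f (a n) * _)]mulrA ae' mul1r mulrDl mul1r.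
    congr (_ + _); rewrite /v -!mulrA; congr (_ * _).
    rewrite mulr_suml; apply: eq_bigr => j _; rewrite /bump /= add1n addnS addSn.
    by rewrite -[q ^+ (n + j).+1]/(q ^+ (n + j).+1) exprS exprD; ring.
  apply: xCM => //.
  move: av; rewrite rn big_split_ord /= => /eqP; rewrite addrC addr_eq0 => /eqP ->.
  rewrite -sumrN; apply: xC_sum => j.
  have /pker[b ->] : p (a j) = 0.
    apply: contrapT => /eqP aj; have jr : (j <= r)%N by apply: leq_trans nr; exact: ltnW.
    by have := nmin j; rewrite jr aj => /(_ isT); rewrite leqNgt ltn_ord.
  exists (- (f b * q ^+ j)); last by rewrite rmorphM /X; ring.
  by apply: (srN sC); apply: (srM sC) => //; apply: (srX _ sC).
Qed.

(** Finitely many elements of [F] generate it modulo [x], because of the bound on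
    the rank. *)
Let F_gens : exists s : seq Q, (forall q, q \in s -> F q) /\
  forall q, F q -> exists c : nat -> Q, (forall i, C (c i)) /\
    xC (q - \sum_(i < size s) c i * s`_i).
Proof.
pose ind (s : seq Q) := (forall q, q \in s -> F q) /\
  forall a : nat -> A, xC (lin f a s) -> forall i, (i < size s)%N -> p (a i) = 0.
pose P n := `[< exists s, ind s /\ size s = n >].
have P0 : exists n, P n by exists 0%N; apply/asboolP; exists [::].
have Pr n : P n -> (n <= r)%N.
  move=> /asboolP [s [[_ sind] <-]]; rewrite leqNgt; apply/negP => rs.
  have [a [[i ir ai] av]] := rank_mod (nth 0 s).
  pose b j := if (j <= r)%N then a j else 0.
  have : lin f b s = 0.
    rewrite -av /lin -(subnKC rs) big_split_ord /= [X in _ + X = _]big1 ?addr0 => [|j _].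
      by apply: eq_bigr => j _; rewrite /b -ltnS ltn_ord.
    by rewrite /b leqNgt ltnS -ltnS ltnS leq_addr /= rmorph0 mul0r.
  move=> b0; have := sind b; rewrite b0 => /(_ _ i (leq_ltn_trans ir rs)).
  rewrite /b ir; move=> H; apply: ai; apply: H.
  by exists 0; [exact: (sr0 sC)|rewrite mulr0].
have [n /asboolP[s [[sF sind] sn]] nmax] := ex_maxnP P0 Pr.
exists s; split=> // q Fq; apply: contrapT => nog.
suff : ind (q :: s).
  move=> qs; have : P (size (q :: s)) by apply/asboolP; exists (q :: s).
  by move=> /nmax; rewrite /= sn ltnn.
split=> [z|a]; first by rewrite inE => /predU1P[->|/sF].
rewrite lin_cons => axC.
have a0 : p (a 0%N) = 0.
  apply: contrapT => a0; have [e Ce ae] := Cinv a0; apply: nog.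
  exists (fun i => - (e * f (a i.+1))); split=> [i|].
    by apply: (srN sC); apply: (srM sC).
  suff -> : q - \sum_(i < size s) - (e * f (a i.+1)) * s`_i =
      e * (f (a 0%N) * q + lin f (fun i => a i.+1) s) by apply: xCM.
  rewrite mulrDr mulrA [e * _]mulrC ae mul1r; congr (_ + _).
  rewrite -sumrN /lin mulr_sumr; apply: eq_bigr => i _; ring.
case=> [|i] //; rewrite /= ltnS; apply: (sind (fun i => a i.+1)).
have [b aE] := (pker _).1 a0.
have -> : lin f (fun i => a i.+1) s =
    (f (a 0%N) * q + lin f (fun i => a i.+1) s) + X * (- (f b * q)).
  by rewrite aE rmorphM /X; ring.
apply: xCD => //; exists (- (f b * q)) => //.
by apply: (srN sC); apply: (srM sC) => //; apply: FC.
Qed.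

(** The radical [I] of [x C] is invertible. Otherwise [F = I I^-1] avoids the
    multiplicative set [1 + F], and an element [c] outside [x C] with
    [c F] inside [x C] is found by treating the generators of [F] one by one;
    then [c / x] stabilizes [I^-1], so it is integral and [c] lies in [x C]. *)
Let F1 : F 1.
Proof.
apply: contrapT => nF1.
have xCF q : xC q -> F q.
  by move=> [c Cc ->]; rewrite mulrC; apply: FM => //; apply: IF.
have [s [sF sgen]] := F_gens.
have [c [Cc cinv cs]] : exists c, [/\ C c, forall v, C v -> F (v - 1) -> ~ xC (v * c) &
    forall q, q \in s -> xC (c * q)].
  elim: s sF {sgen} => [|q s IH] sF.
    exists 1; split=> // [|v Cv Fv]; first by case: sC.
    rewrite mulr1 => /xCF Fv'; apply: nF1.
    have -> : 1 = v + (- 1) * (v - 1) by ring.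
    apply: FD => //; apply: FM => //; apply: (srN sC); by case: sC.
  have [|c [Cc cinv cs]] := IH; first by move=> z zs; apply: sF; rewrite inE zs orbT.
  have Fq := sF q (mem_head _ _); have Cq := FC Fq.
  pose P j := `[< exists u, [/\ C u, F (u - 1) & xC (u * c * q ^+ j)] >].
  have P0 : exists j, P j.
    have [u [n [Cu Fu un]]] := F_nil Fq; exists n; apply/asboolP; exists u; split=> //.
    by rewrite mulrAC mulrC; apply: xCM.
  have [j /asboolP[u [Cu Fu uj]] jmin] := ex_minnP P0.
  case: j uj jmin => [|j] uj jmin; first by case: (cinv u Cu Fu); rewrite mulr1 in uj.
  exists (u * c * q ^+ j); split.
  - by apply: (srM sC); [apply: (srM sC)|apply: (srX _ sC)].
  - move=> v Cv Fv vxC; have : P j.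
      apply/asboolP; exists (v * u); split; first exact: (srM sC).
        have -> : v * u - 1 = v * (u - 1) + (v - 1) by ring.
        by apply: FD => //; apply: FM.
      by move: vxC; rewrite !mulrA.
    by move=> /jmin; rewrite ltnn.
  - move=> z; rewrite inE => /predU1P[->|/cs cz].
      by rewrite -mulrA -exprSr.
    have -> : u * c * q ^+ j * z = (u * q ^+ j) * (c * z) by ring.
    by apply: xCM => //; apply: (srM sC) => //; apply: (srX _ sC).
have cF q : F q -> xC (c * q).
  move=> Fq; have [a [Ca qa]] := sgen q Fq.
  have -> : c * q = c * (q - \sum_(i < size s) a i * s`_i) +
      \sum_(i < size s) a i * (c * s`_i).
    rewrite mulrBr mulr_sumr.
    have -> : \sum_(i < size s) c * (a i * s`_i) = \sum_(i < size s) a i * (c * s`_i).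
      by apply: eq_bigr => i _; ring.
    by ring.
  apply: xCD; first exact: xCM.
  by apply: xC_sum => i; apply: xCM => //; apply: cs; apply: mem_nth.
have [y Xy] := Qinv x0.
have wF q : F q -> C (y * c * q).
  move=> /cF[e Ce E]; have -> : y * c * q = (f x * y) * e by rewrite -mulrA E /X; ring.
  by rewrite Xy mul1r.
have wInv z : Inv z -> Inv (y * c * z).
  move=> Iz q Iq; have -> : y * c * z * q = y * c * (q * z) by ring.
  apply: wF; exists [:: (q, z)]; rewrite big_seq1; split=> // u.
  by rewrite inE => /eqP ->.
have wn n : Inv ((y * c) ^+ n).
  by elim: n => [|n IH]; [exact: Inv1|rewrite exprS; apply: wInv].
have Cw : C (y * c) by apply: C_almost => n; rewrite mulrC; apply: wn.
apply: (cinv 1); [by case: sC| |].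
  by rewrite subrr; apply: IF.
exists (y * c) => //; rewrite mul1r /X mulrA Xy mul1r //.
Qed.

Let inv_data : exists s : seq (Q * Q), (forall u, u \in s -> I u.1 /\ Inv u.2) /\
  \sum_(u <- s) u.1 * u.2 = 1.
Proof. by have [s [sI s1]] := F1; exists s. Qed.

Let fC_ex : exists g : {rmorphism A -> Ct}, forall a, cv (g a) = f a.
Proof.
suff [gB gM] : zmod_morphism (fun a => sr_mk sC (CA a)) /\
    monoid_morphism (fun a => sr_mk sC (CA a)) by exists (mk_rmorphism gB gM).
split.
- by move=> a b; apply: cv_inj; rewrite [RHS]rmorphB; apply: (rmorphB f).
- split=> [|a b]; apply: cv_inj; first by rewrite [RHS]rmorph1; apply: (rmorph1 f).
  by rewrite [RHS]rmorphM; apply: (rmorphM f).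
Qed.

Let fC : {rmorphism A -> Ct} := sval (cid fC_ex).
Let fCE a : cv (fC a) = f a. Proof. exact: (svalP (cid fC_ex)). Qed.

(** The quotient of [C] by [I] is a reduced algebra of finite rank over the
    fraction field of [A / x], so the hypothesis on [A / x] applies to it. *)
Let fin_I : fin f B I.
Proof.
have [It1|It1] := pselect (It 1).
  exists [::]; split=> // q Bq; exists (fun=> 0); rewrite lin0 subr0.
  exists (sr_mk sC (BC Bq)) => //; exact: ideal1.
have Q01 : 1 != 0 :> quot It.
  by apply/eqP; rewrite -(rmorph1 (to_quot It)) => /to_quot0.
pose Q0 : comNzRingType := nzring Q01.
pose pr : {rmorphism Ct -> Q0} := to_quot It.
have prK c : pr c = 0 <-> It c by apply: to_quot0.
have prS z : exists c, z = pr c by apply: to_quot_surj.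
have [|f0 f0E] := @surj_factor A A0 Q0 p (pr \o fC) psurj.
  move=> a /pker[b ->]; rewrite /= rmorphM; apply/prK; exists 1%N; rewrite expr1.
  exists (f b) => //; by rewrite rmorphM !fCE mulrC.
have [|||h hP] := finA0 (f := f0) (r := r).
- move=> a0 a00; have [d dE] := psurj a0.
  have [|e Ce de] := Cinv (d := d); first by rewrite -dE.
  exists (pr (sr_mk sC Ce)); rewrite dE f0E /= -rmorphM.
  have -> : fC d * sr_mk sC Ce = 1 by apply: cv_inj; rewrite rmorphM rmorph1 fCE; apply: de.
  exact: rmorph1.
- move=> z n; have [c ->] := prS z; rewrite -rmorphXn => /prK [k ck]; apply/prK.
  by exists (n * k)%N; rewrite exprM.
- move=> v; have [V VE] := choice (fun i => prS (v i)).
  have [a [[i ir ai] aV]] := rank_mod (fun i => cv (V i)).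
  exists (fun i => p (a i)); split; first by exists i.
  have -> : \sum_(i0 < r.+1) f0 (p (a i0)) * v i0 = pr (\sum_(i0 < r.+1) fC (a i0) * V i0).
    by rewrite rmorph_sum; apply: eq_bigr => j _; rewrite rmorphM f0E VE.
  have -> : \sum_(i0 < r.+1) fC (a i0) * V i0 = 0; last exact: rmorph0.
  by apply: cv_inj; rewrite rmorph0 rmorph_sum -[RHS]aV; apply: eq_bigr => j _; rewrite rmorphM fCE.
pose g (q : Q) : Q0 := if pselect (C q) is left Cq then pr (sr_mk sC Cq) else 0.
have gE q (Cq : C q) : g q = pr (sr_mk sC Cq).
  by rewrite /g; case: pselect => // Cq'; congr (pr _); apply: cv_inj.
pose f1 : {rmorphism A -> Q0} := pr \o fC.
have sBm : submod f B.
  by split=> [|u v|a u Bu]; [exact: (sr0 sB)|exact: (srD sB)|exact: (srM sB)].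
have : fin f B [set q | g q = 0].
  apply: (@fin_preim A noethA Q Q0 f f1 g B [set 0] h) => //.
  - move=> u v Bu Bv; rewrite (gE _ (srD sC (BC Bu) (BC Bv))) (gE _ (BC Bu)) (gE _ (BC Bv)).
    by rewrite -rmorphD; congr (pr _); apply: cv_inj.
  - move=> a u Bu; rewrite (gE _ (srM sC (CA a) (BC Bu))) (gE _ (BC Bu)).
    rewrite -[f1 a]/(pr (fC a)) -rmorphM; congr (pr _); apply: cv_inj.
    by rewrite rmorphM fCE.
  - exact: submod0.
  - move=> b Bb; have [P Pm /eqP Pb] := Bb.
    have Pb' : (map_poly fC P).[sr_mk sC (BC Bb)] = 0.
      apply: cv_inj; rewrite rmorph0 -horner_map -map_poly_comp.
      by rewrite (eq_map_poly (g := f)).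
    have [|c cE] := hP (g b).
      exists (map_poly p P); first exact: monic_map.
      rewrite rootE (gE _ (BC Bb)) -map_poly_comp.
      rewrite (eq_map_poly (g := pr \o fC)); last by move=> a; exact: f0E.
      by rewrite map_poly_comp horner_map Pb' rmorph0.
    have [a aE] := choice (fun i => psurj (c i)).
    exists a; rewrite /= cE /lin; apply/eqP; rewrite subr_eq0; apply/eqP.
    by apply: eq_bigr => i _; rewrite aE f0E.
apply: fin_weaken_in => // q Bq; rewrite /= (gE _ (BC Bq)) => /prK Iq.
by exists (sr_mk sC (BC Bq)).
Qed.

Section Filtration.
Variable s : seq (Q * Q).
Hypotheses (sI : forall u, u \in s -> I u.1 /\ Inv u.2) (s1 : \sum_(u <- s) u.1 * u.2 = 1).

(** [K j] is the power [I ^ j]: as [I] is invertible with inverse spanned by the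
    second components of [s], it can be described by the latter alone. *)
Let K := fix K (j : nat) (q : Q) : Prop :=
  if j is k.+1 then forall u, u \in s -> K k (u.2 * q) else C q.

Let KM j c q : C c -> K j q -> K j (c * q).
Proof.
move=> Cc; elim: j q => [|j IH] q; first exact: (srM sC).
by move=> Kq u us; rewrite mulrCA; apply: IH; apply: Kq.
Qed.

Let KD j q q' : K j q -> K j q' -> K j (q + q').
Proof.
elim: j q q' => [|j IH] q q'; first exact: (srD sC).
by move=> Kq Kq' u us; rewrite mulrDr; apply: IH; [apply: Kq|apply: Kq'].
Qed.

Let K0 j : K j 0.
Proof. by elim: j => [|j IH] /=; [exact: (sr0 sC)|move=> u _; rewrite mulr0]. Qed.

Let K_sub j : submod f (K j).
Proof. by split=> [|u v|a u]; [exact: K0|exact: KD|apply: KM]. Qed.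

Let s_expand q : q = \sum_(u <- s) u.1 * (u.2 * q).
Proof. by rewrite -[LHS]mul1r -s1 mulr_suml; apply: eq_bigr => u _; rewrite mulrA. Qed.

Let KS j q : K j.+1 q -> K j q.
Proof.
move=> Kq; rewrite (s_expand q) big_seq; apply: (big_ind (K j)).
- exact: K0.
- by move=> u v; apply: KD.
- by move=> u us; apply: KM; [apply/IC; have [] := sI us|apply: Kq].
Qed.

Let KC j q : K j q -> C q.
Proof. by elim: j => // j IH /KS. Qed.

Let K_I q : I q -> K 1 q.
Proof. by move=> Iq u us; have [_] := sI us; apply. Qed.

Let K_exp j q : K j q -> exists2 c : Ct, ideal_exp It j c & cv c = q.
Proof.
elim: j q => [|j IH] q.
  by move=> Cq; exists (sr_mk sC Cq) => //; apply: ideal_exp0.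
move=> Kq; rewrite (s_expand q) big_seq.
apply: (big_ind (fun q => exists2 c : Ct, ideal_exp It j.+1 c & cv c = q)).
- by exists 0; [apply: ideal0|rewrite rmorph0].
- by move=> _ _ [c Ic <-] [d Id <-]; exists (c + d); [apply: idealD|rewrite rmorphD].
- move=> u us; have [[d Id <-] _] := sI us; have [c Ic <-] := IH _ (Kq u us).
  by exists (d * c); [apply: ideal_expS_mem|rewrite rmorphM].
Qed.

Let K_small : exists j, forall q, K j q -> xC q.
Proof.
have [es [esI Ies]] : exists es : seq Ct, (forall c, c \in es -> It c) /\ It `<=` ideal_span es.
  have : exists es : seq Ct, (forall c, c \in es -> It c) /\ map cv es = map fst s.
    elim: s sI => [|u t IH] tI; first by exists [::].
    have [|es [esI esE]] := IH; first by move=> v vt; apply: tI; rewrite inE vt orbT.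
    have [[c Ic cu] _] := tI u (mem_head _ _); exists (c :: es); rewrite !map_cons cu esE; split=> //.
    by move=> d; rewrite inE => /predU1P[->|/esI].
  move=> [es [esI esE]]; exists es; split=> // c Ic.
  have /choice[w wP] (u : Q * Q) : exists d : Ct, u \in s -> cv d = u.2 * cv c.
    have [us|us] := boolP (u \in s); last by exists 0.
    have Cuc : C (u.2 * cv c) by have [_] := sI us; apply; exists c.
    by exists (sr_mk sC Cuc).
  have sz : size es = size s by rewrite -(size_map cv) esE size_map.
  suff -> : c = \sum_(i < size es) w (nth (0, 0) s i) * es`_i.
    exact: (ideal_span_comb (fun i => w (nth (0, 0) s i))).
  apply: cv_inj; rewrite rmorph_sum {1}(s_expand (cv c)) (big_nth (0, 0)) big_mkord sz.
  apply: eq_bigr => i _; rewrite rmorphM wP ?mem_nth // mulrC; congr (_ * _).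
  by rewrite -(nth_map _ 0 fst) // -esE (nth_map 0) // sz.
have [n nP] : exists n, ideal_exp (ideal_span es) n `<=` xCt.
  by apply: fg_nil_exp => c /esI.
exists n => q /K_exp[c Ic <-]; apply: nP.
by apply: ideal_exp_mono Ic.
Qed.

Let sBK j : submod f (B `&` K j).
Proof.
apply: submod_cap => //.
by split=> [|u v|a u Bu]; [exact: (sr0 sB)|exact: (srD sB)|exact: (srM sB)].
Qed.

Let common_B : exists2 d, p d <> 0 & forall u, u \in s -> B (f d * (u.2 * X)).
Proof.
elim: s sI => [|u t IH] tI; first by exists 1 => //; rewrite rmorph1; apply/eqP/oner_neq0.
have [|d d0 dP] := IH; first by move=> v vt; apply: tI; rewrite inE vt orbT.
have [_ Iu] := tI u (mem_head _ _); have [e e0 Be] := Iu X IX.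
exists (d * e); first exact: pM.
move=> v; rewrite inE rmorphM => /predU1P[->|/dP Bv].
  by rewrite -mulrA; apply: (srM sB).
by rewrite [f d * _]mulrC -mulrA; apply: (srM sB).
Qed.

(** Multiplication by the [z] of the pairs [(e, z)] embeds each graded piece of
    the filtration in a power of the previous one. *)
Let fin_K j : fin f (B `&` K j) (K j.+1).
Proof.
elim: j => [|j IH].
  have [h [hB hP]] := fin_I; exists h; split=> [q /hB Bq|q [Bq _]].
    by split=> //; apply: BC.
  by have [c cP] := hP q Bq; exists c; apply: K_I.
have [d d0 dP] := common_B.
have [e Ce de] := Cinv d0.
have [h [hM hP]] := IH.
have step u : u \in s -> fin f (B `&` K j.+1) [set q | K j.+1 (u.2 * q)].
  move=> us.
  have : fin f (B `&` K j.+1) [set q | K j.+1 (f d * u.2 * q)].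
    apply: (@fin_preim A noethA Q Q f f (fun q => f d * u.2 * q) _ (K j.+1) h) => //.
    - by move=> q q' _ _; rewrite mulrDr.
    - by move=> a q _; rewrite mulrCA.
    - move=> q [Bq Kq]; apply: hP; split; last first.
        by rewrite -mulrA; apply: KM => //; apply: Kq.
      have [d' d'0 Bd'] : C (f d * u.2 * q).
        by rewrite -mulrA; apply: (srM sC) => //; apply: (KC (Kq u us)).
      apply: (closure_cap d'0) => //.
      have -> : X * (f d * u.2 * q) = f d * (u.2 * X) * q by ring.
      by apply: (srM sB) => //; apply: dP.
  apply: fin_weaken => q Kq; have := @KM j.+1 _ _ Ce Kq.
  by rewrite !mulrA [e * f d]mulrC de mul1r.
have step' (t : seq (Q * Q)) : (forall u, u \in t -> u \in s) ->
    fin f (B `&` K j.+1) [set q | forall u, u \in t -> K j.+1 (u.2 * q)].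
  elim: t => [|u t IHt] ts; first by exists [::]; split=> // q _; exists (fun=> 0).
  have ft : fin f (B `&` K j.+1) [set q | forall u, u \in t -> K j.+1 (u.2 * q)].
    by apply: IHt => v vt; apply: ts; rewrite inE vt orbT.
  have fu := step u (ts u (mem_head _ _)).
  have subu (v : Q * Q) : submod f [set q | K j.+1 (v.2 * q)].
    split=> [|q q' Kq Kq'|a q Kq].
    - by have := K0 j.+1; rewrite -[X in K _ X](mulr0 v.2).
    - by have := @KD j.+1 _ _ Kq Kq'; rewrite -mulrDr.
    - by have := @KM j.+1 _ _ (CA a) Kq; rewrite mulrCA.
  suff subt : submod f [set q | forall u, u \in t -> K j.+1 (u.2 * q)].
    have := fin_cap noethA (sBK j.+1) (subu u) subt fu ft.
    by apply: fin_weaken => q [Ku Kt] v; rewrite inE => /predU1P[->|/Kt].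
  split=> [v _|q q' Kq Kq' v vt|a q Kq v vt].
  - by have [? _ _] := subu v.
  - by have [_ H _] := subu v; apply: H; [apply: Kq|apply: Kq'].
  - by have [_ _ H] := subu v; apply: H; apply: Kq.
exact: (step' s (fun u us => us)).
Qed.

Let fin_K_all j : fin f B (K j).
Proof.
elim: j => [|j IH].
  by exists [::]; split=> // q Bq; exists (fun=> 0); rewrite lin0 subr0; apply: BC.
have sBm : submod f B.
  by split=> [|u v|a u Bu]; [exact: (sr0 sB)|exact: (srD sB)|exact: (srM sB)].
apply: (fin_trans (M1 := B `&` K j)) (fin_K j); first by move=> q [].
by apply: (fin_weaken_in sBm _ IH) => q Bq Kq.
Qed.

Lemma fin_mod_x_aux : fin f B [set q | exists2 b, B b & q = X * b].
Proof.
have [j jP] := K_small.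
have sBm : submod f B.
  by split=> [|u v|a u Bu]; [exact: (sr0 sB)|exact: (srD sB)|exact: (srM sB)].
by apply: (fin_weaken_in sBm _ (fin_K_all j)) => q Bq /jP; apply: BCX.
Qed.

End Filtration.

Let fin_mod_x : fin f B [set q | exists2 b, B b & q = X * b].
Proof. by have [s [sI s1]] := inv_data; apply: (fin_mod_x_aux sI s1). Qed.

(** A monic equation with coefficients in [A] for [a / x ^ n]. *)
Let dvd_monic n m (a : A) (c : nat -> A) :
  a ^+ m + \sum_(k < m) c k * x ^+ (n * (m - k)) * a ^+ k = 0 ->
  exists b, a = b * x ^+ n.
Proof.
move=> E; suff H j : (j <= n)%N -> exists b, a = b * x ^+ j by exact: H.
elim: j => [|j IH] jn; first by exists a; rewrite mulr1.
have [b aE] := IH (ltnW jn).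
have Eb : x ^+ (j * m) * (b ^+ m + \sum_(k < m) c k * x ^+ ((n - j) * (m - k)) * b ^+ k) = 0.
  rewrite -[RHS]E mulrDr {1}aE exprMn -exprM mulrC; congr (_ + _).
  rewrite mulr_sumr; apply: eq_bigr => k _; rewrite aE exprMn -exprM.
  have -> : x ^+ (n * (m - k)) = x ^+ ((n - j) * (m - k)) * x ^+ (j * (m - k)).
    by rewrite -exprD -mulnDl subnK // ltnW.
  have -> : x ^+ (j * m) = x ^+ (j * (m - k)) * x ^+ (j * k).
    by rewrite -exprD -mulnDr subnK // ltnW.
  by ring.
have {}Eb : b ^+ m + \sum_(k < m) c k * x ^+ ((n - j) * (m - k)) * b ^+ k = 0.
  by apply: (x_cancel (n := (j * m)%N)); rewrite mulr0.
have pb : p b = 0.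
  apply: contrapT => pb; apply: (pX (n := m) pb).
  have := congr1 p Eb; rewrite rmorphD rmorph0 rmorph_sum big1 ?addr0 // => k _.
  rewrite !rmorphM [p (x ^+ _)]rmorphXn px expr0n muln_eq0 !subn_eq0.
  by rewrite leqNgt jn leqNgt ltn_ord /= mulr0 mul0r.
have [b' bE] := (pker b).1 pb; exists b'.
by rewrite aE bE exprS mulrA.
Qed.

(** An element [e] of all the [x ^ n B] satisfies [a e = e w] for a nonzero [a]
    in [A] and another such [w]; on the component that [e] spans, [w / x ^ n] is
    [a / x ^ n], which would then be integral for every [n]. *)
Let B_separated e : (forall n, exists2 b, B b & e = X ^+ n * b) -> e = 0.
Proof.
move=> eB.
have [a0 [[i0 i0r ai0] av]] := Qdep (fun i => e ^+ i).
have P0 : exists i, (i <= r)%N && (a0 i != 0) by exists i0; rewrite i0r; apply/eqP.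
have [l /andP[lr /eqP al] lmin] := ex_minnP P0.
pose a := a0 l.
pose v := \sum_(j < r - l) f (a0 (l.+1 + j)%N) * e ^+ j.
have Be : B e by have [b Bb] := eB 0%N; rewrite mul1r => ->.
have Bv : B v by apply: (sr_sum sB) => j; apply: (srM sB) => //; apply: (srX _ sB).
have E : (f a + v * e) * e ^+ l = 0.
  have rl : r.+1 = (l + (r - l).+1)%N by rewrite addnS subnKC.
  move: av; rewrite rl big_split_ord /= big1 ?add0r => [<-|j _]; last first.
    have -> : a0 j = 0; last by rewrite rmorph0 mul0r.
    apply: contrapT => /eqP aj; have jr : (j <= r)%N by apply: leq_trans lr; exact: ltnW.
    by have := lmin j; rewrite jr aj => /(_ isT); rewrite leqNgt ltn_ord.
  rewrite big_ord_recl /= addn0 mulrDl; congr (_ + _).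
  rewrite /v !mulr_suml; apply: eq_bigr => j _; rewrite /bump /= add1n addnS addSn.
  by rewrite exprS exprD; ring.
have {}E : e * (f a + v * e) = 0.
  apply: (Qred (n := l.+1)).
  transitivity (e * (f a + v * e) ^+ l * ((f a + v * e) * e ^+ l)).
    by rewrite exprMn !exprS; ring.
  by rewrite E mulr0.
pose w := - (v * e).
have ew : e * w = f a * e.
  by apply/eqP; rewrite -subr_eq0; apply/eqP; rewrite -[RHS]oppr0 -E /w; ring.
have ewX k : e * w ^+ k = f (a ^+ k) * e.
  elim: k => [|k IH]; first by rewrite rmorph1 mul1r mulr1.
  by rewrite exprS mulrA ew -mulrA IH exprS rmorphM mulrA.
apply: contrapT => e0; apply: al; have [_ xsep] := xc; apply: xsep => n.
have [b Bb eE] := eB n.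
have Bw : B (- (v * b)) by apply: (srN sB); apply: (srM sB).
have wE : w = X ^+ n * (- (v * b)) by rewrite /w eE; ring.
have [P Pm /eqP Pw] := Bw.
pose m := (size P).-1.
apply: (@dvd_monic n m a (fun k => P`_k)); apply: contrapT => N0; apply: e0.
apply: (fA_reg Qinv N0).
set u := - (v * b) in Pw wE.
have szP : size P = m.+1 by rewrite /m prednK // lt0n size_poly_eq0 monic_neq0.
have {Pw} Pw : u ^+ m + \sum_(k < m) f P`_k * u ^+ k = 0.
  have fPm : f P`_m = 1.
    by rewrite -[m]/(m.+1.-1) -szP -lead_coefE (monicP Pm) rmorph1.
  rewrite addrC -[RHS]Pw (horner_coef_wide _ (size_poly _ _)) szP big_ord_recr.
  congr (_ + _); first by apply: eq_bigr => k _; rewrite coef_poly /= (leq_trans (ltn_ord k)) ?leqnSn.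
  by rewrite coef_poly /= ltnSn fPm mul1r.
rewrite rmorphD mulrDl -ewX rmorph_sum mulr_suml.
have -> : \sum_(k < m) f (P`_k * x ^+ (n * (m - k)) * a ^+ k) * e =
    e * (X ^+ (n * m) * \sum_(k < m) f P`_k * u ^+ k).
  rewrite !mulr_sumr; apply: eq_bigr => k _.
  rewrite rmorphM -mulrA -ewX rmorphM rmorphXn -/X wE exprMn -exprM.
  have -> : X ^+ (n * m) = X ^+ (n * (m - k)) * X ^+ (n * k).
    by rewrite -exprD -mulnDr subnK // ltnW.
  by ring.
rewrite {1}wE exprMn -exprM -mulrDr -mulrDr Pw !mulr0 //.
Qed.

(** Nakayama's lemma by successive approximation. *)
Lemma adic_finite : exists h : seq Q, forall q, B q -> exists c, q = lin f c h.
Proof.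
have [h [hB hP]] := fin_mod_x; exists h => q Bq.
have step (u : {q | B q}) : {cb : (nat -> A) * {q | B q} |
    sval u = lin f cb.1 h + X * sval cb.2}.
  apply: cid; case: u => u Bu /=; have [c [b Bb E]] := hP u Bu.
  exists (c, exist _ b Bb); rewrite /= -E; ring.
pose u n := iter n (fun w => (sval (step w)).2) (exist _ q Bq).
pose a l := (sval (step (u l))).1.
have qE n : q = \sum_(l < n) X ^+ l * lin f (a l) h + X ^+ n * sval (u n).
  elim: n => [|n IH]; first by rewrite big_ord0 add0r mul1r.
  rewrite {1}IH big_ord_recr /= {1}(svalP (step (u n))) exprSr /a.
  by ring.
have [xlim _] := xc.
have [c cP] := choice (fun i => xlim (fun l => a l i)).
exists c; apply/eqP; rewrite -subr_eq0; apply/eqP/B_separated => n.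
have [c' c'P] := choice (fun i => cP i n).
exists (sval (u n) - lin f c' h).
  have [_ BB _] := sB; apply: BB; first exact: (svalP (u n)).
  by apply: (sr_sum sB) => i; apply: (srM sB) => //; apply: hB; apply: mem_nth.
rewrite {1}(qE n).
have -> : lin f c h = \sum_(l < n) X ^+ l * lin f (a l) h + X ^+ n * lin f c' h.
  rewrite /lin.
  under [in RHS]eq_bigr do rewrite mulr_sumr.
  rewrite exchange_big mulr_sumr -big_split; apply: eq_bigr => i _ /=.
  rewrite {1}(c'P i) rmorphD rmorphM rmorphXn rmorph_sum /= mulrDl mulr_suml.
  congr (_ + _); last by rewrite /X; ring.
  by apply: eq_bigr => l _; rewrite rmorphM rmorphXn /= /X; ring.
by ring.
Qed.

End AdicFiniteness.

Lemma finite_closures_adic (A A0 : comNzRingType) (p : {rmorphism A -> A0}) (x : A) :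
  noetherian A -> (forall b, exists a, b = p a) ->
  (forall a, p a = 0 <-> exists c, a = c * x) -> xcomplete x -> x <> 0 ->
  domain A0 -> finite_closures A0 -> finite_closures A.
Proof.
move=> noethA psurj pker xc x0 domA0 finA0 Q f r Qinv Qred Qdep.
exact: (adic_finite noethA psurj pker xc x0 domA0 finA0 Qinv Qred Qdep).
Qed.

(** * Complete local domains have finite normalization *)

Lemma ideal_span_cons (A : comPzRingType) (a : A) s x : ideal_span s x -> ideal_span (a :: s) x.
Proof.
by apply: ideal_span_sub => y ys; apply: ideal_span_mem; rewrite inE ys orbT.
Qed.

Lemma ideal_span_head (A : comPzRingType) (a : A) s : ideal_span (a :: s) a.
Proof. by apply: ideal_span_mem; rewrite mem_head. Qed.

(** Gaussian elimination without division: there are fewer equations than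
    unknowns. *)
Lemma dependent_rows (A : comNzRingType) (r : nat) (M : 'I_r.+1 -> nat -> A) : domain A ->
  exists a : 'I_r.+1 -> A, (exists i, a i <> 0) /\
    forall j, (j < r)%N -> \sum_i a i * M i j = 0.
Proof.
move=> domA; elim: r M => [|r IH] M.
  by exists (fun=> 1); split=> //; exists ord0; apply/eqP/oner_neq0.
have [[i0 Mi0]|noi] := pselect (exists i, M i r <> 0); last first.
  have [a [[i ai] aM]] := IH (fun i => M (lift ord0 i)).
  exists (fun i => if unlift ord0 i is Some j then a j else 0); split.
    by exists (lift ord0 i); rewrite liftK.
  move=> j; rewrite ltnS leq_eqVlt => /predU1P[->|jr].
    apply: big1 => k _; have -> : M k r = 0 by apply: contrapT => Mk; apply: noi; exists k.
    by rewrite mulr0.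
  rewrite big_ord_recl unlift_none mul0r add0r -[RHS](aM j jr).
  by apply: eq_bigr => k _; rewrite liftK.
pose N (i : 'I_r.+1) j := M i0 r * M (lift i0 i) j - M (lift i0 i) r * M i0 j.
have [a [[i ai] aN]] := IH N.
exists (fun k => if unlift i0 k is Some j then a j * M i0 r else
  - \sum_j a j * M (lift i0 j) r); split.
  by exists (lift i0 i); rewrite liftK => /domA[].
have sumE (G : 'I_r.+2 -> A) : \sum_k G k = G i0 + \sum_j G (lift i0 j).
  by rewrite (bigD1_ord i0).
move=> j; rewrite sumE unlift_none ltnS => jr.
transitivity (\sum_k a k * N k j).
  rewrite mulNr mulr_suml -sumrN -big_split; apply: eq_bigr => k _ /=.
  by rewrite liftK /N; ring.
move: jr; rewrite leq_eqVlt => /predU1P[->|/aN//].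
by apply: big1 => k _; rewrite /N; ring.
Qed.

Lemma noetherian_field (A : comNzRingType) :
  (forall a : A, a <> 0 -> exists y, a * y = 1) -> noetherian A.
Proof.
move=> Ainv J; have [[a [Ja a0]]|noa] := pselect (exists a, J a /\ a <> 0).
  exists [:: 1]; rewrite eqEsubset; split=> x _.
    by apply: ideal1; apply: ideal_span_head.
  by have [y ay] := Ainv a a0; apply: ideal1; rewrite -ay; apply: ideal_mulr.
exists [::]; rewrite eqEsubset; split=> x; last first.
  by move=> /ideal_spanP[c ->]; rewrite big_ord0; apply: ideal0.
move=> Jx; have -> : x = 0 by apply: contrapT => x0; apply: noa; exists x.
exact: ideal0.
Qed.

Section CompleteDomain.
Variables (D : comNzRingType) (I : ideal D).
Hypotheses (I1 : ~ I 1) (Iunit : forall d, ~ I d -> exists y, d * y = 1).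
Hypotheses (noethD : noetherian D) (domD : domain D) (cD : icomplete I).

Lemma unit_add v z : ~ I v -> I z -> ~ I (v + z).
Proof. by move=> Iv Iz /idealB /(_ Iz); rewrite addrK. Qed.

Section Tower.
Variables (L : comNzRingType) (f : {rmorphism L -> D}) (y : L).
Hypotheses (f_inj : injective f) (Iy : I (f y))
  (f_ker : forall a, I (f a) -> exists c, a = c * y)
  (f_onto : forall d, exists a, I (d - f a)) (yc : xcomplete y).
Hypotheses (noethL : noetherian L) (finL : finite_closures L).

Let domL : domain L.
Proof.
move=> a b /(congr1 f); rewrite rmorphM rmorph0 => /domD[] E; [left|right];
  by apply: f_inj; rewrite E rmorph0.
Qed.

(** What is kept while power series variables with values [vars] are adjoined.
    The last clause is Noether's change of variables: unless [y] divides [G],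
    replacing each variable [x] other than the first one, [x1], by [x - x1 ^ N]
    makes the value of [G] a unit times a power of [x1] modulo the others. *)
Definition tower (x1 : D) (vars : seq D) (A : comNzRingType) (F : {rmorphism A -> D})
    (yA : A) :=
  [/\ noetherian A, domain A /\ finite_closures A,
      F yA = f y /\ (y = 0 -> yA = 0),
      (forall z, (forall n, exists c, z = c * yA ^+ n) -> z = 0) /\
      (forall d b, (forall z, exists c, ideal_span (vars ++ b) (z - lin f c d)) ->
         forall z, exists c, ideal_span b (z - lin F c d))
    & forall G, ~ (exists c, G = c * yA) -> exists ys s v,
        [/\ size ys = (size vars).-1, forall z, z \in ys -> I z, ~ I v,
            ideal_span (f y :: ys) (F G - v * x1 ^+ s)
          & forall z, z \in vars -> ideal_span (f y :: x1 :: ys) z]].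

Let ps_sep (A : comNzRingType) (yA : A) :
  (forall z, (forall n, exists c, z = c * yA ^+ n) -> z = 0) ->
  forall z : pseries A, (forall n, exists c, z = c * ps_const yA ^+ n) -> z = 0.
Proof.
move=> ysep z zy; apply: pseries_eq => k.
have -> : pcoef (0 : pseries A) k = 0 by case: k.
apply: ysep => n; have [c ->] := zy n; exists (pcoef c k).
by rewrite -rmorphXn mulrC pcoefCM mulrC.
Qed.

Let ps_first (A : comNzRingType) (yA : A) (G : pseries A) :
  ~ (exists c, G = c * ps_const yA) -> exists i, ~ (exists c, pcoef G i = c * yA) /\
    forall l, (l < i)%N -> exists c, pcoef G l = c * yA.
Proof.
move=> Gy; pose P i := `[< ~ exists c, pcoef G i = c * yA >].
have P0 : exists i, P i.
  apply: contrapT => noi; apply: Gy.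
  have /choice[c cP] i : exists c, pcoef G i = c * yA.
    by apply: contrapT => H; apply: noi; exists i; apply/asboolP.
  exists (PSeries c); apply: pseries_eq => i.
  by rewrite mulrC pcoefCM /= cP mulrC.
have [i /asboolP Pi imin] := ex_minnP P0; exists i; split=> // l li.
by apply: contrapT => /asboolP /imin; rewrite leqNgt li.
Qed.

Let ps_value (A : comNzRingType) (F : {rmorphism A -> D}) (Phi : {rmorphism pseries A -> D}) x G i :
  (forall a, Phi (ps_const a) = F a) -> Phi (ps_X A) = x ->
  exists g, Phi G = \sum_(l < i) F (pcoef G l) * x ^+ l + x ^+ i * (F (pcoef G i) + x * g).
Proof.
move=> PhiC PhiX; exists (Phi (ps_drop i.+1 G)).
rewrite {1}(ps_split G i.+1) big_ord_recr /= !rmorphD rmorph_sum !rmorphM !rmorphXn PhiC PhiX /=.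
have -> : \sum_(l < i) Phi (ps_const (pcoef G l) * ps_X A ^+ l) =
    \sum_(l < i) F (pcoef G l) * x ^+ l.
  by apply: eq_bigr => l _; rewrite rmorphM rmorphXn PhiC PhiX.
by rewrite exprS; ring.
Qed.

Let tower_ring (A : comNzRingType) (yA : A) : noetherian A -> domain A -> finite_closures A ->
  [/\ noetherian (pseries A), domain (pseries A) & finite_closures (pseries A)].
Proof.
move=> noethA domA finA; split; [exact: ps_noetherian|exact: ps_domain|].
apply: (@finite_closures_adic _ A (@ps_coef0 A) (ps_X A)) => //.
- exact: ps_noetherian.
- exact: ps_coef0_surj.
- exact: ps_coef0P.
- exact: ps_xcomplete.
- by move=> /(congr1 (fun G => pcoef G 1)) /eqP; rewrite oner_eq0.
Qed.

Let tower_first (x1 : D) : I x1 -> exists A F yA, @tower x1 [:: x1] A F yA.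
Proof.
move=> Ix1; have xc1 := icomplete_xcomplete cD Ix1.
have [Phi [PhiC PhiX]] := ps_eval f xc1.
have [n1 n2 n3] := tower_ring y noethL domL finL.
exists (pseries L), Phi, (ps_const y); split=> //.
- by split=> // ->; apply: rmorph0.
- split; first by apply: ps_sep; case: yc.
  move=> d b gen; apply: (@complete_nakayama _ _ Phi (ps_X L)); rewrite ?PhiX //.
    exact: ps_xcomplete.
  move=> z; have [c cP] := gen z; exists (fun i => ps_const (c i)).
  rewrite (_ : lin Phi _ d = lin f c d) //.
  by apply: eq_bigr => i _; rewrite PhiC.
- move=> G /ps_first[i [Gi Gl]]; have [g ->] := ps_value G i PhiC PhiX.
  exists [::], i, (f (pcoef G i) + x1 * g); split=> //.
  + apply: unit_add; last exact: ideal_mulr.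
    by move=> /f_ker.
  + rewrite [X in _ - X]mulrC addrK; apply: ideal_sum => l.
    have [c ->] := Gl l (ltn_ord l); rewrite rmorphM -mulrA mulrCA; apply: ideal_mulr.
    exact: ideal_span_head.
  + by move=> z; rewrite inE => /eqP ->; apply: ideal_span_cons; apply: ideal_span_head.
Qed.

Let tower_next (x1 x : D) vars A F yA : I x1 -> I x -> (0 < size vars)%N ->
  @tower x1 vars A F yA -> exists A' F' yA', @tower x1 (rcons vars x) A' F' yA'.
Proof.
move=> Ix1 Ix vars0 [noethA [domA finA] [FyA yA0] [ysep gen] co].
have xc := icomplete_xcomplete cD Ix.
have [Phi [PhiC PhiX]] := ps_eval F xc.
have [n1 n2 n3] := tower_ring yA noethA domA finA.
exists (pseries A), Phi, (ps_const yA); split=> //.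
- by rewrite PhiC; split=> // /yA0 ->; apply: rmorph0.
- split; first exact: ps_sep.
  move=> d b genb; apply: (@complete_nakayama _ _ Phi (ps_X A)); rewrite ?PhiX //.
    exact: ps_xcomplete.
  move=> z; have [|c cP] := gen d (x :: b) _ z.
    by move=> w; have [c] := genb w; rewrite cat_rcons => cP; exists c.
  exists (fun i => ps_const (c i)).
  rewrite (_ : lin Phi _ d = lin F c d) //.
  by apply: eq_bigr => i _; rewrite PhiC.
- move=> G /ps_first[i [Gi Gl]]; have [g ->] := ps_value G i PhiC PhiX.
  have [ys [s [v [sys Iys Iv cos varsJ]]]] := co _ Gi.
  pose w := x - x1 ^+ s.+1.
  have Jw : ideal_span (f y :: w :: ys) w.
    by apply: ideal_span_cons; apply: ideal_span_head.
  have Jys z : ideal_span (f y :: ys) z -> ideal_span (f y :: w :: ys) z.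
    apply: ideal_span_sub => u; rewrite inE => /predU1P[->|uys]; first exact: ideal_span_head.
    by apply: ideal_span_mem; rewrite !inE uys !orbT.
  exists (w :: ys), (s.+1 * i + s)%N, (v + x1 * g); split.
  + by rewrite /= sys size_rcons /= prednK.
  + move=> z; rewrite inE => /predU1P[->|/Iys//].
    by apply: idealB => //; rewrite exprS; apply: ideal_mulr.
  + by apply: unit_add => //; apply: ideal_mulr.
  + have -> : \sum_(l < i) F (pcoef G l) * x ^+ l + x ^+ i * (F (pcoef G i) + x * g) -
        (v + x1 * g) * x1 ^+ (s.+1 * i + s) =
      \sum_(l < i) F (pcoef G l) * x ^+ l + (x ^+ i * (F (pcoef G i) - v * x1 ^+ s) +
      (x ^+ i * g * w + (v + x1 * g) * x1 ^+ s * (x ^+ i - (x1 ^+ s.+1) ^+ i))).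
      by rewrite /w exprD exprM exprS; ring.
    apply: idealD.
      apply: ideal_sum => l; have [c ->] := Gl l (ltn_ord l).
      rewrite rmorphM FyA -mulrA mulrCA; apply: ideal_mulr; exact: ideal_span_head.
    apply: idealD; first by apply: idealM; apply: Jys.
    apply: idealD; first exact: idealM.
    by apply: idealM; rewrite subrXX; apply: ideal_mulr.
  + move=> z; rewrite mem_rcons inE => /predU1P[->|/varsJ].
      have -> : x = w + x1 * x1 ^+ s by rewrite /w exprS; ring.
      apply: idealD; first by apply: ideal_span_mem; rewrite !inE eqxx !orbT.
      by apply: ideal_mulr; apply: ideal_span_mem; rewrite !inE eqxx !orbT.
    apply: ideal_span_sub => u; rewrite !inE => H; apply: ideal_span_mem.
    by rewrite !inE; case/or3P: H => ->; rewrite ?orbT.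
Qed.

Let tower_exists (x1 : D) (xs : seq D) : I x1 -> (forall x, x \in xs -> I x) ->
  exists A F yA, @tower x1 (x1 :: xs) A F yA.
Proof.
move=> Ix1; elim/last_ind: xs => [|xs x IH] Ixs; first exact: tower_first.
have [|A [F [yA tow]]] := IH.
  by move=> z zxs; apply: Ixs; rewrite mem_rcons inE zxs orbT.
apply: (tower_next (vars := x1 :: xs) Ix1 _ _ tow) => //.
by apply: Ixs; rewrite mem_rcons mem_head.
Qed.

Let params (xs : seq D) := (forall x, x \in xs -> I x) /\
  forall i, I i -> exists N, ideal_span (f y :: xs) (i ^+ N).

Let params_min : exists xs, params xs /\ forall ys, params ys -> (size xs <= size ys)%N.
Proof.
pose P n := `[< exists xs, params xs /\ size xs = n >].
have P0 : exists n, P n.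
  have [s sE] := noethD I; exists (size s); apply/asboolP; exists s; split=> //; split.
    by move=> x xs; rewrite sE; apply: ideal_span_mem.
  by move=> i; rewrite sE => si; exists 1%N; rewrite expr1; apply: ideal_span_cons.
have [n /asboolP[xs [pxs sxs]] nmin] := ex_minnP P0.
by exists xs; split=> // ys pys; rewrite sxs; apply: nmin; apply/asboolP; exists ys.
Qed.

Let finite_mod (xs : seq D) : params xs ->
  exists d, forall z, exists c, ideal_span (f y :: xs) (z - lin f c d).
Proof.
move=> [_ pxs]; have [s sE] := noethD I.
have [N NP] : exists N, ideal_exp I N `<=` ideal_span (f y :: xs).
  have [|N NP] := @fg_nil_exp _ s (ideal_span (f y :: xs)).
    by move=> x xs'; apply: pxs; rewrite sE; apply: ideal_span_mem.
  by exists N => z zI; apply: NP; apply: ideal_exp_mono zI; rewrite sE.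
suff [d dP] : exists d, forall z, exists c, ideal_exp I N (z - lin f c d).
  by exists d => z; have [c cP] := dP z; exists c; apply: NP.
elim: N {NP} => [|N [d dP]].
  by exists [::] => z; exists (fun=> 0); apply: ideal_exp0.
have [g gE] := noethD (ideal_exp I N); exists (d ++ g) => z.
have [c] := dP z; rewrite gE => /ideal_spanP[e E].
have [a aP] := choice (fun i => f_onto (e i)).
have [b bE] := lin_cat_ex f c a d g; exists b.
rewrite bE opprD addrA E /lin -sumrB; apply: ideal_sum => i; rewrite -mulrBl.
apply: ideal_expS_mem => //.
by rewrite gE; apply: ideal_span_mem; apply: mem_nth.
Qed.

(** By minimality of the number of parameters there is no relation between them,
    because a change of variables would make one of them superfluous. *)
Lemma normalization_exists : exists (A : comNzRingType) (F : {rmorphism A -> D}) (d : seq D),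
  [/\ noetherian A, finite_closures A, injective F & forall z, exists c, z = lin F c d].
Proof.
have [xs [pxs xsmin]] := params_min; have [Ixs Nxs] := pxs.
have [d dP] := finite_mod pxs.
have {}dP : forall z, exists c, ideal_span xs (z - lin f c d).
  by apply: complete_nakayama dP => //; apply: icomplete_xcomplete cD _.
case: xs => [|x1 xs] in pxs xsmin Ixs Nxs dP *.
  exists L, f, d; split=> // z; have [c] := dP z => /ideal_spanP[e].
  by rewrite big_ord0 => /eqP; rewrite subr_eq0 => /eqP zE; exists c.
have Ix1 : I x1 by apply: Ixs; rewrite mem_head.
have [|A [F [yA [noethA [domA finA] [FyA yA0] [ysep gen] co]]]] :=
    tower_exists (xs := xs) Ix1.
  by move=> x xxs; apply: Ixs; rewrite inE xxs orbT.
exists A, F, d; split=> //; last first.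
  move=> z; have [|c] := gen d [::] _ z.
    by move=> w; rewrite cats0; apply: dP.
  move=> /ideal_spanP[e]; rewrite big_ord0 => /eqP; rewrite subr_eq0 => /eqP zE.
  by exists c.
have noker G : ~ (exists c, G = c * yA) -> F G <> 0.
  move=> Gy FG; have [ys [s [v [sys Iys Iv]]]] := co G Gy.
  rewrite FG sub0r => /idealN; rewrite opprK => cos varsJ.
  have [u uv] := Iunit Iv.
  have {}cos : ideal_span (f y :: ys) (x1 ^+ s).
    have -> : x1 ^+ s = u * (v * x1 ^+ s) by rewrite mulrA [u * v]mulrC uv mul1r.
    exact: idealM.
  suff /xsmin : params ys by rewrite sys /= ltnn.
  split=> // i Ii; have [N iN] := Nxs i Ii.
  have [|M MP] := @fg_nil_exp _ (f y :: x1 :: ys) (ideal_span (f y :: ys)).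
    move=> z; rewrite !inE => /or3P[/eqP ->|/eqP ->|zys].
    - by exists 1%N; rewrite expr1; apply: ideal_span_head.
    - by exists s.
    - by exists 1%N; rewrite expr1; apply: ideal_span_mem; rewrite inE zys orbT.
  exists (N * M)%N; rewrite exprM; apply: MP; apply: ideal_exp_pow.
  move: iN; apply: ideal_span_sub => z; rewrite inE => /predU1P[->|/varsJ//].
  exact: ideal_span_head.
have Finj G : F G = 0 -> G = 0.
  move=> FG; apply: contrapT => G0.
  have [yy|yy] := pselect (y = 0).
    by apply: (noker G) => // -[c E]; apply: G0; rewrite E yA0 // mulr0.
  have [n nG] : exists n, ~ exists c, G = c * yA ^+ n.
    by apply: contrapT => non; apply: G0; apply: ysep => n; apply: contrapT => H; apply: non; exists n.
  elim: n nG => [|n IH] nG; first by apply: nG; exists G; rewrite mulr1.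
  have [[c cE]|noc] := pselect (exists c, G = c * yA ^+ n); last exact: IH.
  apply: (noker c).
    by move=> [c' c'E]; apply: nG; exists c'; rewrite cE c'E exprS mulrA.
  have fy0 : f y <> 0 by move=> fy; apply: yy; apply: f_inj; rewrite fy rmorph0.
  move: FG; rewrite cE rmorphM rmorphXn FyA => /domD[//|].
  elim: (n) => [/eqP|k IHk]; first by rewrite oner_eq0.
  by rewrite exprS => /domD[].
by move=> G H E; apply/eqP; rewrite -subr_eq0; apply/eqP/Finj; rewrite rmorphB E subrr.
Qed.

End Tower.

Let normalization : exists (A : comNzRingType) (F : {rmorphism A -> D}) (d : seq D),
  [/\ noetherian A, finite_closures A, injective F & forall z, exists c, z = lin F c d].
Proof.
have [L [f [y [f_inj Iy f_ker f_onto yc]]]] := coefficient_ring I1 Iunit noethD domD cD.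
have [k [res [res_surj res0]]] := residue_field_exists I1 Iunit.
have kinv (a : k) : a <> 0 -> exists b, a * b = 1.
  by move=> /eqP a0; exists a^-1; rewrite divff.
pose rho : {rmorphism L -> k} := res \o f.
have rho_surj b : exists a, b = rho a.
  have [d ->] := res_surj b; have [a da] := f_onto d; exists a.
  by apply/eqP; rewrite -subr_eq0 /= -rmorphB; apply/eqP/res0.
have rho_ker a : rho a = 0 <-> exists c, a = c * y.
  split=> [/res0/f_ker//|[c ->]].
  by apply/res0; rewrite rmorphM; apply: idealM.
have noethk := noetherian_field kinv.
have noethL : noetherian L.
  by apply: (xadic_noetherian rho_surj _ yc noethk) => a /rho_ker.
have finL : finite_closures L.
  have [y0|y0] := pselect (y = 0).
    apply: finite_closures_field => a a0.
    have [|b ab] := kinv (rho a).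
      by move=> /rho_ker[c cE]; apply: a0; rewrite cE y0 mulr0.
    have [b' b'E] := rho_surj b; exists b'; apply/eqP; rewrite -subr_eq0; apply/eqP.
    have /rho_ker[c ->] : rho (a * b' - 1) = 0 by rewrite rmorphB rmorphM rmorph1 -b'E ab subrr.
    by rewrite y0 mulr0.
  apply: (finite_closures_adic noethL rho_surj rho_ker yc y0) => //.
    by move=> a b /eqP; rewrite mulf_eq0 => /orP[/eqP|/eqP]; [left|right].
  exact: finite_closures_field.
exact: (normalization_exists f_inj Iy f_ker f_onto yc noethL finL).
Qed.

(** [D] is finite over a ring [A] of power series over a coefficient ring, so its
    fraction field has finite rank over [A], and integrality over [D] is
    integrality over [A]. Tate's criterion applies to [A] one variable at a time. *)
Lemma complete_domain_finite : exists h : seq (total_frac D),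
  forall q, integralOver (to_total_frac D) q -> exists c, q = lin (to_total_frac D) c h.
Proof.
have [A [F [d [noethA finA Finj dP]]]] := normalization.
pose Q := total_frac D; pose g : {rmorphism D -> Q} := to_total_frac D.
pose fQ : {rmorphism A -> Q} := g \o F.
have nzd z : z <> 0 -> nonzerodivisors D z by move=> z0 w /domD[].
have g_inj z : g z = 0 -> z = 0.
  by move=> /to_loc0[u Su]; apply: Su.
have Qinv a : a <> 0 -> exists b, fQ a * b = 1.
  move=> a0; apply: (to_loc_unit (S := nonzerodivisors D)).
  by apply: nzd => Fa; apply: a0; apply: Finj; rewrite Fa rmorph0.
have domA : domain A := subfield_domain Qinv.
have Qred (q : Q) n : q ^+ n = 0 -> q = 0.
  have [a [s [Ss qs]]] := loc_frac q; have [s' ss'] := to_loc_unit Ss.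
  move=> qn; suff a0 : a = 0.
    by rewrite -[q]mulr1 -ss' mulrA qs a0 rmorph0 mul0r.
  have : g (a ^+ n) = 0 by rewrite rmorphXn -[g a]qs exprMn qn mul0r.
  move=> /g_inj; elim: n {qn} => [/eqP|n IH]; first by rewrite oner_eq0.
  by rewrite exprS => /domD[].
have Qdep (v : nat -> Q) : exists a : nat -> A,
    (exists2 i, (i <= size d)%N & a i <> 0) /\ \sum_(i < (size d).+1) fQ (a i) * v i = 0.
  have [s [Ss [w wP]]] : exists s, nonzerodivisors D s /\ exists w : nat -> D,
      forall i, (i <= size d)%N -> v i * g s = g (w i).
    elim: (size d) => [|r [s [Ss [w wP]]]].
      have [a [s [Ss E]]] := loc_frac (v 0%N); exists s; split=> //; exists (fun=> a) => i.
      by rewrite leqn0 => /eqP ->.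
    have [a [t [St E]]] := loc_frac (v r.+1); exists (s * t); split; first exact: mult_setM.
    exists (fun i => if i == r.+1 then a * s else w i * t) => i.
    rewrite leq_eqVlt => /predU1P[->|]; first by rewrite eqxx !rmorphM -[g a]E; ring.
    by move=> ir; rewrite ltn_eqF // !rmorphM -wP //; ring.
  have [c cP] := choice (fun i => dP (w i)).
  have [a [[i ai] aM]] := dependent_rows (fun i : 'I_(size d).+1 => c i) domA.
  exists (fun k => if insub k is Some j then a j else 0); split.
    by exists i; [rewrite -ltnS|rewrite valK].
  have [s' ss'] := to_loc_unit Ss.
  rewrite -[LHS]mulr1 -ss' mulrA mulr_suml.
  rewrite (_ : \sum_(_ < _) _ = 0) ?mul0r //.
  transitivity (g (\sum_(k < (size d).+1) F (a k) * w k)).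
    rewrite rmorph_sum; apply: eq_bigr => k _; rewrite valK rmorphM -mulrA.
    by rewrite -[g (w k)]wP // -ltnS.
  rewrite (_ : \sum_(_ < _) _ = 0) ?rmorph0 //.
  transitivity (\sum_(j < size d) F (\sum_(k < (size d).+1) a k * c k j) * d`_j).
    under eq_bigr do rewrite cP /lin mulr_sumr.
    rewrite exchange_big; apply: eq_bigr => j _; rewrite rmorph_sum mulr_suml.
    by apply: eq_bigr => k _; rewrite rmorphM mulrA.
  by apply: big1 => j _; rewrite aM // rmorph0 mul0r.
have [h hP] := finA Q fQ (size d) Qinv Qred Qdep.
have intD z : integralOver fQ (g z).
  apply: (@integral_common_denominator _ _ _ Qinv noethA (map g d) 1) => [|n].
    by apply/eqP/oner_neq0.
  have [c zE] := dP (z ^+ n); exists c; rewrite rmorph1 mul1r -rmorphXn zE.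
  rewrite /lin rmorph_sum size_map; apply: eq_bigr => i _.
  by rewrite rmorphM (nth_map 0).
exists h => q [P Pm Pq].
have [|c cE] := hP q.
  apply: (integral_root_monic (monic_map g Pm) Pq).
  by apply/integral_poly => i; rewrite coef_map; apply: intD.
by exists (fun i => F (c i)); rewrite cE.
Qed.

End CompleteDomain.

(** * The normalization of a complete local ring modulo nilpotents *)

(** If [x] lies in [P], its product with an element [y] of the other minimal primes is
    nilpotent; were [x] a nonzerodivisor, [y] would be nilpotent, but it can be
    taken outside [P]. *)
Lemma nzd_not_minimal_prime (A : comPzRingType) (P : spec A) x : noetherian A ->
  nonzerodivisors A x -> minimal_prime P -> ~ P x.
Proof.
move=> noethA xreg Pmin Px; have [l [_ lnil]] := minimal_primes noethA.
have [|y [ly Py]] := @list_prod_notin _ P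
    (List.filter (fun p : spec A => `[< ~ ((p : set A) `<=` P) >]) l).
  move=> p /List.filter_In[_ /asboolP] /existsNP[y /not_implyP pP].
  by exists y.
have [n] : exists n, (x * y) ^+ n = 0.
  apply: lnil => p pl; have [pP|pP] := pselect ((p : set A) `<=` P).
    by apply: ideal_mulr; apply: (Pmin p pP).
  by apply: idealM; apply: ly; apply/List.filter_In; split=> //; apply/asboolP.
rewrite exprMn => xyn; apply: Py; apply: (@prime_pow _ _ n).
suff -> : y ^+ n = 0 by apply: ideal0.
elim: n (y ^+ n) xyn => [|n IH] z; first by rewrite mul1r.
by rewrite exprS -mulrA => /xreg /IH.
Qed.

Section QuotientOfComplete.
Variables (T : comNzRingType) (I : ideal T).
Hypotheses (noethT : noetherian T) (I1 : ~ I 1)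
  (Iunit : forall d, ~ I d -> exists y, d * y = 1) (cI : icomplete I).
Variable P : spec T.

Lemma quot_prime_neq0 : 1 != 0 :> quot P.
Proof.
by apply/eqP => /to_quot0; case: (specP P).
Qed.

Let D : comNzRingType := nzring quot_prime_neq0.
Let pi : {rmorphism T -> D} := to_quot P.

Let piP a : pi a = 0 <-> P a. Proof. exact: to_quot0. Qed.
Let pi_surj d : exists a, d = pi a. Proof. exact: to_quot_surj. Qed.

Lemma quot_prime_domain : domain D.
Proof.
move=> x y; have [a ->] := pi_surj x; have [b ->] := pi_surj y.
by rewrite -rmorphM => /piP; have [_ PM] := specP P; case/PM => /piP; [left|right].
Qed.

Let ID : ideal D.
Proof.
exists [set b | exists2 a, I a & b = pi a].
- by exists 0; rewrite ?rmorph0 //; apply: ideal0.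
- by move=> _ _ [a Ka ->] [b Kb ->]; exists (a + b); rewrite ?rmorphD //; apply: idealD.
- move=> b _ [a Ka ->]; have [c ->] := pi_surj b.
  by exists (c * a); rewrite ?rmorphM //; apply: idealM.
Defined.

Let P_sub_I : (P : set T) `<=` I.
Proof.
move=> a Pa; apply: contrapT => /Iunit[y ay].
by have [P1 _] := specP P; apply: P1; rewrite -ay; apply: ideal_mulr.
Qed.

Let ID_exp n a : ideal_exp I n a -> ideal_exp ID n (pi a).
Proof.
elim: n a => [|n IH] a; first by move=> _; apply: ideal_exp0.
apply: (@ideal_expS_sub _ _ _ (ideal_preim pi (ideal_exp ID n.+1))) => y z Iy Iz.
rewrite /ideal_preim /ideal_set rmorphM; apply: ideal_expS_mem; last exact: IH.
by exists y.
Qed.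

Let ID_exp_lift n d : ideal_exp ID n d -> exists2 a, ideal_exp I n a & d = pi a.
Proof.
elim: n d => [|n IH] d.
  by have [a ->] := pi_surj d; exists a => //; apply: ideal_exp0.
have @K : ideal D.
  exists [set d | exists2 a, ideal_exp I n.+1 a & d = pi a].
  - by exists 0; [apply: ideal0|rewrite rmorph0].
  - by move=> _ _ [a ? ->] [b ? ->]; exists (a + b); [apply: idealD|rewrite rmorphD].
  - move=> b _ [a ? ->]; have [c ->] := pi_surj b.
    by exists (c * a); [apply: idealM|rewrite rmorphM].
apply: (@ideal_expS_sub _ _ _ K) => _ _ [a Ia ->] /IH[b Ib ->].
by exists (a * b); [apply: ideal_expS_mem|rewrite rmorphM].
Qed.

Lemma quot_prime_icomplete : icomplete ID.
Proof.
split=> [u uC|z].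
  have [a0 a0E] := pi_surj (u 0%N).
  have [v vP] := choice (fun n => let: ex_intro2 a Ia E := ID_exp_lift (uC n) in
    ex_intro (fun a => ideal_exp I n a /\ u n.+1 - u n = pi a) a (conj Ia E)).
  have sE n : pi (a0 + \sum_(k < n) v k) = u n.
    elim: n => [|n IH]; first by rewrite big_ord0 addr0.
    by rewrite big_ord_recr addrA rmorphD IH /=; have [_ <-] := vP n; rewrite addrC subrK.
  have [|l lP] := cI.1 (fun n => a0 + \sum_(k < n) v k).
    by move=> n; rewrite big_ord_recr addrA /= [_ + v n]addrC addrK; have [] := vP n.
  by exists (pi l) => n; rewrite -sE -rmorphB; apply: ID_exp.
have [a ->] := pi_surj z => aI; apply/piP.
apply: (krull_closed noethT (I := I)) => [i|n]; first exact: icomplete_jacobson.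
have [b Ib /esym/eqP] := ID_exp_lift (aI n).
rewrite -subr_eq0 -rmorphB => /eqP/piP Pba.
exists (a - b); last by rewrite opprB addrC subrK.
by rewrite -opprB; apply: idealN.
Qed.

Lemma quot_prime_closure_finite : exists h : seq (total_frac D),
  forall q, integralOver (to_total_frac D) q -> exists c, q = lin (to_total_frac D) c h.
Proof.
apply: (@complete_domain_finite D ID).
- move=> [a Ia /esym/eqP]; rewrite -subr_eq0 -(rmorph1 pi) -rmorphB => /eqP/piP/P_sub_I.
  by move=> /(idealB Ia); rewrite opprB addrC subrK => /I1.
- move=> d; have [a ->] := pi_surj d => IDa.
  have [|y ay] := @Iunit a; first by move=> Ia; apply: IDa; exists a.
  by exists (pi y); rewrite -rmorphM ay rmorph1.
- by apply: (@noetherian_surj _ _ pi) => //; exact: pi_surj.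
- exact: quot_prime_domain.
- exact: quot_prime_icomplete.
Qed.

Hypothesis Pmin : minimal_prime P.

Let Q := total_frac T.

Lemma total_frac_minimal_quot : exists (E : comPzRingType) (g : {rmorphism T -> E})
    (psi : {rmorphism Q -> E}) (h : seq E),
  [/\ forall a, psi (to_total_frac T a) = g a, forall a, g a = 0 -> P a
    & forall q, integralOver (to_total_frac T) q -> exists c, psi q = lin g c h].
Proof.
pose g : {rmorphism T -> total_frac D} := to_total_frac D \o pi.
have nzdD d : d <> 0 -> nonzerodivisors D d.
  by move=> d0 w /quot_prime_domain[].
have [psi psiE] : exists psi : {rmorphism Q -> total_frac D},
    forall a, psi (to_total_frac T a) = g a.
  apply: (@loc_lift _ (nonzerodivisors T) _ g) => s sreg.
  apply: to_loc_unit; apply: nzdD => /piP.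
  exact: nzd_not_minimal_prime Pmin.
have [h hP] := quot_prime_closure_finite.
exists (total_frac D), g, psi, h; split=> // [a|q [p pm pq]].
  by move=> /to_loc0[u ureg E]; apply/piP; apply: ureg.
have [|c ->] := hP (psi q).
  exists (map_poly pi p); first exact: monic_map.
  have -> : map_poly (to_total_frac D) (map_poly pi p) =
            map_poly psi (map_poly (to_total_frac T) p).
    by apply/polyP => i; rewrite !coef_map /= psiE.
  exact: rmorph_root.
have [c' c'E] := choice (fun i => pi_surj (c i)); exists c'.
by apply: eq_bigr => i _; rewrite c'E.
Qed.

End QuotientOfComplete.

Section ClosureModNil.
Variables (T : comNzRingType) (I : ideal T).
Hypotheses (noethT : noetherian T) (I1 : ~ I 1)
  (Iunit : forall d, ~ I d -> exists y, d * y = 1) (cI : icomplete I).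

Let Q := total_frac T.
Let t : {rmorphism T -> Q} := to_total_frac T.

Lemma integral_submod : submod t [set q | integralOver t q].
Proof.
split=> [|x y xi yi|a x xi].
- exact: (integral0 t).
- exact: (integral_add xi yi).
- exact: (integral_mul (integral_id t a) xi).
Qed.

(** A nilpotent of the total ring of fractions is one that vanishes in the
    fraction fields of the quotients by the minimal primes, and these quotients
    have finite normalizations. *)
Lemma integral_mod_nil_fin :
  fin t [set q | integralOver t q] [set q | exists n, q ^+ n = 0].
Proof.
have [l [lmin lnil]] := minimal_primes noethT.
have : forall p, List.In p l -> exists M : set Q, [/\ submod t M,
    forall q a s, M q -> nonzerodivisors T s -> q * t s = t a -> p a &
    forall M', submod t M' -> M' `<=` [set q | integralOver t q] -> fin t M' (M' `&` M)].
  move=> p /lmin pmin.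
  have [E [g [psi [h [psiE gp hP]]]]] := total_frac_minimal_quot noethT I1 Iunit cI pmin.
  have psiZ a x : psi (t a * x) = g a * psi x by rewrite rmorphM psiE.
  exists [set q | psi q = 0]; split.
  - split; rewrite /mkset; first by rewrite rmorph0.
      by move=> x y xM yM; rewrite rmorphD xM yM addr0.
    by move=> a x xM; rewrite psiZ xM mulr0.
  - by move=> q a s qM _ E'; apply: gp; rewrite -psiE -[to_total_frac T a]E' rmorphM qM mul0r.
  - move=> M' sM' M'i; have : fin t M' [set x | [set 0] (psi x)].
      apply: (@fin_preim _ noethT _ _ t g psi M' [set 0] h) => //.
      + by move=> x y _ _; rewrite rmorphD.
      + exact: submod0.
      + by move=> x /M'i/hP[c ->]; exists c; rewrite /= subrr.
    by apply: fin_weaken_in.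
move=> {lmin} lM.
suff [M [sM Mi Mp finM]] : exists M, [/\ submod t M, M `<=` [set q | integralOver t q],
   forall q a s p, List.In p l -> M q -> nonzerodivisors T s -> q * t s = t a -> p a &
   fin t [set q | integralOver t q] M].
  apply: fin_weaken finM => q Mq; have [a [s [sreg qs]]] := loc_frac q.
  have [n an] : exists n, a ^+ n = 0.
    by apply: lnil => p pl; apply: Mp Mq sreg qs.
  exists n; have [s' ss'] := to_loc_unit sreg.
  by rewrite -[q]mulr1 -ss' mulrA qs exprMn -rmorphXn an rmorph0 mul0r.
elim: l lM {lnil} => [|p l IH] lM.
  exists [set q | integralOver t q]; split; first exact: integral_submod.
  - by move=> q.
  - by move=> q a s p [].
  - by exists [::]; split=> [//|q qi]; exists (fun=> 0); rewrite lin0 subr0.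
have [|M [sM Mi Mp finM]] := IH; first by move=> p' p'l; apply: lM; right.
have [N [sN Np finN]] := lM p (or_introl erefl).
exists (M `&` N); split.
- exact: submod_cap.
- by move=> q [/Mi].
- move=> q a s p' [<- [_ Nq]|p'l [Mq _]]; first exact: Np.
  exact: Mp Mq.
- exact: (fin_trans Mi finM (finN M sM Mi)).
Qed.

End ClosureModNil.

(** * Finiteness of the strict closure *)

Lemma nilradical_mul0 (A : comPzRingType) (a b : A) : nilradical_sq0 A ->
  nilradical a -> nilradical b -> a * b = 0.
Proof.
move=> N2 Na Nb.
have : ideal_mul (@nilradical A) (@nilradical A) (a * b) by apply: ideal_mul_mem.
by rewrite N2.
Qed.

Section TotalFractions.
Variable A : comNzRingType.
Let t : {rmorphism A -> total_frac A} := to_total_frac A.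

Lemma to_total_frac_inj a : t a = 0 -> a = 0.
Proof. by move=> /to_loc0[u ureg]; apply: ureg. Qed.

Lemma nzd_total_frac s z : nonzerodivisors A s -> t s * z = 0 -> z = 0.
Proof.
move=> /to_loc_unit[y ty] E; rewrite -[z]mul1r -[1]ty -[_ * y]mulrC -mulrA.
by rewrite [X in _ * X]E mulr0.
Qed.

Lemma common_denominator (h : seq (total_frac A)) : exists s, nonzerodivisors A s /\
  forall z, z \in h -> exists a, t s * z = t a.
Proof.
elim: h => [|z h [s [sreg hs]]]; first by exists 1; split=> //; exact: mult_set1.
have [a [u [ureg za]]] := loc_frac z; exists (u * s); split; first exact: mult_setM.
move=> y; rewrite inE => /predU1P[->|/hs[b yb]].
  by exists (a * s); rewrite !rmorphM mulrAC [_ * z]mulrC -[t a]za.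
by exists (u * b); rewrite !rmorphM -mulrA yb.
Qed.

Lemma total_frac_nilpotent (q : total_frac A) n : q ^+ n = 0 -> exists s a,
  [/\ nonzerodivisors A s, t s * q = t a & nilradical a].
Proof.
move=> qn; have [a [s [sreg qa]]] := loc_frac q; exists s, a; split=> //.
  by rewrite mulrC.
exists n; apply: to_total_frac_inj; rewrite rmorphXn -[t a]qa exprMn qn.
exact: mul0r.
Qed.

Lemma total_frac_nilpotent_mul0 (q q' : total_frac A) n n' : nilradical_sq0 A ->
  q ^+ n = 0 -> q' ^+ n' = 0 -> q * q' = 0.
Proof.
move=> N2 /total_frac_nilpotent[s [a [sreg qa Na]]].
move=> /total_frac_nilpotent[s' [a' [s'reg qa' Na']]].
apply: (nzd_total_frac sreg); apply: (nzd_total_frac s'reg).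
transitivity ((t s * q) * (t s' * q')); first by rewrite /t; ring.
by rewrite qa qa' -rmorphM nilradical_mul0 ?rmorph0.
Qed.

End TotalFractions.

Section StrictClosureModule.
Variables (R S : comPzRingType) (f : {rmorphism R -> S}).

Lemma tensM a b a' b' : tens f f (a * a') (b * b') = tens f f a b * tens f f a' b'.
Proof.
rewrite /tens -[RHS](@rp_classM (tens_pres f f)); apply/rp_classP; exact: tens_refl.
Qed.

Lemma tensDl a a' b : tens f f (a + a') b = tens f f a b + tens f f a' b.
Proof.
rewrite /tens -[RHS](@rp_classD (tens_pres f f)); apply/rp_classP; exact: tens_Dl.
Qed.

Lemma tens_scaleE r a b : tens f f (f r * a) b = tens f f a (f r * b).
Proof. by apply/(@rp_classP (tens_pres f f)); apply: tens_scale. Qed.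

Lemma strict_closure_submod : submod f (strict_closure f).
Proof.
split=> [|x y xs ys|r x xs]; rewrite /strict_closure /mkset.
- by rewrite tens0l -[RHS]/(tens_inr f f 0) rmorph0.
- by rewrite tensDl xs ys -[RHS]/(tens_inr f f (x + y)) rmorphD.
- by rewrite -[X in tens f f _ X = _]mulr1 tensM xs -tensM tens_scaleE !mul1r.
Qed.

Lemma lin_fg_submodule (M : set S) (h : seq S) : submod f M -> (forall x, x \in h -> M x) ->
  (forall x, M x -> exists c, x = lin f c h) -> fg_submodule f M.
Proof.
move=> sM hM Mh; exists (size h), (fun i : 'I_(size h) => h`_i).
rewrite eqEsubset; split=> [x /Mh[c ->]|_ [c _ <-]]; first by exists (fun i : 'I_(size h) => c i).
have [M0 MD MZ] := sM.
by elim/big_ind: _ => // i _; apply: MZ; apply: hM; apply: mem_nth.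
Qed.

End StrictClosureModule.


Section Conductor.
Variables (R S T Q : comNzRingType) (f : {rmorphism R -> S}) (iota : {rmorphism R -> T})
  (th : {rmorphism S -> Q}) (t : {rmorphism T -> Q}).
Hypothesis thE : forall r, th (f r) = t (iota r).
Hypothesis t_inj : forall a, t a = 0 -> a = 0.

Definition nilp : set Q := [set q | exists n, q ^+ n = 0].

Hypothesis nil0 : forall q q', nilp q -> nilp q' -> q * q' = 0.

Let nilE q : nilp q <-> q * q = 0.
Proof. by split=> [qn|qq]; [apply: nil0|exists 2%N; rewrite expr2]. Qed.

Lemma nilp_submod : submod t nilp.
Proof.
split=> [|x y /[dup] xn /nilE xx /[dup] yn /nilE yy|a x /nilE xx]; apply/nilE.
- by rewrite mul0r.
- have xy := nil0 xn yn; have yx := nil0 yn xn.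
  by rewrite mulrDl !mulrDr xx yy xy yx !addr0.
- by rewrite mulrACA xx mulr0.
Qed.

Definition nil_image : set Q := [set q | exists2 a : T, nilradical a & q = t a].

Let t_nil a : nilp (t a) -> nilradical a.
Proof. by move=> [n an]; exists n; apply: t_inj; rewrite rmorphXn. Qed.

Let nil_t a : nilradical a -> nilp (t a).
Proof. by move=> [n an]; exists n; rewrite -rmorphXn an rmorph0. Qed.

Let nil_image_submod : submod t nil_image.
Proof.
have [n0 nD nZ] := nilp_submod; split=> [|_ _ [a Na ->] [b Nb ->]|c _ [a Na ->]].
- by exists 0; rewrite ?rmorph0 //; exists 1%N; rewrite expr1.
- exists (a + b); last by rewrite rmorphD.
  by apply: t_nil; rewrite rmorphD; apply: nD; apply: nil_t.
- exists (c * a); last by rewrite rmorphM.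
  by apply: t_nil; rewrite rmorphM; apply: nZ; apply: nil_t.
Qed.

Lemma nil_image_gens : noetherian T ->
  exists h : seq Q, forall q, nil_image q -> exists c, q = lin t c h.
Proof.
move=> noethT; have @N : ideal T.
  exists (@nilradical T).
  - by exists 1%N; rewrite expr1.
  - move=> a b Na Nb; apply: t_nil; rewrite rmorphD.
    by have [_ nD _] := nilp_submod; apply: nD; apply: nil_t.
  - by move=> c a [n an]; exists n; rewrite exprMn an mulr0.
have [s sE] := noethT N.
exists (map t s) => _ [a Na ->]; have : N a by [].
rewrite sE => /ideal_spanP[c ->]; exists c; rewrite /lin rmorph_sum size_map.
by apply: eq_bigr => i _; rewrite rmorphM (nth_map 0).
Qed.

Let uniq r n r' n' : nilp n -> nilp n' -> t r + n = t r' + n' -> nil_image (n - n').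
Proof.
move=> nn nn' E; have E' : n - n' = t (r' - r).
  by rewrite rmorphB -[n](addKr (t r)) E; ring.
exists (r' - r); last exact: E'.
by apply: t_nil; rewrite -E'; exact: (submodB nilp_submod nn nn').
Qed.

Variables (x : T) (B : set Q).
Hypotheses (B1 : B 1) (thB : forall b, B (th b))
  (xP : forall q, B q -> exists r n, nilp n /\ t x * q = t r + n).

(** The part [nu b] of [x * b] that is nilpotent modulo the ring is additive in
    [b], so the strict closure relation may be evaluated on it. *)
Let nu_ex : exists (nu : S -> Q) (rho : S -> T),
  (forall b, nilp (nu b)) /\ forall b, t x * th b = t (rho b) + nu b.
Proof.
have [rho rhoP] := choice (fun b => xP (thB b)).
have [nu nuP] := choice rhoP.
by exists nu, rho; split=> b; have [] := nuP b.
Qed.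

Let L : set Q := [set z | nil_image (t x * z)].

Let L_submod : submod t L.
Proof.
have [N0 ND NZ] := nil_image_submod; split=> [|y z yL zL|a y yL]; rewrite /L /mkset.
- by rewrite mulr0.
- by rewrite mulrDr; apply: ND.
- by rewrite mulrCA; apply: NZ.
Qed.

Let L_mul b n : B b -> nil_image n -> L (b * n).
Proof.
move=> /xP[r [n' [nn' xb]]] Nn; rewrite /L /mkset mulrA xb mulrDl.
have -> : n' * n = 0 by case: Nn => a Na ->; apply: nil0 => //; apply: nil_t.
by rewrite addr0; have [_ _ NZ] := nil_image_submod; apply: NZ.
Qed.

(** The map [b * b' |-> b * nu b'] is balanced modulo [L], the elements that [x]
    multiplies into the nilradical of the ring [T]. Applied to the relation that
    defines the strict closure it puts [nu a] in [L] for [a] in the closure; and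
    [nu q] is [x * q] when [q] is nilpotent. *)
Lemma strict_closure_conductor (s : seq S) (c : nat -> T) q :
  (forall a, a \in s -> strict_closure f a) ->
  q = lin t c (map th s) -> nilp q -> nil_image (t x * (t x * q)).
Proof.
move=> sS qE nq; have [nu [rho [nuN nuE]]] := nu_ex.
have NQL z : nil_image z -> L z by move=> Nz; rewrite -[z]mul1r; apply: L_mul.
have nuD b b' : nil_image (nu (b + b') - (nu b + nu b')).
  have [_ nD _] := nilp_submod.
  apply: (@uniq (rho (b + b')) _ (rho b + rho b')) => //; first exact: nD.
  by rewrite -nuE !rmorphD mulrDr !nuE; ring.
have nuZ r b : nil_image (t (iota r) * nu b - nu (f r * b)).
  have [_ _ nZ] := nilp_submod.
  apply: (@uniq (iota r * rho b) _ (rho (f r * b))) => //; first exact: nZ.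
  by rewrite -nuE rmorphM -mulrDr -nuE rmorphM thE; ring.
have nu1 : nil_image (nu 1).
  rewrite -[nu 1]subr0; apply: (@uniq (rho 1) _ x) => //; first by exists 1%N; rewrite expr1.
  by rewrite -nuE !rmorph1 mulr1 addr0.
have [L0 LD LZ] := L_submod.
have nuL a : strict_closure f a -> L (nu a).
  move=> /(@rp_classP (tens_pres f f)).
  move=> /(tens_eq_balanced_mod (H := L) (b := fun y z => th y * nu z)) H.
  have : L (th a * nu 1 - th 1 * nu a).
    move: H; rewrite !big_seq1; apply=> //.
    - by move=> y z yL zL; apply: (submodB L_submod).
    - by move=> y y' z; rewrite rmorphD mulrDl subrr.
    - by move=> y z z'; rewrite -mulrDr -mulrBr; apply: L_mul.
    - move=> r y z; have -> : th (f r * y) = th y * t (iota r) by rewrite rmorphM thE mulrC.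
      by rewrite -mulrA -mulrBr; apply: L_mul.
  have aL : L (th a * nu 1) by apply: L_mul.
  move=> /(submodB L_submod aL); rewrite opprB addrC subrK.
  by rewrite rmorph1 mul1r.
have [r xE] : exists r, t x * lin t c (map th s) = t r + lin t c (map nu s).
  elim: s c {qE sS nq} => [|a s IH] c; first by exists 0; rewrite !lin0 mulr0 rmorph0 addr0.
  have [r rE] := IH (fun i => c i.+1); exists (c 0%N * rho a + r).
  by rewrite /= !lin_cons mulrDr rE mulrCA nuE !rmorphD rmorphM; ring.
have nl : nilp (lin t c (map nu s)).
  by apply: lin_sub nilp_submod _ => _ /mapP[b _ ->].
have Ll : L (lin t c (map nu s)).
  by apply: lin_sub L_submod _ => _ /mapP[b bs ->]; apply/nuL/sS.
have : nil_image (t x * q - lin t c (map nu s)).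
  apply: (@uniq 0 _ r) => //; last by rewrite rmorph0 add0r qE xE.
  by have [_ _ nZ] := nilp_submod; apply: nZ.
have [_ ND NZ] := nil_image_submod.
by move=> /(NZ x) /ND /(_ Ll); rewrite -mulrDr subrK.
Qed.

Hypotheses (noethT : noetherian T) (xreg : forall q, t x * q = 0 -> q = 0)
  (sB : submod t B) (finB : fin t B nilp).

(** The span [M] of the strict closure is finite modulo nilpotents like [B], and by
    the previous lemma [x ^ 2] embeds its nilpotents in the nilradical of the
    Noetherian ring [T]. *)
Lemma strict_closure_span_finite : exists s : seq S,
  (forall a, a \in s -> strict_closure f a) /\
  forall a, strict_closure f a -> exists c, th a = lin t c (map th s).
Proof.
pose M : set Q := [set q | exists s c,
  (forall a, a \in s -> strict_closure f a) /\ q = lin t c (map th s)].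
have sM : submod t M.
  split=> [|_ _ [s [c [sS ->]]] [s' [c' [sS' ->]]]|a _ [s [c [sS ->]]]].
  - by exists [::], (fun=> 0); rewrite lin0.
  - have [e eE] := lin_cat_ex t c c' (map th s) (map th s').
    exists (s ++ s'), e; rewrite map_cat eE; split=> // a.
    by rewrite mem_cat => /orP[/sS|/sS'].
  - by exists s, (fun i => a * c i); rewrite linZ.
have MB : M `<=` B.
  by move=> _ [s [c [_ ->]]]; apply: (lin_sub c sB) => _ /mapP[b _ ->].
have finM1 : fin t M (M `&` nilp).
  by apply: (fin_weaken_in sM _ (fin_sub noethT sM nilp_submod MB finB)).
have finM2 : fin t (M `&` nilp) [set 0].
  have [h hP] := nil_image_gens noethT.
  have : fin t (M `&` nilp) [set q | [set 0] (t x * (t x * q))].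
    apply: (@fin_preim _ noethT _ _ t t _ (M `&` nilp) [set 0] h).
    - by move=> y z _ _; rewrite !mulrDr.
    - by move=> a y _; ring.
    - exact: (submod_cap sM nilp_submod).
    - exact: submod0.
    - move=> q [[s [c [sS qE]]] nq].
      have [d dE] := hP _ (strict_closure_conductor sS qE nq).
      by exists d; rewrite dE; apply: subrr.
  by apply: fin_weaken => q /xreg/xreg.
have [|h [hM hP]] := fin_trans _ finM1 finM2; first by move=> q [].
have [s [sS hs]] : exists s, (forall a, a \in s -> strict_closure f a) /\
    forall z, z \in h -> exists c, z = lin t c (map th s).
  elim: h hM {hP} => [|z h IH] hM; first by exists [::].
  have [|s [sS hs]] := IH; first by move=> y yh; apply: hM; rewrite inE yh orbT.
  have [s' [c [sS' zE]]] := hM z (mem_head _ _); exists (s' ++ s); split.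
    by move=> a; rewrite mem_cat => /orP[/sS'|/sS].
  rewrite map_cat => y; rewrite inE => /predU1P[->|/hs[d ->]].
    have [e eE] := lin_cat_ex t c (fun=> 0) (map th s') (map th s).
    by exists e; rewrite eE lin_zero addr0.
  have [e eE] := lin_cat_ex t (fun=> 0) d (map th s') (map th s).
  by exists e; rewrite eE lin_zero add0r.
exists s; split=> // a aS; have [|c] := hP (th a).
  exists [:: a], (fun=> 1); split=> [b|]; first by rewrite inE => /eqP ->.
  by rewrite /lin big_ord1 rmorph1 mul1r.
rewrite /mkset => /eqP; rewrite subr_eq0 => /eqP ->.
by apply: (lin_sub c (lin_submod t (map th s))).
Qed.

End Conductor.

Section Core.
Variables (R : comNzRingType) (m : ideal R).
Hypotheses (noethR : noetherian R) (mloc : local_ring m).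

Let T : comNzRingType := nzring (cmpl_1neq0 mloc).
Let iota : {rmorphism R -> T} := to_completion m.
Let Q := total_frac T.
Let t : {rmorphism T -> Q} := to_total_frac T.
Let RB := int_closure R.
Let f : {rmorphism R -> RB} := @to_int_closure R.
Let tR : {rmorphism R -> total_frac R} := to_total_frac R.

Let closure_fin : fin t [set q | integralOver t q] (@nilp Q).
Proof.
apply: (@integral_mod_nil_fin T (cmpl_ideal m)).
- exact: cmpl_noetherian.
- by rewrite -(rmorph1 iota) => /iota_ker; rewrite ideal_exp1; case: mloc => -[].
- by move=> d; apply: cmpl_unit.
- exact: cmpl_icomplete.
Qed.

Let theta_ex : exists theta : {rmorphism total_frac R -> Q},
  forall r, theta (tR r) = t (iota r).
Proof.
apply: (@loc_lift _ (nonzerodivisors R) _ (t \o iota)) => s sreg.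
by apply: to_loc_unit; apply: cmpl_nzd.
Qed.

Let closure_map_ex : exists th : {rmorphism RB -> Q},
  [/\ forall r, th (f r) = t (iota r), forall b, integralOver t (th b) &
   forall b (d a : R), tR d * val b = tR a -> t (iota d) * th b = t (iota a)].
Proof.
have [theta thetaE] := theta_ex.
pose th : {rmorphism RB -> Q} := theta \o val.
exists th; split=> [r|b|b d a E]; first exact: thetaE.
  have /asboolP[p pm pb] := valP b; exists (map_poly iota p); first exact: monic_map.
  have -> : map_poly t (map_poly iota p) = map_poly theta (map_poly tR p).
    by apply/polyP => i; rewrite !coef_map /= thetaE.
  exact: rmorph_root.
by rewrite -!thetaE -E rmorphM.
Qed.

(** Coefficients in the completion may be replaced by coefficients in [R], because
    ideals of [R] are contracted from the completion. *)
Lemma strict_closure_fg : nilradical_sq0 (completion m) ->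
  fg_submodule f (strict_closure f).
Proof.
move=> N2; have [th [thE th_int thfrac]] := closure_map_ex.
have t_inj a : t a = 0 -> a = 0 := @to_total_frac_inj T a.
have nil0 (q q' : Q) : nilp q -> nilp q' -> q * q' = 0.
  by move=> [n qn] [n' qn']; apply: (total_frac_nilpotent_mul0 (A := T) N2 qn qn').
have noethT : noetherian T := cmpl_noetherian noethR mloc.
have [x [xreg xP]] : exists x : T, nonzerodivisors T x /\
    forall q, integralOver t q -> exists r n, nilp n /\ t x * q = t r + n.
  have [h [_ hP]] := closure_fin.
  have [x [xreg xh]] := common_denominator h; exists x; split=> // q /hP[c qc].
  have [a aE] : exists a, t x * lin t c h = t a.
    elim: h c xh {hP qc} => [|z h IH] c xh; first by exists 0; rewrite lin0 mulr0 rmorph0.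
    have [b bE] := xh z (mem_head _ _).
    have [|a aE] := IH (fun i => c i.+1); first by move=> y yh; apply: xh; rewrite inE yh orbT.
    by exists (c 0%N * b + a); rewrite lin_cons mulrDr aE mulrCA [t x * z]bE -rmorphM -rmorphD.
  exists a, (t x * (q - lin t c h)); split; last by rewrite mulrBr aE addrC subrK.
  by have [_ _ nZ] := nilp_submod t nil0; apply: nZ.
have [|s [sS hs]] := strict_closure_span_finite thE t_inj nil0 (integral1 t) th_int
   xP noethT _ (integral_submod T) closure_fin.
  by move=> q; apply: nzd_total_frac.
apply: (lin_fg_submodule (strict_closure_submod f) sS) => a /hs[c aE].
have [d [dreg dP]] := common_denominator (map val (a :: s)).
have [num numP] : exists num : RB -> R, forall b, b \in a :: s -> tR d * val b = tR (num b).
  have : forall b : RB, exists r, b \in a :: s -> tR d * val b = tR r.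
    move=> b; have [bs|_] := boolP (b \in a :: s); last by exists 0.
    by have [r rE] := dP (val b) (map_f _ bs); exists r.
  by move=> /choice[num numP]; exists num.
have : ideal_span (map iota (map num s)) (iota (num a)).
  apply/ideal_spanP; exists c; rewrite !size_map.
  apply/eqP; rewrite -subr_eq0; apply/eqP/t_inj/eqP; rewrite rmorphB subr_eq0; apply/eqP.
  rewrite -(thfrac _ _ _ (numP a (mem_head _ _))) aE /lin size_map mulr_sumr rmorph_sum.
  apply: eq_bigr => i _.
  have is_ : s`_i \in a :: s by rewrite inE mem_nth ?orbT.
  rewrite (nth_map 0) // -map_comp (nth_map 0) // rmorphM mulrCA.
  by rewrite (thfrac _ _ _ (numP _ is_)).
move=> /(cmpl_span noethR mloc)/ideal_spanP[e]; rewrite size_map => numE.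
exists e; apply: val_inj; apply/eqP; rewrite -subr_eq0; apply/eqP.
apply: (nzd_total_frac dreg); rewrite mulrBr; apply/eqP; rewrite subr_eq0; apply/eqP.
have -> : val (lin f e s) = \sum_(i < size s) tR (e i) * val (s`_i).
  by rewrite /lin rmorph_sum; apply: eq_bigr => i _; rewrite rmorphM.
rewrite [LHS](numP a (mem_head _ _)) numE mulr_sumr rmorph_sum; apply: eq_bigr => i _.
have is_ : s`_i \in a :: s by rewrite inE mem_nth ?orbT.
by rewrite (nth_map 0) // rmorphM mulrCA [_ * val _](numP _ is_).
Qed.

End Core.

(** * Finiteness forces the nilradical to have square zero *)

Lemma depth_nonzerodivisor (A : comPzRingType) (I : ideal A) : depth_gt I 0 ->
  exists2 x, I x & nonzerodivisors A x.
Proof.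
move=> [s [s0 sI [_ sreg]]]; exists (s`_0); first by apply: sI; apply: mem_nth.
move=> y /= xy; have /ideal_spanP[c ->] : ideal_span (take 0 s) y.
  by apply: (sreg 0%N s0); rewrite xy; apply: ideal0.
by rewrite take0 big_ord0.
Qed.

Section NilpotentFractions.
Variable R : comNzRingType.
Let S := int_closure R.
Let f : {rmorphism R -> S} := @to_int_closure R.

Lemma to_int_closure_inj a : f a = 0 -> a = 0.
Proof. by move=> /(congr1 val) /(@to_total_frac_inj R). Qed.

Let nil_div (s : R) (n : S) k : nonzerodivisors R s -> n ^+ k = 0 ->
  exists n' : S, n = f s * n' /\ n' ^+ k = 0.
Proof.
move=> sreg nk; have [y sy] := to_loc_unit sreg.
have yk : (y * val n) ^+ k = 0 by rewrite exprMn -rmorphXn nk rmorph0 mulr0.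
have yint : y * val n \in @integral_pred R.
  apply/asboolP; exists 'X^k; first exact: monicXn.
  by rewrite rootE map_polyXn hornerXn yk.
exists (Sub (y * val n) yint); split; apply: val_inj; last by rewrite rmorphXn SubK yk.
by rewrite -[RHS]/(to_total_frac R s * (y * val n)) mulrA [X in X * _]sy mul1r.
Qed.

Let nil_num (n : S) : exists s a, nonzerodivisors R s /\ f s * n = f a.
Proof.
have [a [s [sreg na]]] := loc_frac (val n); exists s, a; split=> //.
by apply: val_inj; rewrite rmorphM mulrC.
Qed.

(** Fractions of nilpotents are integral, so that denominators move freely
    across the tensor sign. *)
Lemma nilpotent_mul_strict (n n' : S) k k' : n ^+ k = 0 -> n' ^+ k' = 0 ->
  strict_closure f (n * n').
Proof.
have left (u v : S) j : v ^+ j = 0 -> tens f f (u * v) 1 = tens f f v u.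
  move=> vj; have [s [a [sreg ua]]] := nil_num u.
  have [v' [-> _]] := nil_div sreg vj; rewrite mulrCA mulrA ua.
  rewrite tens_scaleE mulr1 -ua -tens_scaleE.
  by [].
have right (u v : S) j : v ^+ j = 0 -> tens f f 1 (u * v) = tens f f u v.
  move=> vj; have [s [a [sreg ua]]] := nil_num u.
  have [v' [-> _]] := nil_div sreg vj; rewrite mulrCA mulrA ua.
  by rewrite -tens_scaleE mulr1 -ua tens_scaleE.
move=> nk n'k; rewrite /strict_closure /mkset (right _ _ _ n'k) mulrC.
exact: left nk.
Qed.

Hypothesis noethR : noetherian R.

(** Dividing a nilpotent fraction by powers of [x] gives elements [z l] of the strict
    closure with [z l = x * z l.+1]; by finiteness [z l.+1] is a multiple of [z l]
    for some [l], hence of [x * z l.+1], so it vanishes as [x] lies in [m]. *)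
Lemma nilradical_sq0_of_fg (m : ideal R) : local_ring m -> depth_gt m 0 ->
  fg_submodule f (strict_closure f) -> nilradical_sq0 R.
Proof.
move=> mloc /depth_nonzerodivisor[x mx xreg] [k [g gE]].
suff N2 (a b : R) : nilradical a -> nilradical b -> a * b = 0.
  rewrite /nilradical_sq0 eqEsubset; split=> [|_ ->]; last exact: ideal0.
  by apply: (@ideal_mul_sub _ _ _ (ideal_bot R)) => a b Na Nb; apply: N2.
move=> [i ai] [j bj]; apply: to_int_closure_inj; rewrite rmorphM.
have fb : f b ^+ j = 0 by rewrite -rmorphXn bj rmorph0.
have fa : f a ^+ i = 0 by rewrite -rmorphXn ai rmorph0.
have [u [u0 uS uN]] : exists u : nat -> S,
    [/\ u 0%N = f a, forall l, u l = f x * u l.+1 & forall l, u l ^+ i = 0].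
  have step (n : {n : S | n ^+ i = 0}) : exists n' : {n : S | n ^+ i = 0},
      sval n = f x * sval n'.
    by case: n => n ni; have [n' [E n'i]] := nil_div xreg ni; exists (exist _ n' n'i).
  have [F FP] := choice step.
  exists (fun l => sval (iter l F (exist _ (f a) fa))); split=> // l; last by case: (iter _ _ _).
pose z l := u l * f b.
have zx l d : z l = f (x ^+ d) * z (l + d)%N.
  elim: d l => [|d IH] l; first by rewrite addn0 rmorph1 mul1r.
  by rewrite IH addnS exprSr rmorphM /z (uS (l + d)%N); ring.
pose N : set S := [set y | exists l r, y = f r * z l].
have sN : submod f N.
  split=> [|_ _ [l [r ->]] [l' [r' ->]]|c _ [l [r ->]]].
  - by exists 0%N, 0; rewrite rmorph0 mul0r.
  - exists (l + l')%N, (r * x ^+ l' + r' * x ^+ l).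
    rewrite (zx l l') (zx l' l) [(l' + l)%N]addnC rmorphD !rmorphM; ring.
  - by exists l, (c * r); rewrite rmorphM mulrA.
have NS : N `<=` strict_closure f.
  move=> _ [l [r ->]]; have [_ _ SZ] := strict_closure_submod f.
  by apply: SZ; apply: nilpotent_mul_strict (uN l) fb.
have [h [hN hP]] : fin f N [set 0].
  apply: (@fin_preim _ noethR _ _ f f id N [set 0] (codom g)) => //; first exact: (submod0 f).
  move=> y /NS; rewrite gE => -[c _ <-].
  exists (fun l => if insub l is Some e then c e else 0).
  rewrite /lin size_codom card_ord; apply/eqP; rewrite subr_eq0; apply/eqP.
  apply: eq_bigr => e _; rewrite valK; congr (_ * _).
  rewrite (nth_map e) ?size_enum_ord //; congr (g _).
  by rewrite nth_ord_enum.
have [K KP] : exists K, forall y, y \in h -> exists r, y = f r * z K.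
  elim: h hN {hP} => [|y h IH] hN; first by exists 0%N.
  have [|K KP] := IH; first by move=> w wh; apply: hN; rewrite inE wh orbT.
  have [l [r yE]] := hN y (mem_head _ _); exists (l + K)%N => w; rewrite inE.
  move=> /predU1P[->|/KP[r' ->]].
    by exists (r * x ^+ K); rewrite yE (zx l K) rmorphM mulrA.
  by exists (r' * x ^+ l); rewrite (zx K l) addnC rmorphM mulrA.
have [|c] := hP (z K.+1); first by exists K.+1, 1; rewrite rmorph1 mul1r.
rewrite /mkset => /eqP; rewrite subr_eq0 => /eqP zE.
have [r rE] : exists r, lin f c h = f r * z K.
  elim: h c KP {hN hP zE} => [|y h IH] c KP; first by exists 0; rewrite lin0 rmorph0 mul0r.
  have [|r rE] := IH (fun e => c e.+1); first by move=> w wh; apply: KP; rewrite inE wh orbT.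
  have [r' yE] := KP y (mem_head _ _); exists (c 0%N * r' + r).
  by rewrite lin_cons rE yE rmorphD rmorphM; ring.
have [y yE] := local_jacobson noethR mloc (idealM r mx).
have z0 : z K.+1 = 0.
  rewrite -[LHS]mul1r -(rmorph1 f) -yE rmorphM rmorphB rmorph1 rmorphM.
  have := zx K 1%N; rewrite expr1 addn1 => zK.
  have {}zE : z K.+1 = f r * (f x * z K.+1) by rewrite -zK -rE.
  rewrite mulrAC mulrBl mul1r -mulrA -zE subrr.
  exact: mul0r.
have := zx 0%N K.+1; rewrite add0n z0 mulr0 /z u0; exact.
Qed.

End NilpotentFractions.

(** * Regular local rings are domains *)

Section Saturation.
Variable A : comPzRingType.
Implicit Types (P : spec A) (I J K : ideal A).

Lemma spec1 P : ~ P 1. Proof. by case: (specP P). Qed.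

Lemma specM P x y : P (x * y) -> P x \/ P y.
Proof. by case: (specP P) => _; apply. Qed.

Lemma spec_mul P x y : ~ P x -> ~ P y -> ~ P (x * y).
Proof. by move=> Px Py /specM[]. Qed.

Definition saturation P I : ideal A.
Proof.
exists [set a | exists s, ~ P s /\ I (s * a)].
- by exists 1; split; [apply: spec1|rewrite mulr0; apply: ideal0].
- move=> a b [s [Ps sa]] [u [Pu ub]]; exists (s * u); split; first exact: spec_mul.
  rewrite mulrDr; apply: idealD; last by rewrite -mulrA; apply: idealM.
  by rewrite mulrAC; apply: ideal_mulr.
- by move=> b a [s [Ps sa]]; exists s; split=> //; rewrite mulrCA; apply: idealM.
Defined.

Definition saturated P I := forall s a, ~ P s -> I (s * a) -> I a.

Lemma saturation_sub P I : I `<=` saturation P I.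
Proof. by move=> a Ia; exists 1; rewrite mul1r; split=> //; apply: spec1. Qed.

Lemma saturation_saturated P I : saturated P (saturation P I).
Proof.
move=> s a Ps [u [Pu usa]]; exists (u * s); split; first exact: spec_mul.
by rewrite -mulrA.
Qed.

Hypothesis noethA : noetherian A.

(** Nakayama's lemma in the localization at [P], for a saturated ideal [J]: a
    saturated ideal that is maximal among those that contain [J] but not [I]
    cannot exist. *)
Lemma nakayama_saturated P I J : saturated P J ->
  (forall a, I a -> saturation P (ideal_add J (ideal_mul P I)) a) -> I `<=` J.
Proof.
move=> satJ IJ; apply: contrapT => nIJ.
pose F : set (ideal A) := [set M | saturated P M /\ ~ (I `<=` M)].
have [M [[satM nIM] JM Mmax]] := noetherian_max noethA (F := F) (conj satJ nIJ).
have [a Ia Ma] : exists2 a, I a & ~ M a.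
  apply: contrapT => H; apply: nIM => a Ia; apply: contrapT => Ma; apply: H.
  by exists a.
pose M' := saturation P (ideal_add M (ideal_span [:: a])).
have IM' : I `<=` M'.
  apply: contrapT => nIM'; apply: Ma; apply: (Mmax M').
  - by split=> //; apply: saturation_saturated.
  - by move=> b Mb; apply: saturation_sub; apply: ideal_addl.
  - by apply: saturation_sub; apply: ideal_addr; apply: ideal_span_mem; rewrite inE.
have @Z : ideal A.
  exists [set z | exists s w, [/\ ~ P s, P w & M (s * z - w * a)]].
  - exists 1, 0; split; [exact: spec1|exact: ideal0|].
    by rewrite mulr0 mul0r subr0; apply: ideal0.
  - move=> z z' [s [w [Ps Pw E]]] [s' [w' [Ps' Pw' E']]].
    exists (s * s'), (s' * w + s * w'); split; first exact: spec_mul.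
      by apply: idealD; apply: idealM.
    have -> : s * s' * (z + z') - (s' * w + s * w') * a =
      s' * (s * z - w * a) + s * (s' * z' - w' * a) by ring.
    by apply: idealD; apply: idealM.
  - move=> b z [s [w [Ps Pw E]]]; exists s, (b * w); split=> //; first exact: idealM.
    have -> : s * (b * z) - b * w * a = b * (s * z - w * a) by ring.
    exact: idealM.
have PIZ : ideal_mul P I `<=` Z.
  apply: ideal_mul_sub => w b Pw /IM'[s [Ps [y [_ [My /ideal_span1P[c ->] E]]]]].
  exists s, (w * c); split=> //; first exact: ideal_mulr.
  have -> : s * (w * b) - w * c * a = w * (s * b - c * a) by ring.
  by rewrite E addrK; apply: idealM.
have [s [Ps [j [z [Jj /PIZ[s' [w [Ps' Pw E']]] E]]]]] := IJ a Ia.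
apply: Ma; apply: (satM (s' * s - w)).
  move=> /idealD /(_ Pw); rewrite subrK; exact: spec_mul.
have -> : (s' * s - w) * a = s' * j + (s' * z - w * a).
  by rewrite mulrBl -mulrA E; ring.
by apply: idealD => //; apply: idealM; apply: JM.
Qed.

(** Modulo a [P]-primary ideal [K] the localization at [P] has finite length: [A] is
    reached from [K] by adjoining finitely many elements [g] one at a time, with
    [P g] contained in the ideal reached so far, and each [g] allows at most one
    drop of the chain. *)
Lemma saturated_dcc P K N (I : nat -> ideal A) : ideal_exp P N `<=` K ->
  (forall n, K `<=` I n) -> (forall n, saturated P (I n)) ->
  (forall n, I n.+1 `<=` I n) -> exists n, I n `<=` I n.+1.
Proof.
move=> PNK KI satI Idec.
have Ile k n : (k <= n)%N -> I n `<=` I k.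
  by move=> /subnK <-; elim: (n - k)%N => // d IH a /Idec/IH.
pose stab (K' : set A) := exists n0, forall n, (n0 <= n)%N ->
  forall a, K' a -> I n0 a -> I n a.
have step (K' : ideal A) g : (forall w, P w -> K' (w * g)) -> stab K' ->
    stab (ideal_add K' (ideal_span [:: g])).
  move=> Pg [n0 n0P].
  have [[n1 [n01 n1P]]|no] := pselect (exists n1, (n0 <= n1)%N /\
      forall s k, K' k -> I n1 (k + s * g) -> P s).
    exists n1 => n n1n a [k [_ [Kk /ideal_span1P[c ->] ->]]] Ia.
    have Kc : K' (k + c * g) by apply: idealD => //; apply/Pg/(n1P c k).
    by apply: n0P => //; [apply: leq_trans n1n|apply: Ile Ia].
  exists n0 => n n0n a [k [_ [Kk /ideal_span1P[c ->] ->]]] Ia.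
  have [s' [k' [Kk' Ik' Ps']]] : exists s' k', [/\ K' k', I n (k' + s' * g) & ~ P s'].
    apply: contrapT => H; apply: no; exists n; split=> // s k' Kk' Ik'.
    by apply: contrapT => Ps; apply: H; exists s, k'.
  apply: (satI n s') => //.
  have -> : s' * (k + c * g) = (s' * k - c * k') + c * (k' + s' * g) by ring.
  apply: idealD; last exact: idealM.
  apply: n0P => //; first by apply: idealB; apply: idealM.
  have -> : s' * k - c * k' = s' * (k + c * g) - c * (k' + s' * g) by ring.
  by apply: idealB; apply: idealM => //; apply: Ile Ik'.
have steps (K' : ideal A) (g : seq A) : (forall w z, P w -> z \in g -> K' (w * z)) -> stab K' ->
    exists K'' : ideal A, [/\ K' `<=` K'', ideal_span g `<=` K'' & stab K''].
  elim: g => [|z g IH] Pg sK.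
    exists K'; split=> // a /ideal_spanP[c ->]; rewrite big_ord0; exact: ideal0.
  have [|K'' [KK gK sK'']] := IH _ sK.
    by move=> w y Pw yg; apply: Pg => //; rewrite inE yg orbT.
  exists (ideal_add K'' (ideal_span [:: z])); split.
  - by move=> a /KK; apply: ideal_addl.
  - apply: ideal_span_sub => y; rewrite inE => /predU1P[->|yg].
      by apply: ideal_addr; apply: ideal_span_mem; rewrite inE.
    by apply: ideal_addl; apply: gK; apply: ideal_span_mem.
  - by apply: step sK'' => w Pw; apply: KK; apply: Pg => //; rewrite mem_head.
have all j : (j <= N)%N -> exists K'' : ideal A, [/\ K `<=` K'', ideal_exp P (N - j) `<=` K'' & stab K''].
  elim: j => [|j IH] jN.
    by exists K; rewrite subn0; split=> //; exists 0%N => n _ a Ka _; apply: KI.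
  have [K' [KK' PK' sK']] := IH (ltnW jN).
  have [g gE] := noethA (ideal_exp P (N - j.+1)).
  have [|L [KL gL sL]] := steps K' g _ sK'.
    move=> w z Pw zg; apply: PK'; rewrite -subSS subSn //.
    by apply: ideal_expS_mem => //; rewrite gE; apply: ideal_span_mem.
  by exists L; split=> // a; [move=> /KK'/KL|rewrite gE => /gL].
have [K'' [_ PK'' [n0 n0P]]] := all N (leqnn N); exists n0 => a Ia.
by apply: n0P => //; apply: PK''; rewrite subnn; apply: ideal_exp0.
Qed.

(** The principal ideal theorem. If [P] is minimal over [p + (x)] then the
    symbolic powers of [q] modulo [p] stop decreasing, whence [q] lies in [p]. *)
Lemma principal_ideal_theorem (p q P : spec A) x :
  (p : set A) `<` q -> (q : set A) `<` P -> P x ->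
  exists Q : spec A, [/\ (p : set A) `<` Q, (Q : set A) `<` P & Q x].
Proof.
move=> [pq nqp] [qP nPq] Px.
have [qx|qx] := pselect (q x); first by exists q.
apply: contrapT => noQ; apply: nqp.
have px : ~ p x by move=> /pq.
have minP (Q : spec A) : (p : set A) `<=` Q -> (Q : set A) `<=` P -> Q x -> (P : set A) `<=` Q.
  move=> pQ QP Qx; apply: contrapT => nPQ; apply: noQ; exists Q; split=> //; split=> //.
  by move=> /(_ x Qx).
pose J := ideal_add p (ideal_span [:: x]).
have Jp : (p : set A) `<=` J by apply: ideal_addl.
have Jx : J x by apply: ideal_addr; apply: ideal_span_mem; rewrite inE.
pose K := saturation P J.
have Pnil a : P a -> exists n, K (a ^+ n).
  move=> Pa; apply: contrapT => noK.
  have @S : mult_set A.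
    exists [set z | exists s n, ~ P s /\ z = s * a ^+ n].
    - by exists 1, 0%N; rewrite mulr1; split=> //; apply: spec1.
    - move=> _ _ [s [n [Ps ->]]] [s' [n' [Ps' ->]]].
      by exists (s * s'), (n + n')%N; split; [apply: spec_mul|rewrite exprD mulrACA].
  have [|Q [JQ QS]] := @prime_avoiding _ noethA J S.
    by move=> z Jz [s [n [Ps zE]]]; apply: noK; exists n; exists s; rewrite -zE.
  have QP : (Q : set A) `<=` P.
    by move=> z Qz; apply: contrapT => Pz; apply: (QS z Qz); exists z, 0%N; rewrite mulr1.
  have Qa : Q a by apply: minP Pa => //; [move=> z /Jp/JQ|apply: JQ].
  by apply: (QS a Qa); exists 1, 1%N; rewrite mul1r; split=> //; apply: spec1.
have [N PNK] : exists N, ideal_exp P N `<=` K.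
  have [g gE] := noethA P; have [|N NK] := @fg_nil_exp _ g K.
    by move=> a ag; apply: Pnil; rewrite gE; apply: ideal_span_mem.
  by exists N => z zI; apply: NK; apply: ideal_exp_mono zI; rewrite gE.
pose qn n := saturation q (ideal_add (ideal_exp q n) p).
have qn_sat n : saturated q (qn n) by apply: saturation_saturated.
have p_qn n : (p : set A) `<=` qn n.
  by move=> a pa; apply: saturation_sub; apply: ideal_addr.
have qn_dec n : qn n.+1 `<=` qn n.
  move=> a [s [qs [y [z [yq pz E]]]]]; exists s; split=> //; rewrite E.
  by exists y, z; split=> //; apply: ideal_expSr.
pose I n := saturation P (ideal_add (qn n) (ideal_span [:: x])).
have [n In] : exists n, I n `<=` I n.+1.
  apply: (saturated_dcc PNK).
  - move=> n a [s [Ps [y [z [py xz E]]]]]; exists s; split=> //; exists y, z.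
    by split=> //; apply: p_qn.
  - by move=> n; apply: saturation_saturated.
  - move=> n a [s [Ps [y [z [py xz E]]]]]; exists s; split=> //; exists y, z.
    by split=> //; apply: qn_dec.
have qnn : qn n `<=` qn n.+1.
  apply: (@nakayama_saturated P) => [s a Ps|a an].
    by apply: qn_sat => /qP.
  have [|s [Ps [b [_ [qb /ideal_span1P[c ->] E]]]]] := In a.
    by apply: saturation_sub; apply: ideal_addl.
  exists s; split=> //; exists b, (x * c); split=> //; last by rewrite E [x * c]mulrC.
  apply: ideal_mul_mem => //; apply: (qn_sat n x) => //.
  have -> : x * c = s * a - b by rewrite E mulrC addrC addKr.
  by apply: idealB; [apply: idealM|apply: qn_dec].
suff qnp : ideal_exp q n `<=` p.
  by move=> a qa; apply: (@prime_pow _ _ n); apply: qnp; apply: ideal_exp_pow.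
apply: (@nakayama_saturated q) => [s a qs /specM[/pq//|//]|a an].
have [|s [qs [y [z [yq pz E]]]]] := qnn a.
  by apply: saturation_sub; apply: ideal_addl.
by exists s; split=> //; exists z, y; split=> //; rewrite E addrC.
Qed.

(** Descending along the chain, the principal ideal theorem replaces its primes by
    primes that contain [x]. *)
Lemma chain_through (c : nat -> spec A) k x : prime_chain c k.+1 -> c k.+1 x ->
  exists c', [/\ prime_chain c' k.+1, c' 0%N = c 0%N, c' k.+1 = c k.+1 & c' 1%N x].
Proof.
elim: k c => [|k IH] c cC cx; first by exists c.
have [Q [cQ Qc Qx]] := principal_ideal_theorem (cC k (leqW (leqnn _))) (cC k.+1 (leqnn _)) cx.
have [||c' [c'C c'0 c'k c'x]] := IH (fun i => if (i <= k)%N then c i else Q).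
- move=> i; rewrite ltnS => ik; rewrite ik; case: ltnP => ki; first exact/cC/leqW/leqW.
  by have -> : i = k by apply/eqP; rewrite eqn_leq ik ki.
- by rewrite ltnn.
exists (fun i => if (i <= k.+1)%N then c' i else c i); split=> //=; last by rewrite ltnn.
move=> i; rewrite ltnS => ik; rewrite ik; case: ltnP => ki; first exact: c'C.
have -> : i = k.+1 by apply/eqP; rewrite eqn_leq ik ki.
by rewrite c'k ltnn.
Qed.

End Saturation.

Section RegularLocal.
Variables (A : comPzRingType) (m : ideal A).
Hypotheses (noethA : noetherian A) (mloc : local_ring m).

Let M : spec A := Spec (local_prime noethA mloc).

Let proper_sub (J : ideal A) : ~ J 1 -> J `<=` m.
Proof.
move=> J1 a Ja; apply: contrapT => /(local_unit noethA mloc)[y ay].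
by apply: J1; rewrite -ay; apply: ideal_mulr.
Qed.

Let unit_saturated (J : ideal A) : saturated M J.
Proof.
move=> s a /(local_unit noethA mloc)[y sy] Jsa.
by rewrite -[a]mul1r -sy [s * y]mulrC -mulrA; apply: idealM.
Qed.

Let nakayama (I J : ideal A) : I `<=` ideal_add J (ideal_mul m I) -> I `<=` J.
Proof.
move=> IJ; apply: (nakayama_saturated noethA (P := M)) => //.
by move=> a Ia; apply: saturation_sub; apply: IJ.
Qed.

Let add_cons (I : ideal A) x s : (m : set A) `<=` ideal_add I (ideal_span (x :: s)) ->
  (m : set A) `<=` ideal_add (ideal_add I (ideal_span [:: x])) (ideal_span s).
Proof.
move=> ms a /ms[i [z [Ii zs ->]]].
have : ideal_add (ideal_span [:: x]) (ideal_span s) z.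
  move: zs; apply: ideal_span_sub => y; rewrite inE => /predU1P[->|ys].
    by apply: ideal_addl; apply: ideal_span_mem; rewrite inE.
  by apply: ideal_addr; apply: ideal_span_mem.
move=> [u [v [xu sv ->]]]; exists (i + u), v; split=> //; last by rewrite addrA.
by exists i, u.
Qed.

(** The number of generators of the maximal ideal bounds the length of a chain,
    since a chain may be made to pass through a given generator at its first step. *)
Let chain_bound_max s (I : ideal A) (c : nat -> spec A) k :
  (forall x, x \in s -> m x) -> (m : set A) `<=` ideal_add I (ideal_span s) ->
  prime_chain c k -> (I : set A) `<=` c 0%N -> (m : set A) `<=` c k -> (k <= size s)%N.
Proof.
elim: s I c k => [|x s IH] I c [|k] // sm mIs cC Ic mc.
  have [_] := cC 0%N isT; case=> a ca.
  have /mIs[i [z [Ii zs ->]]] : m a by apply: (proper_sub (@spec1 _ (c 1%N))).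
  apply: idealD; first exact: Ic.
  by move: zs => /ideal_spanP[e ->]; rewrite big_ord0; apply: ideal0.
have [c' [c'C c'0 c'k c'x]] := chain_through noethA cC (mc x (sm x (mem_head _ _))).
have [sub _] := c'C 0%N isT.
rewrite ltnS; apply: (IH _ (fun i => c' i.+1) k _ (add_cons mIs)).
- by move=> y ys; apply: sm; rewrite inE ys orbT.
- by move=> i ik; apply: c'C.
- move=> _ [i [_ [Ii /ideal_span1P[e ->] ->]]]; apply: idealD; last exact: idealM.
  by apply: sub; rewrite c'0; apply: Ic.
- by rewrite c'k.
Qed.

Let chain_bound s (I : ideal A) (c : nat -> spec A) k :
  (forall x, x \in s -> m x) -> (m : set A) `<=` ideal_add I (ideal_span s) ->
  prime_chain c k -> (I : set A) `<=` c 0%N ->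
  (k <= size s)%N /\ (k = size s -> (m : set A) `<=` c k).
Proof.
move=> sm mIs cC Ic.
have [mc|nmc] := pselect ((m : set A) `<=` c k).
  split=> [|_]; last by [].
  exact: (chain_bound_max sm mIs cC Ic mc).
suff ks : (k < size s)%N by split; [apply: ltnW|move=> E; rewrite E ltnn in ks].
apply: (chain_bound_max (c := fun i => if (i <= k)%N then c i else M) sm mIs) => //=.
  move=> i; rewrite ltnS => ik; rewrite ik; case: ltnP => ki; first exact: cC.
  have -> : i = k by apply/eqP; rewrite eqn_leq ik ki.
  by split=> //; apply: proper_sub; apply: spec1.
by rewrite ltnn.
Qed.

(** By induction on the number of generators: an element [x] of [m] outside
    [I + m ^ 2] may serve as one of them, so [I + (x)] is prime; if moreover [x]
    lies outside the first prime [c 0] of the chain, then [I + (x)] contains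
    [c 0] by maximality of the chain, so [c 0] is [I + x * c 0]. *)
Let chain_prime n s (I : ideal A) (c : nat -> spec A) : size s = n ->
  (forall x, x \in s -> m x) -> (m : set A) `<=` ideal_add I (ideal_span s) ->
  prime_chain c n -> (I : set A) `<=` c 0%N -> exists P : spec A, (I : set A) = P.
Proof.
elim: n s I c => [|n IH] s I c sn sm mIs cC Ic.
  exists (c 0%N); rewrite eqEsubset; split=> // a /(proper_sub (@spec1 _ (c 0%N)))/mIs.
  have /size0nil -> := sn; move=> [i [_ [Ii /ideal_spanP[e ->] ->]]].
  by rewrite big_ord0 addr0.
have Im : (I : set A) `<=` m by move=> a /Ic; apply: proper_sub; apply: spec1.
have nmc : ~ (m : set A) `<=` c 0%N.
  move=> mc; have [_] := cC 0%N isT; apply=> a ca.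
  by apply: mc; apply: (proper_sub (@spec1 _ (c 1%N))).
have [y my m2y] : exists2 y, m y & ~ ideal_add I (ideal_mul m m) y.
  apply: contrapT => H; apply: nmc => a ma; apply: Ic; apply: (@nakayama m) => // b mb.
  by apply: contrapT => nb; apply: H; exists b.
have [x [mx m2x cx]] : exists x, [/\ m x, ~ ideal_add I (ideal_mul m m) x & ~ c 0%N x].
  have [cy|cy] := pselect (c 0%N y); last by exists y.
  have [z mz cz] : exists2 z, m z & ~ c 0%N z.
    by apply: contrapT => H; apply: nmc => z mz; apply: contrapT => cz; apply: H; exists z.
  have [m2z|m2z] := pselect (ideal_add I (ideal_mul m m) z); last by exists z.
  exists (y + z); split; first exact: idealD.
    by move=> /idealB /(_ m2z); rewrite addrK.
  by move=> /idealB /(_ cy); rewrite [y + z]addrC addrK.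
pose J := ideal_add I (ideal_span [:: x]).
have [s' [s'n s'm mJs']] : exists s', [/\ size s' = n, forall z, z \in s' -> m z
    & (m : set A) `<=` ideal_add J (ideal_span s')].
  have [i [z [Ii /ideal_spanP[e zE] xE]]] := mIs x mx.
  have [k nek] : exists k : 'I_(size s), ~ m (e k).
    apply: contrapT => H; apply: m2x; exists i, z; split=> //; rewrite zE.
    apply: ideal_sum => k; apply: ideal_mul_mem; last by apply: sm; apply: mem_nth.
    by apply: contrapT => ek; apply: H; exists k.
  have [u eu] := local_unit noethA mloc nek.
  exists (take k s ++ drop k.+1 s); split.
  - by rewrite size_cat size_take ltn_ord size_drop; move: (ltn_ord k) sn; lia.
  - by move=> w; rewrite mem_cat => /orP[/mem_take|/mem_drop]; apply: sm.
  pose L := ideal_add J (ideal_span (take k s ++ drop k.+1 s)).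

  have Lo (j : 'I_(size s)) : j != k -> L s`_j.
    move=> jk; apply: ideal_addr; apply: ideal_span_mem; rewrite mem_cat.
    have [jlk|kj] := ltnP j k.
      by apply/orP; left; rewrite -(nth_take 0 jlk); apply: mem_nth; rewrite size_take ltn_ord.
    have {}kj : (k < j)%N by rewrite ltn_neqAle eq_sym jk.
    apply/orP; right; rewrite -(subnKC kj) -nth_drop; apply: mem_nth.
    by rewrite size_drop ltn_sub2r // (leq_ltn_trans kj).
  have Lk : L s`_k.
    have -> : s`_k = u * (e k * s`_k) by rewrite mulrA [u * _]mulrC eu mul1r.
    apply: idealM; have -> : e k * s`_k = x - i - \sum_(j < size s | j != k) e j * s`_j.
      by rewrite xE [i + z]addrC addrK zE (bigD1 k) //= addrK.
    apply: idealB; last first.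
      elim/big_ind: _ => [|a b|j jk]; [exact: ideal0|exact: idealD|].
      by apply: idealM; apply: Lo.
    apply: ideal_addl; apply: idealB; last exact: ideal_addl.
    by apply: ideal_addr; apply: ideal_span_mem; rewrite inE.
  move=> a /mIs[i' [_ [Ii' /ideal_spanP[e' ->] ->]]]; apply: idealD.
    by do 2 apply: ideal_addl.
  apply: ideal_sum => j; apply: idealM.
  by have [->//|/Lo] := eqVneq j k.
have [_ mc] := chain_bound sm mIs cC Ic.
have [c' [c'C c'0 c'k c'x]] := chain_through noethA cC (mc (esym sn) x mx).
have [sub _] := c'C 0%N isT.
have Jc' : (J : set A) `<=` c' 1%N.
  move=> _ [i [_ [Ii /ideal_span1P[e ->] ->]]]; apply: idealD; last exact: idealM.
  by apply: sub; rewrite c'0; apply: Ic.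
have c'C' : prime_chain (fun i => c' i.+1) n by move=> i ik; apply: c'C.
have [P JP] := IH s' J (fun i => c' i.+1) s'n s'm mJs' c'C' Jc'.
have cJ : (c 0%N : set A) `<=` J.
  apply: contrapT => ncJ.
  suff /chain_bound : prime_chain (fun i => if i is j.+1 then c' j.+1 else P) n.+1.
    move=> /(_ _ J s'm mJs') [|+ _]; last by rewrite s'n ltnn.
    by rewrite JP.
  move=> [|i] ik; last exact: c'C.
  rewrite -JP; split=> // c'J; apply: ncJ => a; rewrite -c'0 => /sub; exact: c'J.
exists (c 0%N); rewrite eqEsubset; split=> //; apply: nakayama => a ca.
have [i [_ [Ii /ideal_span1P[b ->] aE]]] := cJ a ca.
exists i, (b * x); split=> //; rewrite mulrC; apply: ideal_mul_mem => //.
have : c 0%N (b * x).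
  by have -> : b * x = a - i; [rewrite aE addrC addKr|apply: idealB => //; apply: Ic].
by case/specM.
Qed.

Lemma chain_generators_domain s (c : nat -> spec A) :
  (m : set A) = ideal_span s -> prime_chain c (size s) -> domain A.
Proof.
move=> mE cC; have [||||P PE] := @chain_prime (size s) s (ideal_bot A) c _ _ _ cC => //.
- by move=> x xs; rewrite mE; apply: ideal_span_mem.
- by move=> a; rewrite mE; apply: ideal_addr.
- by move=> a ->; apply: ideal0.
move=> a b ab; have : P (a * b) by rewrite -PE ab.
by case/specM; rewrite -PE; [left|right].
Qed.

End RegularLocal.

Lemma regular_local_domain (A : comPzRingType) : regular_local A ->
  ~ (1 = 0 :> A) /\ domain A.
Proof.
move=> [noethA [m [s [mloc [[c cC] _] mE]]]]; split.
  by move=> A0; have [[m1 _] _] := mloc; apply: m1; rewrite A0; apply: ideal0.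
exact: (chain_generators_domain noethA mloc mE cC).
Qed.

(** * Nilpotents of the completion of an excellent ring *)

(** A local ring of a regular ring is a domain, so no prime contains the
    annihilator of a nilpotent. *)
Lemma regular_ring_reduced (A : comPzRingType) (w : A) n :
  regular_ring A -> w ^+ n = 0 -> w = 0.
Proof.
move=> [noethA regA] wn; apply: contrapT => w0.
have @S : mult_set A.
  by exists [set z | z = 1] => [//|x y]; rewrite /mkset => -> ->; rewrite mulr1.
have [|P [wP _]] := @prime_avoiding _ noethA (ideal_colon (ideal_bot A) w) S.
  move=> x xw x1; apply: w0; have xE : x = 1 := x1.
  by rewrite -[w]mulr1 -xE; exact: xw.
have /regular_local_domain[l0 domP] : regular_local (loc_prime P).
  have : [set: spec A] P := I.
  rewrite -regA.
  exact.
have : to_loc (prime_compl P) w = 0.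
  have : to_loc (prime_compl P) w ^+ n = 0 by rewrite -rmorphXn wn rmorph0.
  elim: n {wn} => [/l0//|n IH]; rewrite exprS => /domP[//|].
  exact: IH.
by move=> /to_loc0[u Pu uw]; apply: Pu; apply: wP; have : w * u = 0 by rewrite mulrC.
Qed.

Section ResidueField.
Variables (A : comPzRingType) (q : spec A).
Local Notation kappa := (residue_field q).
Let loc_q : {rmorphism A -> loc_prime q} := to_loc_prime q.

Lemma loc_prime_ideal_frac l : loc_prime_ideal q l ->
  exists a s, [/\ q a, ~ q s & l * loc_q s = loc_q a].
Proof.
have @K : ideal (loc_prime q).
  exists [set l | exists a s, [/\ q a, ~ q s & l * loc_q s = loc_q a]].
  - by exists 0, 1; split; [apply: ideal0|apply: spec1|rewrite rmorph0 mul0r].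
  - move=> l1 l2 [a [s [qa qs E]]] [a' [s' [qa' qs' E']]].
    exists (a * s' + a' * s), (s * s'); split; [|exact: spec_mul|].
      by apply: idealD; apply: ideal_mulr.
    by rewrite rmorphD !rmorphM -E -E'; ring.
  - move=> b l1 [a [s [qa qs E]]]; have [c [t [qt E']]] := loc_frac b.
    exists (c * a), (t * s); split; [exact: idealM|exact: spec_mul|].
    have {}E' : b * loc_q t = loc_q c := E'.
    by rewrite !rmorphM -E -E'; ring.
apply: (@ideal_gen_sub _ _ K) => _ [a qa <-]; exists a, 1.
by split=> //; [apply: spec1|rewrite rmorph1 mulr1].
Qed.

Lemma residue_field1_neq0 : 1 != 0 :> kappa.
Proof.
apply/eqP; rewrite -(rmorph1 (to_quot (loc_prime_ideal q))).
move=> /to_quot0/loc_prime_ideal_frac[a [s [qa qs]]]; rewrite mul1r => /to_loc_eq[u qu E].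
by apply: (spec_mul (qu : ~ q u) qs); rewrite E; apply: idealM.
Qed.

Lemma residue_field_inv (x : kappa) : x != 0 -> exists y, y * x = 1.
Proof.
have [l ->] := to_quot_surj x; move=> /eqP l0; have [a [s [qs E]]] := loc_frac l.
have qa : ~ q a.
  move=> qa; apply: l0; apply/to_quot0.
  have [s' ss'] := to_loc_unit qs.
  rewrite -[l]mulr1 -ss' mulrA E; apply: ideal_mulr.
  by apply: sub_ideal_gen; exists a.
have [a' aa'] := @to_loc_unit _ (prime_compl q) _ qa.
exists (to_quot _ (loc_q s * a')).
rewrite -rmorphM (_ : _ * l = 1) ?rmorph1 //.
by rewrite -aa' -E; ring.
Qed.

End ResidueField.

(** The fibre over [q] maps to the localization of [B / q B] at the image of
    the complement of [q]; being reduced, it shows which multiples of a nilpotent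
    lie in [q B]. *)
Lemma regular_fibre_nilpotent (A B : comPzRingType) (f : {rmorphism A -> B})
    (q : spec A) (z : B) n : geometrically_regular_fibres f -> z ^+ n = 0 ->
  exists a, ~ q a /\ ideal_gen (f @` q) (f a * z).
Proof.
move=> /(_ q) regf zn.
pose kappa := residue_field q; pose res : {rmorphism A -> kappa} := to_residue_field q.
pose L : fieldType := fieldring (@residue_field1_neq0 A q) (@residue_field_inv A q).
pose h : {rmorphism kappa -> L} := idfun : {rmorphism kappa -> kappa}.
have finh : finite_algebra h.
  exists 1%N, (fun=> 1); rewrite eqEsubset; split=> // x _.
  by exists (fun=> x) => //; rewrite big_ord1 mulr1.
have regF := regf L h finh.
pose y : tensor f res := tens f res z 1.
pose w : tensor (tens_inr f res) h := tens (tens_inr f res) h y 1.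
have w0 : w = 0.
  by apply: (regular_ring_reduced (n := n) regF); rewrite /w tensX /y tensX zn !tens0l.
pose J := ideal_gen (f @` q); pose pi : {rmorphism B -> quot J} := to_quot J.
have @S : mult_set (quot J).
  exists [set s | exists2 a, ~ q a & s = pi (f a)].
  - by exists 1; [apply: spec1|rewrite !rmorph1].
  - move=> _ _ [a qa ->] [b qb ->]; exists (a * b); first exact: spec_mul.
    by rewrite !rmorphM.
pose u : {rmorphism B -> loc S} := to_loc S \o pi.
have [v0 v0E] : exists v0 : {rmorphism loc_prime q -> loc S},
    forall a, v0 (to_loc_prime q a) = u (f a).
  apply: (@loc_lift _ (prime_compl q) _ (u \o f)) => s qs.
  by apply: to_loc_unit; exists s.
have [v vE] : exists v : {rmorphism kappa -> loc S}, forall l, v (to_quot _ l) = v0 l.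
  apply: quot_lift => l /loc_prime_ideal_frac[a [s [qa qs E]]].
  have ua : u (f a) = 0.
    rewrite /u /= (_ : pi (f a) = 0) ?rmorph0 //.
    by apply/to_quot0; apply: sub_ideal_gen; exists a.
  have [s' ss'] := @to_loc_unit _ (prime_compl q) _ qs.
  by rewrite -[l]mulr1 -ss' mulrA E rmorphM [v0 _]v0E ua mul0r.
have vres a : v (res a) = u (f a) by rewrite [LHS]vE v0E.
have [k kE] := tens_lift (fun a => esym (vres a)).
pose vL : {rmorphism L -> loc S} := v.
have [|k' k'E] := @tens_lift _ _ _ (tens_inr f res) h _ k vL.
  by move=> x; rewrite /tens_inr /= [LHS]kE rmorph1 mul1r.
have : k' w = 0 by rewrite w0 rmorph0.
rewrite /w [LHS]k'E [vL 1]rmorph1 mulr1 /y kE rmorph1 mulr1 => /to_loc0[_ [a qa ->]].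
rewrite -rmorphM => /to_quot0 H; exists a; split=> //.
Qed.

Lemma completion_map (A B : comPzRingType) (I : ideal A) (J : ideal B)
    (f : {rmorphism A -> B}) : (forall a, I a -> J (f a)) ->
  exists phi : {rmorphism completion I -> completion J},
    forall (t : completion I) n x, t n = to_quot _ x -> phi t n = to_quot _ (f x).
Proof.
move=> fIJ; have fexp n a : ideal_exp I n a -> ideal_exp J n (f a).
  elim: n a => [|n IH] a; first by move=> _; apply: ideal_exp0.
  apply: (@ideal_expS_sub _ _ _ (ideal_preim f (ideal_exp J n.+1))) => y z Iy Iz.
  by rewrite /ideal_preim /ideal_set rmorphM; apply: ideal_expS_mem; [apply: fIJ|apply: IH].
have feq n x y : to_quot (ideal_exp I n) x = to_quot _ y ->
    to_quot (ideal_exp J n) (f x) = to_quot _ (f y).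
  by move=> /to_quot_eq xy; apply/to_quot_eq; rewrite -rmorphB; apply: fexp.
pose F (t : completion I) n : quot (ideal_exp J n) :=
  to_quot _ (f (sval (cid (to_quot_surj (t n))))).
have FE (t : completion I) n x : t n = to_quot _ x -> F t n = to_quot _ (f x).
  by move=> tx; rewrite /F; case: cid => y /= ty; apply: feq; rewrite -ty.
have FP (t : completion I) n : exists x, F t n = to_quot _ x /\ F t n.+1 = to_quot _ x.
  by have [x [tx tx']] := cmplP t n; exists (f x); split; apply: FE.
pose phi (t : completion I) : completion J := Completion (FP t).
have phiB : zmod_morphism phi.
  move=> s t; apply: cmpl_inj => n; have [x sx] := to_quot_surj (s n).
  have [y ty] := to_quot_surj (t n).
  have E : (s - t : completion I) n = to_quot _ (x - y).
    by rewrite -[LHS]/(s n - t n) sx ty rmorphB.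
  rewrite [LHS](FE _ _ _ E) -[RHS]/(F s n - F t n) (FE _ _ _ sx) (FE _ _ _ ty).
  by rewrite -!rmorphB.
have phiM : monoid_morphism phi.
  split=> [|s t]; apply: cmpl_inj => n.
    rewrite [LHS](FE (1 : completion I) n 1 _); first by rewrite rmorph1.
    exact: (rmorph1 (to_quot _)).
  have [x sx] := to_quot_surj (s n); have [y ty] := to_quot_surj (t n).
  have E : (s * t : completion I) n = to_quot _ (x * y).
    by rewrite -[LHS]/(s n * t n) sx ty rmorphM.
  rewrite [LHS](FE _ _ _ E) -[RHS]/(F s n * F t n) (FE _ _ _ sx) (FE _ _ _ ty).
  by rewrite -!rmorphM.
by exists (mk_rmorphism phiB phiM) => t n x /FE.
Qed.

Section CompletionNilpotents.
Variables (R : comNzRingType) (m : ideal R).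
Hypotheses (noethR : noetherian R) (mloc : local_ring m).
Local Notation T := (completion m).
Local Notation iota := (to_completion m).

(** The condition on the fibres concerns the completion of the localization of [R] at
    the maximal ideal, which is mapped back to the completion of [R]. *)
Let nilpotent_fibre (q : spec R) (z : T) n : G_ring R -> z ^+ n = 0 ->
  exists a, ~ q a /\ ideal_gen (iota @` q) (iota a * z).
Proof.
pose M : spec R := Spec (local_prime noethR mloc).
move=> /(_ M) gfib zn.
pose j : {rmorphism R -> loc_prime M} := to_loc_prime M.
have [g gE] : exists g : {rmorphism loc_prime M -> R}, forall a, g (j a) = a.
  by apply: (@loc_lift _ (prime_compl M) _ idfun) => s /(local_unit noethR mloc).
have [phi phiE] : exists phi : {rmorphism T -> completion (loc_prime_ideal M)},
    forall (t : T) n x, t n = to_quot _ x -> phi t n = to_quot _ (j x).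
  by apply: completion_map => a ma; apply: sub_ideal_gen; exists a.
have [psi psiE] : exists psi : {rmorphism completion (loc_prime_ideal M) -> T},
    forall (t : completion (loc_prime_ideal M)) n x, t n = to_quot _ x ->
    psi t n = to_quot _ (g x).
  apply: completion_map; apply: (@ideal_gen_sub _ _ (ideal_preim g m)) => _ [a ma <-].
  by rewrite /ideal_preim /ideal_set [g _]gE.
have psi_phi t : psi (phi t) = t.
  apply: cmpl_inj => n'; have [x tx] := to_quot_surj (t n').
  by rewrite (psiE _ _ _ (phiE _ _ _ tx)) gE tx.
have psi_iota l : psi (to_completion (loc_prime_ideal M) l) = iota (g l).
  by apply: cmpl_inj => n'; apply: psiE.
have @q' : spec (loc_prime M).
  exists (ideal_preim g q); split; rewrite /ideal_preim /ideal_set ?rmorph1; first exact: spec1.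
  by move=> x y; rewrite rmorphM; apply: specM.
have phin : phi z ^+ n = 0 by rewrite -rmorphXn zn rmorph0.
have [a [qa az]] := regular_fibre_nilpotent q' gfib phin.
exists (g a); split; first exact: qa.
rewrite -psi_iota -[z]psi_phi -rmorphM.
move: az; apply: (@ideal_gen_sub _ _ (ideal_preim psi (ideal_gen (iota @` q)))) => _ [b qb <-].
rewrite /ideal_preim /ideal_set psi_iota; apply: sub_ideal_gen.
by exists (g b).
Qed.

(** A zero divisor lies in an annihilator that is maximal among those of nonzero
    elements, hence in an associated prime, which is minimal. *)
Let avoid_nonzerodivisor (l : seq (spec R)) x : serre_S1 R ->
  (forall y, (forall p, List.In p l -> p y) -> exists n, y ^+ n = 0) ->
  (forall p, List.In p l -> ~ p x) -> nonzerodivisors R x.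
Proof.
move=> S1 lnil lx y xy; apply: contrapT => y0.
pose F : set (ideal R) := [set I | exists2 w, w <> 0 & (I : set R) = [set a | w * a = 0]].
have Fy : F (ideal_colon (ideal_bot R) y) by exists y.
have [P [[w w0 PE] yP Pmax]] := noetherian_max noethR Fy.
have Pw a : P a <-> w * a = 0 by rewrite PE.
have primeP : prime_ideal P.
  split=> [/Pw|a b /Pw wab]; first by rewrite mulr1.
  have [wa|wa] := pselect (w * a = 0); first by left; apply/Pw.
  right; apply: (Pmax (ideal_colon (ideal_bot R) (w * a))).
  - by exists (w * a).
  - move=> c /Pw wc; have E : w * a * c = 0 by rewrite mulrAC wc mul0r.
    exact: E.
  - have E : w * a * b = 0 by rewrite -mulrA.
    exact: E.
pose p : spec R := Spec primeP.
have pmin : minimal_prime p.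
  by apply: S1; exists w; rewrite [LHS]PE; apply/funext => a; rewrite /ann /mkset mulrC.
have px : p x by apply: yP; have E : y * x = 0; [rewrite mulrC|exact: E].
have [q lq qp] : exists2 q, List.In q l & (q : set R) `<=` p.
  apply: contrapT => noq; have [|a [la pa]] := @list_prod_notin _ p l.
    move=> q lq; apply: contrapT => H; apply: noq; exists q => // a qa.
    by apply: contrapT => pa; apply: H; exists a.
  have [n an] := lnil a la; apply: pa; apply: (@prime_pow _ _ n).
  by rewrite an; apply: ideal0.
exact: (lx q lq (pmin q qp x px)).
Qed.

Hypotheses (GR : G_ring R) (S1 : serre_S1 R).

Let NT := ideal_gen (iota @` @nilradical R).

(** Multiples of [z] in the extension of a minimal prime [q] become multiples in the
    extension of the nilradical after multiplication by an element of the other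
    minimal primes; so the multipliers that bring [z] there form an ideal that no
    minimal prime contains. *)
Let nilpotent_multiple (z : T) n : z ^+ n = 0 ->
  exists2 x, nonzerodivisors R x & NT (iota x * z).
Proof.
move=> zn; have [l [lmin lnil]] := minimal_primes noethR.
pose Iz := ideal_preim iota (ideal_colon NT z).
have IzE a : Iz a = NT (z * iota a) by [].
have [||x [Ix lx]] := @prime_avoidance _ Iz l.
- by move=> p q pl ql pq; apply: (lmin q ql p pq).
- move=> q lq Izq; have [a [qa az]] := nilpotent_fibre q GR zn.
  have [|b [lb qb]] := @list_prod_notin _ q
      (List.filter (fun p : spec R => `[< ~ ((p : set R) `<=` q) >]) l).
    by move=> p /List.filter_In[_ /asboolP] /existsNP[y /not_implyP pP]; exists y.
  suff /Izq : Iz (b * a) by apply: spec_mul.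
  rewrite IzE rmorphM mulrC -mulrA.
  move: az; apply: (@ideal_gen_sub _ _ (ideal_colon NT (iota b))) => _ [c qc <-].
  suff E : NT (iota b * iota c) by exact: E.
  rewrite -rmorphM; apply: sub_ideal_gen; exists (b * c) => //.
  apply: lnil => p pl; have [pq|pq] := pselect ((p : set R) `<=` q).
    by apply: idealM; apply: (lmin q lq p pq).
  by apply: ideal_mulr; apply: lb; apply/List.filter_In; split=> //; apply/asboolP.
exists x; first exact: avoid_nonzerodivisor lx.
by rewrite mulrC -IzE.
Qed.

(** Two nilpotents [z], [z'] of the completion have multiples by nonzerodivisors of [R]
    in the extension of the nilradical of [R], which has square zero. *)
Lemma completion_nilradical_sq0 : nilradical_sq0 R -> nilradical_sq0 T.
Proof.
move=> N2; have NT2 u v : NT u -> NT v -> u * v = 0.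
  move=> Nu Nv; suff vN : NT `<=` ideal_colon (ideal_bot T) v.
    by rewrite mulrC; apply: (vN u Nu).
  apply: ideal_gen_sub => _ [a Na <-].
  have aN : NT `<=` ideal_colon (ideal_bot T) (iota a).
    apply: ideal_gen_sub => _ [b Nb <-].
    have E : iota a * iota b = 0 by rewrite -rmorphM (nilradical_mul0 N2 Na Nb) rmorph0.
    exact: E.
  have E : v * iota a = 0 by rewrite mulrC; apply: (aN v Nv).
  exact: E.
rewrite /nilradical_sq0 eqEsubset; split=> [|_ ->]; last exact: ideal0.
apply: (@ideal_mul_sub _ _ _ (ideal_bot T)) => z z' [n zn] [n' zn'].
have [x xreg xz] := nilpotent_multiple zn; have [x' x'reg xz'] := nilpotent_multiple zn'.
suff E : z * z' = 0 by exact: E.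
apply: (cmpl_nzd noethR xreg); apply: (cmpl_nzd noethR x'reg).
by rewrite -(NT2 _ _ xz xz'); ring.
Qed.

End CompletionNilpotents.

Local Close Scope classical_set_scope.

Theorem theorem1p1 (R : comNzRingType) (m : ideal R)
    (noetherianR : noetherian R) (localR : local_ring m)
    (depthR : depth_gt m 0) :
  (serre_S1 (completion m) -> nilradical_sq0 (completion m) ->
     fg_submodule (@to_int_closure R) (strict_closure (@to_int_closure R))) /\
  (excellent R -> serre_S1 R ->
     (fg_submodule (@to_int_closure R) (strict_closure (@to_int_closure R)) <->
      nilradical_sq0 R)).
Proof.
split=> [_ N2|[_ _ GR _] S1]; first exact: (strict_closure_fg noetherianR localR N2).
split=> [fg|N2]; first exact: (nilradical_sq0_of_fg noetherianR localR depthR fg).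
apply: (strict_closure_fg noetherianR localR).
exact: (completion_nilradical_sq0 noetherianR localR GR S1 N2).
Qed.
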